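(* Let $(M,\omega)$ be a compact simply connected pseudo-Einstein symplectic manifold, with $c_1(K^{-1})=k[\omega]$, and let $S\subset M$ be an orientable Bohr–Sommerfeld Lagrangian submanifold. Then the universal Maslov class of $S$ is well defined, i.e. it does not depend on the choice of $I$ and $a$: for any two almost complex structures $I,I'$ compatible with $\omega$, and any reference connections $a$ for $I$ and $a'$ for $I'$, one has $m_S(I,a)=m_S(I',a')$ in $H^1(S,\mathbb Z)$.
   Context: Let $(M,\omega)$ be a symplectic manifold of dimension $2n$. For an $\omega$-compatible almost complex structure $I$, let $G$ be the corresponding Riemannian metric; $(\omega,G,I)$ gives a Hermitian structure on the complex bundle $(TM,I)\cong T^{1,0}M$. The anticanonical line bundle is $K^{-1}=\Lambda^n_{\mathbb C}(TM,I)$ with the induced Hermitian structure $h$; $\mathcal A_h(K^{-1})$ is the space of Hermitian ($U(1)$-) connections on it. The class $c_1(K^{-1})$ is independent of $I$. $(M,\omega)$ is pseudo-Einstein if $c_1(K^{-1})=k[\omega]$ (in real cohomology) for some real constant $k$. Curvature convention: a Hermitian connection is locally $d+A$ with $A$ an $i\mathbb R$-valued 1-form, and its curvature is $F=dA$, so $c_1=[\tfrac{i}{2\pi}F]$. A reference connection for $I$ is $a\in\mathcal A_h(K^{-1})$ with $F_a=-2\pi i k\,\omega$. As $M$ is simply connected, for a given $I$ such connections exist and form a single orbit of the gauge group $\mathrm{Map}(M,U(1))$. A smooth embedded Lagrangian submanifold $S\subset M$ is Bohr–Sommerfeld (with respect to the anticanonical bundle) if the flat connection $a|_S$ on $K^{-1}|_S$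 has trivial holonomy character on $\pi_1(S)$, where $a$ is a reference connection. This condition does not depend on the choice of $I$ and $a$. For an orientable Lagrangian $S$, the canonical trivial connection $A_0\in\mathcal A_h(K^{-1}|_S)$ induced by $I$ is the flat connection for which the unit section $e_1\wedge\dots\wedge e_n$ of $K^{-1}|_S$ is parallel, where $(e_1,\dots,e_n)$ is any local oriented $G$-orthonormal frame of $TS$ (the section is globally defined up to the sign given by the orientation, so $A_0$ does not depend on the orientation). If $S$ is orientable Bohr–Sommerfeld, both $a|_S$ and $A_0$ are flat with trivial holonomy, so there is a gauge transformation $g_S:S\to U(1)$ (unique up to a constant on each component) relating them, with $a|_S-A_0=g_S^{-1}dg_S$. Put $m_S(I,a)=g_S^*\mathbf h\in H^1(S,\mathbb Z)$, with $\mathbf h\in H^1(U(1),\mathbb Z)$ the positive generator; equivalently $m_S(I,a)([\gamma])=\frac1{2\pi i}\int_\gamma(a|_S-A_0)$ for loops $\gamma\subset S$. The universal Maslov class is $m_S=m_S(I,a)$. *)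

(* Defs.v *)
From HB Require Import structures.
From mathcomp Require Import all_boot all_order all_algebra.
From mathcomp Require Import all_classical all_reals all_analysis.
From mathcomp Require Import complex.
Import numFieldNormedType.Exports.
Set Implicit Arguments.
Unset Strict Implicit.
Unset Printing Implicit Defensive.
Import Order.TTheory GRing.Theory Num.Theory.
Local Open Scope classical_set_scope.
Local Open Scope ring_scope.
Local Notation Re := complex.Re.
Local Notation Im := complex.Im.

(** * Smooth manifolds *)

Fixpoint Ck (R : realType) (m : nat) (k : nat) (U : set 'rV[R]_m)
    (f : 'rV[R]_m -> R) {struct k} : Prop :=
  match k with
  | 0%N => forall x, U x -> {for x, continuous f}
  | k'.+1 => (forall x, U x -> differentiable f x) /\
             forall j : 'I_m, Ck k' U (fun x => 'D_(delta_mx 0 j) f x)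
  end.

Definition smooth_on (R : realType) (m : nat) (U : set 'rV[R]_m)
  (f : 'rV[R]_m -> R) : Prop := forall k, Ck k U f.

(* The chart [c] is the homeomorphism [cmap c] from the open set [cdom c] onto
   its open image, with inverse [cinv c]; both are meaningless elsewhere.
   [chart_at p] is a preferred chart around [p], used only to encode tangent
   vectors: T_pM is 'rV[R]_m, a row vector being read as the components in the
   chart [chart_at p]. *)
Record manifold (R : realType) (m : nat) := Manifold {
  mcarrier :> topologicalType;
  chart : Type;
  cdom : chart -> set mcarrier;
  cmap : chart -> mcarrier -> 'rV[R]_m;
  cinv : chart -> 'rV[R]_m -> mcarrier;
  chart_at : mcarrier -> chart;
  manifold_hausdorff : hausdorff_space mcarrier;
  manifold_countable : @second_countable mcarrier;
  cdom_open : forall c, open (cdom c);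
  cdom_chart_at : forall p, cdom (chart_at p) p;
  cimage_open : forall c, open (cmap c @` cdom c);
  cmapK : forall c p, cdom c p -> cinv c (cmap c p) = p;
  cmap_continuous : forall c p, cdom c p -> {for p, continuous (cmap c)};
  cinv_continuous : forall c x, (cmap c @` cdom c) x ->
    {for x, continuous (cinv c)};
  transition_smooth : forall c c' k,
    smooth_on (cmap c @` (cdom c `&` cdom c')) (fun x => cmap c' (cinv c x) 0 k)
}.

Arguments chart {R m} _.
Arguments cdom {R m M} _ _ : rename.
Arguments cmap {R m M} _ _ : rename.
Arguments cinv {R m M} _ _ : rename.
Arguments chart_at {R m M} _ : rename.

Section Tangent.
Context {R : realType}.

(* smooth in a neighbourhood of q *)
Definition smooth_at (m : nat) (N : manifold R m) (q : N) (f : N -> R) : Prop :=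
  exists U : set N, [/\ open U, U q &
    forall c : chart N, smooth_on (cmap c @` (U `&` cdom c)) (f \o cinv c)].

Definition csmooth_at (m : nat) (N : manifold R m) (q : N) (f : N -> R[i]) : Prop :=
  smooth_at q (fun p => Re (f p)) /\ smooth_at q (fun p => Im (f p)).

(* the differential of a function, and the partial derivative in the j-th
   coordinate of the chart c *)
Definition tderiv (m : nat) (N : manifold R m) (f : N -> R) (q : N)
    (v : 'rV[R]_m) : R :=
  'D_v (f \o cinv (chart_at q)) (cmap (chart_at q) q).

Definition ctderiv (m : nat) (N : manifold R m) (f : N -> R[i]) (q : N)
    (v : 'rV[R]_m) : R[i] :=
  (tderiv (fun p => Re (f p)) q v +i* tderiv (fun p => Im (f p)) q v)%C.

Definition pderiv (m : nat) (N : manifold R m) (c : chart N) (j : 'I_m)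
    (f : N -> R) (q : N) : R :=
  'D_(delta_mx 0 j) (f \o cinv c) (cmap c q).

Definition cpderiv (m : nat) (N : manifold R m) (c : chart N) (j : 'I_m)
    (f : N -> R[i]) (q : N) : R[i] :=
  (pderiv c j (fun p => Re (f p)) q +i* pderiv c j (fun p => Im (f p)) q)%C.

Definition smooth_map (d m : nat) (N : manifold R d) (M : manifold R m)
    (F : N -> M) : Prop :=
  continuous F /\ forall q (c : chart M) k, cdom c (F q) ->
    smooth_at q (fun p => cmap c (F p) 0 k).

Definition tmap (d m : nat) (N : manifold R d) (M : manifold R m)
    (F : N -> M) (q : N) (v : 'rV[R]_d) : 'rV[R]_m :=
  'D_v (cmap (chart_at (F q)) \o F \o cinv (chart_at q)) (cmap (chart_at q) q).

(* the coordinate vector d/dx_j of the chart c, as an element of T_pM *)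
Definition cvec (m : nat) (M : manifold R m) (c : chart M) (j : 'I_m) (p : M) :
    'rV[R]_m :=
  'D_(delta_mx 0 j) (cmap (chart_at p) \o cinv c) (cmap c p).

(* the components in the chart c of v in T_pM *)
Definition ccomp (m : nat) (M : manifold R m) (c : chart M) (p : M)
    (v : 'rV[R]_m) : 'rV[R]_m :=
  'D_v (cmap c \o cinv (chart_at p)) (cmap (chart_at p) p).

(* X is, in a neighbourhood of q, a smooth section of F^*TM *)
Definition smooth_vf (d m : nat) (N : manifold R d) (M : manifold R m)
    (F : N -> M) (q : N) (X : N -> 'rV[R]_m) : Prop :=
  forall c : chart M, cdom c (F q) ->
    forall k, smooth_at q (fun p => ccomp c (F p) (X p) 0 k).

(** A 2-form is given by its matrix at each point. *)

Definition bil (m : nat) (M : manifold R m) (w : M -> 'M[R]_m) (p : M)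
  (u v : 'rV[R]_m) : R := (u *m w p *m v^T) 0 0.

Definition bil_coord (m : nat) (M : manifold R m) (w : M -> 'M[R]_m)
    (c : chart M) (j l : 'I_m) (p : M) : R :=
  bil w p (cvec c j p) (cvec c l p).

Definition symplectic (m : nat) (M : manifold R m) (w : M -> 'M[R]_m) : Prop :=
  [/\ forall p, (w p)^T = - w p,
      forall p, w p \in unitmx,
      forall (c : chart M) p j l, cdom c p -> smooth_at p (bil_coord w c j l) &
      forall (c : chart M) p j l r, cdom c p ->
        pderiv c j (bil_coord w c l r) p + pderiv c l (bil_coord w c r j) p
          + pderiv c r (bil_coord w c j l) p = 0].

(* I p acts on tangent (row) vectors by v |-> v *m I p *)
Definition compatible (m : nat) (M : manifold R m) (w : M -> 'M[R]_m)
    (I : M -> 'M[R]_m) : Prop :=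
  [/\ forall p, I p *m I p = - 1%:M,
      forall (c : chart M) p j, cdom c p ->
        smooth_vf (fun x : M => x) p (fun x => cvec c j x *m I x),
      forall p u v, bil w p (u *m I p) (v *m I p) = bil w p u v &
      forall p v, v != 0 -> 0 < bil w p v (v *m I p)].

Definition metric (m : nat) (M : manifold R m) (w I : M -> 'M[R]_m) (p : M)
  (u v : 'rV[R]_m) : R := bil w p u (v *m I p).

(* the Hermitian form G - i w, complex linear in its first argument *)
Definition herm (m : nat) (M : manifold R m) (w I : M -> 'M[R]_m) (p : M)
    (u v : 'rV[R]_m) : R[i] :=
  (metric w I p u v +i* - bil w p u v)%C.

End Tangent.

(** * The top exterior power over the complex numbers *)

Section Exterior.
Context {R : realType} (m n : nat).

Definition cact (J : 'M[R]_m) (z : R[i]) (v : 'rV[R]_m) : 'rV[R]_m :=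
  Re z *: v + Im z *: (v *m J).

Definition upd (v : 'I_n -> 'rV[R]_m) (j : 'I_n) (x : 'rV[R]_m) :
    'I_n -> 'rV[R]_m := fun i => if i == j then x else v i.

(* complex n-linear alternating forms on (R^m, J) *)
Definition calt (J : 'M[R]_m) (al : ('I_n -> 'rV[R]_m) -> R[i]) : Prop :=
  (forall v j z x y, al (upd v j (cact J z x + y))
     = z * al (upd v j x) + al (upd v j y)) /\
  (forall v i j, i != j -> v i = v j -> al v = 0).

(* Lambda^n_C(R^m, J) is the complex dual of the space [calt J]; its elements
   are extended by 0 outside [calt J], so that they all live in one type
   whatever J is. *)
Definition mvec := (('I_n -> 'rV[R]_m) -> R[i]) -> R[i].

Definition ext_power (J : 'M[R]_m) : set mvec :=
  [set L | (forall al, ~ calt J al -> L al = 0) /\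
           (forall z al be, calt J al -> calt J be ->
              L ((z \*o al) \+ be) = z * L al + L be)].

Definition wedge (J : 'M[R]_m) (v : 'I_n -> 'rV[R]_m) : mvec :=
  fun al => if `[< calt J al >] then al v else 0.

End Exterior.

Arguments mvec : clear implicits.

(* The form on Lambda^n induced by a Hermitian form h: on decomposable elements
   <v_1 /\ .. /\ v_n, w_1 /\ .. /\ w_n> = det (h v_i w_j). *)
Definition ext_herm (R : realType) (m n : nat)
    (h : 'rV[R]_m -> 'rV[R]_m -> R[i]) (L L' : mvec R m n) : R[i] :=
  L (fun v => (L' (fun w => \det (\matrix_(i < n, j < n) h (w i) (v j))))^*%C).

(** * Hermitian connections on the anticanonical bundle *)

Section Connection.
Context {R : realType} {n d : nat}.
Variables (N : manifold R d) (M : manifold R (2 * n)).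

Definition section := N -> mvec R (2 * n) n.
Definition connection := section -> N -> 'rV[R]_d -> mvec R (2 * n) n.

Variables (F : N -> M) (w I : M -> 'M[R]_(2 * n)).

(* s is, in a neighbourhood of q, a smooth section of F^*K^-1 *)
Definition smooth_section (q : N) (s : section) : Prop :=
  exists (X : 'I_n -> N -> 'rV[R]_(2 * n)) (f : N -> R[i]),
    [/\ forall i, smooth_vf F q (X i), csmooth_at q f &
        \forall p \near q, s p = f p \*o wedge (I (F p)) (fun i => X i p)].

Definition hK (q : N) (L L' : mvec R (2 * n) n) : R[i] :=
  ext_herm (herm w I (F q)) L L'.

(* A connection on F^*K^-1 is a covariant derivative acting on local sections:
   [nabla s q v] depends on the germ of s at q only, and is relevant only when
   s is smooth near q. *)
Record hermitian_connection (nabla : connection) : Prop := {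
  conn_local : forall q s t v, smooth_section q s -> smooth_section q t ->
    (\forall p \near q, s p = t p) -> nabla s q v = nabla t q v;
  conn_fiber : forall q s v, smooth_section q s ->
    ext_power (I (F q)) (nabla s q v);
  conn_linear : forall q s (x : R) u v, smooth_section q s ->
    nabla s q (x *: u + v) = (x%:C%C \*o nabla s q u) \+ nabla s q v;
  conn_add : forall q s t v, smooth_section q s -> smooth_section q t ->
    nabla (fun p => s p \+ t p) q v = nabla s q v \+ nabla t q v;
  conn_leibniz : forall q s f v, smooth_section q s -> csmooth_at q f ->
    nabla (fun p => f p \*o s p) q v
      = (ctderiv f q v \*o s q) \+ (f q \*o nabla s q v);
  conn_smooth : forall q s X, smooth_section q s ->
    smooth_vf (fun x : N => x) q X -> smooth_section q (fun p => nabla s p (X p));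
  conn_metric : forall q s t v, smooth_section q s -> smooth_section q t ->
    ctderiv (fun p => hK p (s p) (t p)) q v
      = hK q (nabla s q v) (t q) + hK q (s q) (nabla t q v)
}.

End Connection.

Section Reference.
Context {R : realType} {n : nat}.
Variables (M : manifold R (2 * n)) (w : M -> 'M[R]_(2 * n)).

(* If nabla is d + A in the local unit section e, its curvature is dA. *)
Definition has_curvature (I : M -> 'M[R]_(2 * n)) (nabla : connection M)
    (Om : M -> 'rV[R]_(2 * n) -> 'rV[R]_(2 * n) -> R[i]) : Prop :=
  forall (U : set M) (e : section M) (A : M -> 'rV[R]_(2 * n) -> R[i]),
    open U ->
    (forall p, U p -> smooth_section (fun x : M => x) I p e /\
       hK (fun x : M => x) w I p (e p) (e p) = 1) ->
    (forall p v, U p -> nabla e p v = A p v \*o e p) ->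
    forall (c : chart M) p j l, U p -> cdom c p ->
      Om p (cvec c j p) (cvec c l p)
        = cpderiv c j (fun x => A x (cvec c l x)) p
          - cpderiv c l (fun x => A x (cvec c j x)) p.

(* c_1(K^-1) = k [w] in de Rham cohomology: (i / 2 pi) Om - k w = d theta, where
   Om is the curvature of a Hermitian connection on K^-1. *)
Definition pseudo_einstein (k : R) : Prop :=
  exists I nabla Om (theta : M -> 'cV[R]_(2 * n)),
    let th (c : chart M) j (x : M) := (cvec c j x *m theta x) 0 0 in
    [/\ compatible w I, hermitian_connection (fun x : M => x) w I nabla,
        has_curvature I nabla Om,
        forall (c : chart M) p j, cdom c p -> smooth_at p (th c j) &
        forall (c : chart M) p j l, cdom c p ->
          (0 +i* (2 * pi)^-1)%C * Om p (cvec c j p) (cvec c l p)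
          = (k * bil_coord w c j l p
             + (pderiv c j (th c l) p - pderiv c l (th c j) p))%:C%C].

Definition reference_connection (k : R) (I : M -> 'M[R]_(2 * n))
    (a : connection M) : Prop :=
  hermitian_connection (fun x : M => x) w I a /\
  has_curvature I a (fun p u v => (0 +i* - (2 * pi * k * bil w p u v))%C).

End Reference.

(** * Singular cohomology in degree 1, with integer coefficients *)

Section Singular.
Context {R : realType} {X : topologicalType}.

(* A is a subspace of X.  Singular simplices are maps on R or R * R of which only
   the restriction to the standard simplex counts: [0, 1], respectively
   the triangle with vertices (0, 0), (1, 0), (0, 1). *)
Definition simplex1 (A : set X) (s : R -> X) : Prop :=
  {within `[0, 1], continuous s} /\ (forall t, 0 <= t <= 1 -> A (s t)).

Definition triangle : set (R * R) := [set z | [/\ 0 <= z.1, 0 <= z.2 & z.1 + z.2 <= 1]].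

Definition simplex2 (A : set X) (T : R * R -> X) : Prop :=
  {within triangle, continuous T} /\ (forall z, triangle z -> A (T z)).

Definition cochain := (R -> X) -> int.

Definition cocycle (A : set X) (c : cochain) : Prop :=
  (forall s s', simplex1 A s -> simplex1 A s' ->
     (forall t, 0 <= t <= 1 -> s t = s' t) -> c s = c s') /\
  (forall T, simplex2 A T ->
     c (fun t => T (1 - t, t)) - c (fun t => T (0, t)) + c (fun t => T (t, 0)) = 0).

Definition cohomologous (A : set X) (c c' : cochain) : Prop :=
  exists f : X -> int, forall s, simplex1 A s -> c s - c' s = f (s 1) - f (s 0).

End Singular.

Arguments cochain : clear implicits.

Definition simply_connected (R : realType) (X : topologicalType) : Prop :=
  (forall x y : X, exists s : R -> X,
     [/\ {within `[0, 1], continuous s}, s 0 = x & s 1 = y]) /\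
  (forall s : R -> X, {within `[0, 1], continuous s} -> s 0 = s 1 ->
     exists H : R * R -> X,
       {within `[0, 1] `*` `[0, 1], continuous H} /\
       forall t, 0 <= t <= 1 ->
         [/\ H (t, 0) = s t, H (t, 1) = s 0, H (0, t) = s 0 & H (1, t) = s 0]).

Definition circle (R : realType) : set (R * R) := [set z | z.1 ^+ 2 + z.2 ^+ 2 = 1].

Arguments circle : clear implicits.

(* The positive generator of H^1(U(1), Z): the class taking the value 1 on the
   loop exp(2 pi i t).  A class is the set of cocycles representing it. *)
Definition positive_generator (R : realType) : set (cochain R (R * R)%type) :=
  [set c | cocycle (circle R) c /\
           c (fun t => (cos (2 * pi * t), sin (2 * pi * t))) = 1].

(** * Lagrangian submanifolds and the Maslov class *)

Section Lagrangian.
Context {R : realType} {n : nat}.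
Variables (M : manifold R (2 * n)) (w : M -> 'M[R]_(2 * n)).
Variables (S : manifold R n) (iota : S -> M).

Definition embedding : Prop :=
  [/\ smooth_map iota, injective iota,
      forall q v, tmap iota q v = 0 -> v = 0 &
      forall V : set S, open V -> exists2 W : set M, open W & iota @^-1` W = V].

Definition lagrangian : Prop :=
  embedding /\ forall q u v, bil w (iota q) (tmap iota q u) (tmap iota q v) = 0.

Definition frame_mx (e : 'I_n -> S -> 'rV[R]_n) (q : S) : 'M[R]_n :=
  \matrix_(i, j) e i q 0 j.

(* o q tells whether the orientation of T_qS is opposite to the one given by the
   chart [chart_at q] *)
Definition oriented (o : S -> bool) (e : 'I_n -> S -> 'rV[R]_n) (q : S) : Prop :=
  0 < (-1) ^+ (o q) * \det (frame_mx e q).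

Definition orientation (o : S -> bool) : Prop :=
  forall q e, (forall i, smooth_vf (fun x : S => x) q (e i)) ->
    \det (frame_mx e q) != 0 ->
    \forall p \near q, oriented o e p <-> oriented o e q.

Definition orientable : Prop := exists o, orientation o.

(* b is the restriction a|_S, a connection on iota^*K^-1 *)
Definition restriction (I : M -> 'M[R]_(2 * n)) (a : connection M)
    (b : @connection R n n S) : Prop :=
  hermitian_connection iota w I b /\
  forall q (s : section M) v, smooth_section (fun x : M => x) I (iota q) s ->
    b (s \o iota) q v = a s (iota q) (tmap iota q v).

Definition canonical_trivial (I : M -> 'M[R]_(2 * n))
    (A0 : @connection R n n S) : Prop :=
  hermitian_connection iota w I A0 /\
  forall o q (e : 'I_n -> S -> 'rV[R]_n),
    orientation o ->
    (forall i, smooth_vf (fun x : S => x) q (e i)) ->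
    (\forall p \near q, oriented o e p /\
       forall i j, metric w I (iota p) (tmap iota p (e i p)) (tmap iota p (e j p))
                   = (i == j)%:R) ->
    forall v, A0 (fun p => wedge (I (iota p)) (fun i => tmap iota p (e i p))) q v
              = (fun=> 0).

Definition smooth_loop (g : R -> S) : Prop :=
  [/\ forall t, g (t + 1) = g t, continuous g &
      forall t0 (c : chart S) k, cdom c (g t0) ->
        \forall t \near t0, forall r : nat,
          derivable (derive1n r (fun x : R => cmap c (g x) 0 k)) t 1].

Definition velocity (g : R -> S) (t : R) : 'rV[R]_n :=
  derive1 (cmap (chart_at (g t)) \o g) t.

(* s is a section of K^-1 along g with zero covariant derivative; it is written
   near each time as f times a smooth local section e, so that this derivative is
   f' e + f b(e)(g'). *)
Definition parallel_along (I : M -> 'M[R]_(2 * n)) (b : @connection R n n S)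
    (g : R -> S) (s : R -> mvec R (2 * n) n) : Prop :=
  forall t0, exists (e : @section R n n S) (f : R -> R[i]),
    [/\ smooth_section iota I (g t0) e,
        \forall t \near t0, s t = f t \*o e (g t),
        derivable (fun t => Re (f t)) t0 1,
        derivable (fun t => Im (f t)) t0 1 &
        ((derive1 (fun t => Re (f t)) t0 +i* derive1 (fun t => Im (f t)) t0)%C \*o e (g t0))
          \+ (f t0 \*o b e (g t0) (velocity g t0)) = (fun=> 0)].

Definition trivial_holonomy (I : M -> 'M[R]_(2 * n)) (b : @connection R n n S) :
    Prop :=
  forall g s, smooth_loop g -> parallel_along I b g s -> s 1 = s 0.

Definition bohr_sommerfeld (k : R) : Prop :=
  exists I a b, [/\ compatible w I, reference_connection w k I a,
                    restriction I a b & trivial_holonomy I b].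

(* g : S -> U(1) with a|_S - A_0 = g^-1 dg *)
Definition relating_gauge (I : M -> 'M[R]_(2 * n)) (a : connection M)
    (g : S -> R[i]) : Prop :=
  [/\ forall q, csmooth_at q g, forall q, `|g q| = 1 &
      exists b A0, [/\ restriction I a b, canonical_trivial I A0 &
        forall q s v, smooth_section iota I q s ->
          b s q v = A0 s q v \+ (((g q)^-1 * ctderiv g q v) \*o s q)]].

(* m_S(I, a) = g^*h in H^1(S, Z), as the set of cocycles representing it *)
Definition maslov_class (I : M -> 'M[R]_(2 * n)) (a : connection M) :
    set (cochain R S) :=
  [set c | cocycle [set: S] c /\
     exists g h, [/\ relating_gauge I a g, positive_generator h &
       cohomologous [set: S] c
         (fun s => h (fun t => (Re (g (s t)), Im (g (s t)))))]].

End Lagrangian.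

(* Main.v *)
Require Import Defs.
From HB Require Import structures.
From mathcomp Require Import all_boot all_order all_algebra fingroup perm.
From mathcomp Require Import all_classical all_reals all_analysis.
From mathcomp Require Import complex ring lra.
Import numFieldNormedType.Exports.
Import Order.TTheory GRing.Theory Num.Theory.
Set Implicit Arguments.
Unset Strict Implicit.
Unset Printing Implicit Defensive.
Local Open Scope classical_set_scope.
Local Open Scope ring_scope.
Local Notation Re := complex.Re.
Local Notation Im := complex.Im.

(** The complex linear isomorphism 1 - I I' from (TM, I) to (TM, I') induces, after
    normalisation, a unitary isomorphism Phi between the two anticanonical bundles.
    The connections a and a' have the same curvature, so Phi carries the local
    connection forms of a to those of a' up to a closed form i alpha; since M is simply
    connected alpha = df, and exp(- i f) Phi carries a to a'.
    Over S, Phi carries the unit section given by G-orthonormal frames of TS to the one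
    for G', up to sign and the phase of det (Q + Q' - i K), where Q and Q' are the Gram
    matrices of a frame e of TS for G and G' and K_jl = omega (I e_j, I' e_l).  As S is
    Lagrangian, K Q'^-1 Q is symmetric, so that det (Q + Q' - i r K) vanishes for no
    real r.  Hence the quotient of the two gauge transformations g_S is homotopic to 1
    through the phases of exp(- i r f) det (Q + Q' - i r K), and a homotopy does not
    change the pull-back of the generator of H^1(U(1), Z). *)

(** * Calculus in R^m *)

(** K is not symmetric, so positivity of Q + Q' alone would not exclude a complex kernel vector of Q
    + Q' - i r K. Multiplying on the right by Q'^-1 Q turns Q + Q' into Q + Q Q'^-1 Q, still
    positive definite, and K into a symmetric matrix; a complex symmetric matrix with positive
    definite real part is invertible. At r = 0 the determinant is positive, so its phase is 1, and
    the same parameter r can scale f because f is a global real function, not an angle. A gauge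
    transformation for (I', a') is not given and has to be produced, together with connections
    realising a' and A_0 on all sections over S, not only on restrictions of sections over M. It is
    g times the conjugate of the total phase. All local comparisons run through unit sections, in
    which a Hermitian connection is one imaginary form and a change of frame by z adds z^-1 dz. Over
    S the preferred unit sections are fixed only up to sign; this is harmless, because a smooth real
    function of modulus 1 has zero differential. *)

Lemma near_continuous (T T' : topologicalType) (f g : T -> T') (x : T) :
  (\forall y \near x, f y = g y) -> {for x, continuous f} -> {for x, continuous g}.
Proof.
move=> fg cf A; rewrite -(nbhs_singleton fg) => /cf; rewrite /nbhs /= => fA.
by apply: filterS2 fg fA => y /= ->.
Qed.

Section Differentials.
Context {R : realType}.

(** Differentiability in epsilon form, the form in which it is checked for functions known only
    through estimates, such as [radial_primitive] below. *)
Lemma is_diff_estimateP (V W : normedModType R) (f : V -> W)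
    (df : {linear V -> W}) (x : V) : continuous df ->
  (forall e, 0 < e -> \forall h \near (0 : V),
     `|f (h + x) - f x - df h| <= e * `|h|) -> is_diff x f df.
Proof.
move=> dfc H.
have E : f \o shift x = cst (f x) + df +o_ (0 : V) id.
  apply/eqaddoP => e e0; near=> h.
  have -> : ((f \o shift x) - (cst (f x) + df)) h = f (h + x) - f x - df h.
    by rewrite /= opprD addrA.
  by near: h; exact: H.
have D := diff_unique dfc E.
apply: DiffDef => //; apply/diff_locallyP; split; first by rewrite D.
by rewrite D.
Unshelve. all: by end_near. Qed.

Lemma diff_estimate (V W : normedModType R) (f : V -> W) (x : V) :
  differentiable f x -> forall e, 0 < e -> \forall h \near (0 : V),
     `|f (h + x) - f x - 'd f x h| <= e * `|h|.
Proof.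
move=> /diff_locallyP[_ /eqaddoP H] e e0; near=> h.
have -> : f (h + x) - f x - 'd f x h = ((f \o shift x) - (cst (f x) + 'd f x)) h.
  by rewrite /= opprD addrA.
by near: h; exact: H.
Unshelve. all: by end_near. Qed.

Lemma near_differentiable (V W : normedModType R) (f g : V -> W) (x : V) :
  (\forall y \near x, f y = g y) -> differentiable f x -> differentiable g x.
Proof.
move=> fg df; have fgx := nbhs_singleton fg.
suff : is_diff x g ('d f x) by move=> H; exact: ex_diff.
apply: is_diff_estimateP; first exact: diff_continuous.
move=> e e0; near=> h.
rewrite -fgx; have <- : f (h + x) = g (h + x).
  by near: h; move: fg; rewrite (near_shift 0 x); apply: filterS => h /=; rewrite subr0.
by near: h; exact: diff_estimate.
Unshelve. all: by end_near. Qed.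

Lemma differentiable_rV (V : normedModType R) m (F : V -> 'rV[R]_m) (x : V) :
  (forall k, differentiable (fun y => F y 0 k) x) -> differentiable F x.
Proof.
move=> H; have -> : F = \sum_k (fun y => F y 0 k *: (delta_mx 0 k : 'rV[R]_m)).
  by apply/funext => y; rewrite fct_sumE {1}(row_sum_delta (F y)).
by apply: differentiable_sum => k; apply: differentiableZl.
Qed.

Lemma derive_rV m (f : 'rV[R]_m -> R) (x w : 'rV[R]_m) : differentiable f x ->
  'D_w f x = \sum_k w 0 k * 'D_(delta_mx 0 k) f x.
Proof.
move=> df; rewrite deriveE // {1}(row_sum_delta w) linear_sum.
by apply: eq_bigr => k _; rewrite linearZ /= deriveE.
Qed.

Lemma derive_rV_coord m (V : normedModType R) (F : V -> 'rV[R]_m) (x v : V) k :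
  differentiable F x -> ('D_v F x) 0 k = 'D_v (fun y => F y 0 k) x.
Proof. by move=> dF; rewrite derive_mx ?mxE //; exact: diff_derivable. Qed.

Lemma derive_comp (U V W : normedModType R) (g : U -> V) (f : V -> W) (x v : U) :
  differentiable g x -> differentiable f (g x) ->
  'D_v (f \o g) x = 'D_('D_v g x) f (g x).
Proof.
move=> dg df; have dfg := differentiable_comp dg df.
by rewrite (deriveE v dfg) (diff_comp dg df) /= (deriveE v dg) (deriveE _ df).
Qed.

Lemma derive_comp_rV m (V : normedModType R) (g : V -> 'rV[R]_m)
    (f : 'rV[R]_m -> R) (x v : V) :
  differentiable g x -> differentiable f (g x) ->
  'D_v (f \o g) x = \sum_k 'D_v (fun y => g y 0 k) x * 'D_(delta_mx 0 k) f (g x).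
Proof.
move=> dg df; rewrite derive_comp // derive_rV //.
by apply: eq_bigr => k _; rewrite derive_rV_coord.
Qed.

Lemma deriveD_rV (V : normedModType R) (f g : V -> R) (x v : V) :
  differentiable f x -> differentiable g x ->
  'D_v (fun y => f y + g y) x = 'D_v f x + 'D_v g x.
Proof. by move=> /(@diff_derivable _ _ _ f x v) df /(@diff_derivable _ _ _ g x v) dg; rewrite (deriveD df dg). Qed.

Lemma deriveM_rV (V : normedModType R) (f g : V -> R) (x v : V) :
  differentiable f x -> differentiable g x ->
  'D_v (fun y => f y * g y) x = f x * 'D_v g x + g x * 'D_v f x.
Proof. by move=> /(@diff_derivable _ _ _ f x v) df /(@diff_derivable _ _ _ g x v) dg; rewrite (deriveM df dg). Qed.

Lemma differentiable_derivable1 (V : normedModType R) (f : V -> R) (phi : R -> R) (x v : V) d :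
  differentiable f x -> is_derive (f x) 1 phi d ->
  differentiable (fun y => phi (f y)) x /\ 'D_v (fun y => phi (f y)) x = d * 'D_v f x.
Proof.
move=> df dphi; have dp : differentiable phi (f x).
  by apply/derivable1_diffP; case: dphi.
split; first exact: (differentiable_comp df dp).
rewrite (derive_comp v df dp) deriveE // -[X in 'd _ _ X]mulr1 linearZ /=.
by rewrite -deriveE // (@derive_val _ _ _ _ _ _ _ dphi) mulrC.
Qed.

End Differentials.

Section SmoothCalculus.
Context {R : realType} {m : nat}.
Implicit Types (U : set 'rV[R]_m) (f g : 'rV[R]_m -> R).

Lemma Ck_diff k U f x : Ck k.+1 U f -> U x -> differentiable f x.
Proof. by case=> + _; exact. Qed.

Lemma Ck_derive k U f j : Ck k.+1 U f -> Ck k U (fun x => 'D_(delta_mx 0 j) f x).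
Proof. by case=> _; exact. Qed.

Lemma CkS k U f : Ck k.+1 U f -> Ck k U f.
Proof.
elim: k f => [|k IH] f /= [df Df].
  by move=> x Ux; apply: differentiable_continuous; exact: df.
by split => // j; apply: IH; split; case: (Df j).
Qed.

Lemma Ck_sub k U V f : V `<=` U -> Ck k U f -> Ck k V f.
Proof.
move=> VU; elim: k f => [|k IH] f /=; first by move=> H x /VU; exact: H.
by move=> [df Df]; split=> [x /VU|j]; [exact: df|exact: IH].
Qed.

Lemma open_near_eq U f g x : open U -> (forall y, U y -> f y = g y) -> U x ->
  \forall y \near x, f y = g y.
Proof. by move=> oU fg Ux; apply: filterS (open_nbhs_nbhs (conj oU Ux)). Qed.

Lemma Ck_eq k U f g : open U -> (forall x, U x -> f x = g x) ->
  Ck k U f -> Ck k U g.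
Proof.
move=> oU; elim: k f g => [|k IH] f g fg /=.
  move=> H x Ux; have fgn := open_near_eq oU fg Ux.
  exact: near_continuous fgn (H x Ux).
move=> [df Df]; split=> [x Ux|j].
  by apply: (near_differentiable (open_near_eq oU fg Ux)); exact: df.
apply: IH (Df j) => x Ux; apply: near_eq_derive.
exact: (open_near_eq oU fg Ux).
Qed.

Lemma Ck_cst k U (a : R) : Ck k U (fun=> a).
Proof.
elim: k a => [|k IH] a /=; first by move=> x _; exact: cst_continuous.
split=> [x _|j]; first exact: differentiable_cst.
by under eq_fun do rewrite derive_cst; exact: IH.
Qed.

Lemma CkD k U f g : open U -> Ck k U f -> Ck k U g -> Ck k U (fun x => f x + g x).
Proof.
move=> oU; elim: k f g => [|k IH] f g /=.
  by move=> Hf Hg x Ux; exact: (cvgD (Hf x Ux) (Hg x Ux)).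
move=> [df Df] [dg Dg]; split=> [x Ux|j].
  by apply: differentiableD; [exact: df|exact: dg].
apply: Ck_eq oU _ (IH _ _ (Df j) (Dg j)) => x Ux.
by rewrite (deriveD_rV _ (df x Ux) (dg x Ux)).
Qed.

Lemma CkM k U f g : open U -> Ck k U f -> Ck k U g -> Ck k U (fun x => f x * g x).
Proof.
move=> oU; elim: k f g => [|k IH] f g.
  by move=> Hf Hg x Ux; exact: (cvgM (Hf x Ux) (Hg x Ux)).
move=> Hf Hg; split=> [x Ux|j].
  by apply: differentiableM; [exact: Ck_diff Hf _|exact: Ck_diff Hg _].
apply: (Ck_eq (f := fun x => f x * 'D_(delta_mx 0 j) g x + g x * 'D_(delta_mx 0 j) f x)) => //.
  by move=> x Ux; rewrite deriveM_rV //; [exact: Ck_diff Hf _|exact: Ck_diff Hg _].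
by apply: CkD => //; apply: IH; solve [exact: CkS | exact: Ck_derive].
Qed.

(** [phi] lists the successive derivatives of a scalar function on [A]. Carrying the whole sequence
    lets the induction on [k] pass from [phi i] to [phi i.+1] after each differentiation. *)
Lemma Ck_comp1 (phi : nat -> R -> R) (A : set R) k i U f : open U ->
  (forall i y, A y -> is_derive y 1 (phi i) (phi i.+1 y)) ->
  (forall x, U x -> A (f x)) -> Ck k U f -> Ck k U (fun x => phi i (f x)).
Proof.
move=> oU dphi fA; elim: k i => [|k IH] i.
  move=> Hf x Ux; apply: (continuous_comp (Hf x Ux)).
  apply: differentiable_continuous; apply/derivable1_diffP.
  by have [] := dphi i _ (fA x Ux).
move=> Hf; have D x j Ux := differentiable_derivable1 (delta_mx 0 j)
  (Ck_diff Hf Ux) (dphi i _ (fA x Ux)).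
split=> [x Ux|j].
  exact: (differentiable_comp (Ck_diff Hf Ux)
    (iffLR (derivable1_diffP _ _) (@ex_derive _ _ _ _ _ _ _ (dphi i _ (fA x Ux))))).
apply: (Ck_eq (f := fun x => phi i.+1 (f x) * 'D_(delta_mx 0 j) f x)) => //.
  by move=> x Ux; have [_ ->] := D x j Ux.
by apply: CkM => //; [apply: IH; exact: CkS|exact: Ck_derive].
Qed.

End SmoothCalculus.

(** One order more is asked of [g] than of [f], because continuity of the vector-valued [g] is drawn
    from differentiability of its coordinates. The loss disappears for smooth maps. *)
Lemma Ck_comp (R : realType) (d m k : nat) (U : set 'rV[R]_d) (V : set 'rV[R]_m)
    (g : 'rV[R]_d -> 'rV[R]_m) (f : 'rV[R]_m -> R) : open U ->
  (forall x, U x -> V (g x)) -> (forall j, Ck k.+1 U (fun x => g x 0 j)) ->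
  Ck k V f -> Ck k U (f \o g).
Proof.
move=> oU gV; elim: k f => [|k IH] f Hg Hf.
  move=> x Ux; apply: continuous_comp; last exact/Hf/gV.
  by apply: differentiable_continuous; apply: differentiable_rV => j; exact: Ck_diff (Hg j) _.
have dg x : U x -> differentiable g x.
  by move=> Ux; apply: differentiable_rV => j; exact: Ck_diff (Hg j) _.
split=> [x Ux|j].
  by apply: differentiable_comp; [exact: dg|apply: (Ck_diff Hf); exact: gV].
apply: (Ck_eq (f := fun x => \sum_l 'D_(delta_mx 0 j) (fun y => g y 0 l) x
   * 'D_(delta_mx 0 l) f (g x))) => //.
  move=> x Ux; rewrite derive_comp_rV //; first exact: dg.
  by apply: (Ck_diff Hf); exact: gV.
have S (l : seq 'I_m) : Ck k U (fun x => \sum_(i <- l) 'D_(delta_mx 0 j) (fun y => g y 0 i) x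
   * 'D_(delta_mx 0 i) f (g x)).
  elim: l => [|i l IHl]; first by under eq_fun do rewrite big_nil; exact: Ck_cst.
  under eq_fun do rewrite big_cons.
  apply: CkD => //; apply: CkM => //.
    by apply: CkS; apply: Ck_derive.
  apply: (IH (fun y => 'D_(delta_mx 0 i) f y)); last exact: Ck_derive.
  by move=> l'; exact: CkS.
exact: (S (index_enum _)).
Qed.

Section SmoothOn.
Context {R : realType} {m : nat}.
Implicit Types (U V : set 'rV[R]_m) (f g : 'rV[R]_m -> R).

Lemma smooth_on_diff U f x : smooth_on U f -> U x -> differentiable f x.
Proof. by move=> H; exact: Ck_diff (H 1%N). Qed.

Lemma smooth_on_sub U V f : V `<=` U -> smooth_on U f -> smooth_on V f.
Proof. by move=> VU H k; exact: Ck_sub VU (H k). Qed.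

Lemma smooth_on_eq U f g : open U -> (forall x, U x -> f x = g x) ->
  smooth_on U f -> smooth_on U g.
Proof. by move=> oU fg H k; exact: Ck_eq oU fg (H k). Qed.

Lemma smooth_on_derive U f j : smooth_on U f ->
  smooth_on U (fun x => 'D_(delta_mx 0 j) f x).
Proof. by move=> H k; apply: Ck_derive. Qed.

Lemma smooth_on_cst U (a : R) : smooth_on U (fun=> a).
Proof. by move=> k; exact: Ck_cst. Qed.

Lemma smooth_onD U f g : open U -> smooth_on U f -> smooth_on U g ->
  smooth_on U (fun x => f x + g x).
Proof. by move=> oU Hf Hg k; exact: CkD. Qed.

Lemma smooth_onM U f g : open U -> smooth_on U f -> smooth_on U g ->
  smooth_on U (fun x => f x * g x).
Proof. by move=> oU Hf Hg k; exact: CkM. Qed.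

Lemma smooth_on_comp1 (phi : nat -> R -> R) (A : set R) i U f : open U ->
  (forall i y, A y -> is_derive y 1 (phi i) (phi i.+1 y)) ->
  (forall x, U x -> A (f x)) -> smooth_on U f -> smooth_on U (fun x => phi i (f x)).
Proof. by move=> oU H1 H2 H k; exact: Ck_comp1 oU H1 H2 (H k). Qed.

Lemma smooth_on_coord U j : smooth_on U (fun x => x 0 j).
Proof.
case=> [|k]; first by move=> x _; exact: coord_continuous.
split=> [x _|l]; first exact: differentiable_coord.
have -> : (fun x : 'rV[R]_m => 'D_(delta_mx 0 l) (fun y : 'rV[R]_m => y 0 j) x)
    = (fun=> (delta_mx 0 l : 'rV[R]_m) 0 j).
  by apply/funext => x; rewrite -(@derive_rV_coord _ _ _ id) ?derive_id.
exact: Ck_cst.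
Qed.

End SmoothOn.

Lemma smooth_on_comp (R : realType) (d m : nat) (U : set 'rV[R]_d) (V : set 'rV[R]_m)
    (g : 'rV[R]_d -> 'rV[R]_m) (f : 'rV[R]_m -> R) : open U ->
  (forall x, U x -> V (g x)) -> (forall j, smooth_on U (fun x => g x 0 j)) ->
  smooth_on V f -> smooth_on U (f \o g).
Proof. by move=> oU gV Hg Hf k; apply: Ck_comp oU gV _ (Hf k) => j; exact: Hg. Qed.

(** * Smooth functions and tangent vectors *)

Section Charts.
Context {R : realType} {m : nat} (N : manifold R m).
Implicit Types (c : chart N) (q p : N) (f g : N -> R).

Lemma near_ball_sub (x : 'rV[R]_m) (A : set 'rV[R]_m) : nbhs x A ->
  \forall e \near 0^'+, ball x e `<=` A.
Proof.
move=> /nbhs_ballP[d /= d0 dA]; near=> e; apply: subset_trans dA.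
by apply: le_ball; near: e; exact: nbhs_right_le.
Unshelve. all: by end_near. Qed.

Lemma cimage_cinv c x : (cmap c @` cdom c) x ->
  cdom c (cinv c x) /\ cmap c (cinv c x) = x.
Proof. by case=> p cp <-; rewrite (cmapK cp). Qed.

Lemma cimage_cmap c q : cdom c q -> (cmap c @` cdom c) (cmap c q).
Proof. by move=> cq; exists q. Qed.

Lemma near_cdom c q : cdom c q -> \forall p \near q, cdom c p.
Proof. by move=> cq; apply: open_nbhs_nbhs; split=> //; exact: cdom_open. Qed.

Lemma near_cimage c q : cdom c q -> \forall x \near cmap c q, (cmap c @` cdom c) x.
Proof.
move=> cq; apply: open_nbhs_nbhs; split; first exact: cimage_open.
exact: cimage_cmap.
Qed.

Lemma near_cmap c q (A : set 'rV[R]_m) : cdom c q -> nbhs (cmap c q) A ->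
  \forall p \near q, A (cmap c p).
Proof. by move=> cq nA; exact: (cmap_continuous cq nA). Qed.

Lemma near_cinv c q (A : set N) : cdom c q -> nbhs q A ->
  \forall x \near cmap c q, A (cinv c x).
Proof.
move=> cq; rewrite -{1}(cmapK cq) => nA.
exact: (cinv_continuous (cimage_cmap cq) nA).
Qed.

Lemma chart_image_open c (U : set N) : open U -> open (cmap c @` (U `&` cdom c)).
Proof.
move=> oU; rewrite openE => _ [q [Uq cq] <-]; rewrite /interior.
have nU : nbhs q (U `&` cdom c).
  by apply: filterI; [exact: open_nbhs_nbhs|exact: near_cdom].
near=> x; have [cx xK] : cdom c (cinv c x) /\ cmap c (cinv c x) = x.
  by apply: cimage_cinv; near: x; exact: near_cimage.
by exists (cinv c x) => //; near: x; exact: (near_cinv cq nU).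
Unshelve. all: by end_near. Qed.

(** One chart is enough: in any other chart the function is composed with a smooth transition
    map. *)
Lemma smooth_atI c q f : cdom c q ->
  (exists e, 0 < e /\ smooth_on (ball (cmap c q) e) (f \o cinv c)) -> smooth_at q f.
Proof.
move=> cq [e [e0 fe]].
(* [cmap c] is continuous only on [cdom c], so the neighbourhood is made open by taking an
   interior. *)
exists (interior (cdom c `&` cmap c @^-1` ball (cmap c q) e)); split.
- exact: open_interior.
- apply: filterI; first exact: near_cdom.
  by apply: near_cmap => //; exact: nbhsx_ballx.
move=> c'; set U := interior _; set W := cmap c' @` (U `&` cdom c').
have oW : open W by apply: chart_image_open; exact: open_interior.
have WE x : W x -> [/\ cdom c' (cinv c' x), cmap c' (cinv c' x) = x,
    cdom c (cinv c' x) & ball (cmap c q) e (cmap c (cinv c' x))].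
  move=> [p [Up c'p] <-]; rewrite (cmapK c'p).
  by have [] := interior_subset Up.
apply: (@smooth_on_eq _ _ _ ((f \o cinv c) \o (fun x => cmap c (cinv c' x)))) => //.
  by move=> x /WE[_ _ cx _] /=; rewrite (cmapK cx).
apply: (smooth_on_comp (V := ball (cmap c q) e)) => //; first by move=> x /WE[].
move=> j; apply: (smooth_on_sub _ (transition_smooth c' c j)) => x /WE[c'x xK cx _].
by exists (cinv c' x).
Qed.

(** Stated for all small radii rather than for one, so that several conditions on the radius can be
    met at once by intersecting filters. *)
Lemma smooth_atE c q f : cdom c q -> smooth_at q f ->
  \forall e \near 0^'+, smooth_on (ball (cmap c q) e) (f \o cinv c).
Proof.
move=> cq [U [oU Uq H]].
have : nbhs (cmap c q) (cmap c @` (U `&` cdom c)).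
  by apply: open_nbhs_nbhs; split; [exact: chart_image_open|exists q].
move/near_ball_sub; apply: filterS => e eV.
exact: smooth_on_sub eV (H c).
Qed.

Lemma smooth_at_near0 c q f : cdom c q ->
  (\forall e \near 0^'+, smooth_on (ball (cmap c q) e) (f \o cinv c)) -> smooth_at q f.
Proof.
move=> cq H; apply: (@smooth_atI c) => //.
near (0 : R)^'+ => e; exists e; split; last by near: e.
by near: e; exact: nbhs_right_gt.
Unshelve. all: by end_near. Qed.

Lemma near_smooth_at q f : smooth_at q f -> \forall p \near q, smooth_at p f.
Proof.
move=> [U [oU Uq H]]; apply: filterS (open_nbhs_nbhs (conj oU Uq)) => p Up.
by exists U.
Qed.

Lemma smooth_at_diff c q f : cdom c q -> smooth_at q f ->
  differentiable (f \o cinv c) (cmap c q).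
Proof.
move=> cq fq; near (0 : R)^'+ => e.
apply: (@smooth_on_diff _ _ (ball (cmap c q) e)); first by near: e; exact: smooth_atE.
by apply: ballxx; near: e; exact: nbhs_right_gt.
Unshelve. all: by end_near. Qed.

Lemma smooth_at_continuous q f : smooth_at q f -> {for q, continuous f}.
Proof.
move=> fq; have cq := cdom_chart_at q; set c := chart_at q in cq.
have cf : {for cmap c q, continuous (f \o cinv c)}.
  by apply: differentiable_continuous; exact: smooth_at_diff.
apply: (@near_continuous _ _ ((f \o cinv c) \o cmap c)).
  by apply: filterS (near_cdom cq) => p cp; rewrite /= (cmapK cp).
by apply: continuous_comp => //; exact: cmap_continuous.
Qed.

Lemma near_eq_smooth_at q f g : (\forall p \near q, f p = g p) ->
  smooth_at q f -> smooth_at q g.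
Proof.
move=> fg fq; have cq := cdom_chart_at q; apply: (smooth_at_near0 cq).
have E := near_ball_sub (near_cinv cq fg).
apply: filterS2 E (smooth_atE cq fq) => e e1 e2.
apply: smooth_on_eq e2; first exact: ball_open.
by move=> x /e1.
Qed.

Lemma smooth_at_cst q (a : R) : smooth_at q (fun=> a).
Proof.
by apply: (smooth_at_near0 (cdom_chart_at q)); near=> e; exact: smooth_on_cst.
Unshelve. all: by end_near. Qed.

Lemma smooth_atD q f g : smooth_at q f -> smooth_at q g ->
  smooth_at q (fun p => f p + g p).
Proof.
move=> fq gq; have cq := cdom_chart_at q; apply: (smooth_at_near0 cq).
apply: filterS2 (smooth_atE cq fq) (smooth_atE cq gq) => e.
by apply: smooth_onD; exact: ball_open.
Qed.

Lemma smooth_atM q f g : smooth_at q f -> smooth_at q g ->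
  smooth_at q (fun p => f p * g p).
Proof.
move=> fq gq; have cq := cdom_chart_at q; apply: (smooth_at_near0 cq).
apply: filterS2 (smooth_atE cq fq) (smooth_atE cq gq) => e.
by apply: smooth_onM; exact: ball_open.
Qed.

Lemma smooth_at_comp1 (phi : nat -> R -> R) (A : set R) i q f :
  open A -> A (f q) -> (forall i y, A y -> is_derive y 1 (phi i) (phi i.+1 y)) ->
  smooth_at q f -> smooth_at q (fun p => phi i (f p)).
Proof.
move=> oA Aq dphi fq; have cq := cdom_chart_at q; apply: (smooth_at_near0 cq).
have nA : \forall p \near q, A (f p).
  by apply: (smooth_at_continuous fq); exact: open_nbhs_nbhs.
apply: filterS2 (near_ball_sub (near_cinv cq nA)) (smooth_atE cq fq) => e e1 e2.
by apply: (smooth_on_comp1 i _ dphi e1 e2); exact: ball_open.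
Qed.

Lemma smooth_at_cmap c q k : cdom c q -> smooth_at q (fun p => cmap c p 0 k).
Proof.
move=> cq; apply: (smooth_at_near0 cq).
apply: filterS (near_ball_sub (near_cimage cq)) => e eV.
apply: (@smooth_on_eq _ _ _ (fun x => x 0 k)); first exact: ball_open.
  by move=> x /eV /cimage_cinv[_ E] /=; rewrite E.
exact: smooth_on_coord.
Qed.

Lemma smooth_at_pderiv c j q f : cdom c q -> smooth_at q f ->
  smooth_at q (pderiv c j f).
Proof.
move=> cq fq; apply: (smooth_at_near0 cq).
apply: filterS2 (near_ball_sub (near_cimage cq)) (smooth_atE cq fq) => e eV e2.
apply: (@smooth_on_eq _ _ _ (fun x => 'D_(delta_mx 0 j) (f \o cinv c) x)).
- exact: ball_open.
- by move=> x /eV /cimage_cinv[_ E] /=; rewrite /pderiv E.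
exact: smooth_on_derive.
Qed.

End Charts.

Lemma smooth_at_comp (R : realType) (d m : nat) (N : manifold R d) (M : manifold R m)
    (F : N -> M) (q : N) (f : M -> R) : smooth_map F -> smooth_at (F q) f ->
  smooth_at q (f \o F).
Proof.
move=> [cF sF] fq; have cq := cdom_chart_at q; apply: (smooth_at_near0 cq).
have cFq := cdom_chart_at (F q); set c' := chart_at (F q) in cFq.
have sk : \forall e \near 0^'+, forall k, smooth_on (ball (cmap (chart_at q) q) e)
    ((fun p => cmap c' (F p) 0 k) \o cinv (chart_at q)).
  by apply: filter_forall => k; apply: smooth_atE => //; exact: sF.
near (0 : R)^'+ => r.
have r0 : 0 < r by near: r; exact: nbhs_right_gt.
have fr : smooth_on (ball (cmap c' (F q)) r) (f \o cinv c').
  by near: r; exact: smooth_atE.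
have nB : \forall y \near F q, cdom c' y /\ ball (cmap c' (F q)) r (cmap c' y).
  apply: filterI (near_cdom cFq) (near_cmap cFq _).
  exact: nbhsx_ballx.
have nF := cF q _ nB.
apply: filterS2 (near_ball_sub (near_cinv cq nF)) sk => e e1 e2.
apply: (@smooth_on_eq _ _ _ ((f \o cinv c') \o (fun x => cmap c' (F (cinv (chart_at q) x))))).
- exact: ball_open.
- by move=> x /e1[cx _] /=; rewrite (cmapK cx).
apply: (smooth_on_comp (V := ball (cmap c' (F q)) r)) => //; first exact: ball_open.
by move=> x /e1[].
Unshelve. all: by end_near. Qed.

Section ChartDerivative.
Context {R : realType} {m : nat} (N : manifold R m).
Implicit Types (c : chart N) (q p : N) (f g : N -> R) (v : 'rV[R]_m).

(* [tderiv f q v] is [cder (chart_at q) v f q], and [pderiv c j f q] is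
   [cder c (delta_mx 0 j) f q]. *)
Definition cder c v f q : R := 'D_v (f \o cinv c) (cmap c q).

Lemma cder_cst c v (a : R) q : cder c v (fun=> a) q = 0.
Proof. exact: derive_cst. Qed.

Lemma cderD c v f g q : cdom c q -> smooth_at q f -> smooth_at q g ->
  cder c v (fun p => f p + g p) q = cder c v f q + cder c v g q.
Proof.
by move=> cq fq gq; exact: (deriveD_rV v (smooth_at_diff cq fq) (smooth_at_diff cq gq)).
Qed.

Lemma cderM c v f g q : cdom c q -> smooth_at q f -> smooth_at q g ->
  cder c v (fun p => f p * g p) q = f q * cder c v g q + g q * cder c v f q.
Proof.
move=> cq fq gq; have := deriveM_rV v (smooth_at_diff cq fq) (smooth_at_diff cq gq).
by rewrite /= (cmapK cq).
Qed.

Lemma cder_comp1 c v f (phi : R -> R) q d : cdom c q -> smooth_at q f ->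
  is_derive (f q) 1 phi d -> cder c v (fun p => phi (f p)) q = d * cder c v f q.
Proof.
move=> cq fq dphi.
have dphi' : is_derive ((f \o cinv c) (cmap c q)) 1 phi d by rewrite /= (cmapK cq).
by have [_] := differentiable_derivable1 v (smooth_at_diff cq fq) dphi'.
Qed.

Lemma cder_near c v f g q : cdom c q -> (\forall p \near q, f p = g p) ->
  cder c v f q = cder c v g q.
Proof.
move=> cq fg; apply: near_eq_derive; exact: (near_cinv cq fg).
Qed.

Lemma cder_linear c f q (a : R) v w : cdom c q -> smooth_at q f ->
  cder c (a *: v + w) f q = a * cder c v f q + cder c w f q.
Proof.
move=> cq fq; have df := smooth_at_diff cq fq.
by rewrite /cder (deriveE _ df) (deriveE v df) (deriveE w df) linearP.
Qed.

Lemma cder_sum c f q v : cdom c q -> smooth_at q f ->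
  cder c v f q = \sum_k v 0 k * cder c (delta_mx 0 k) f q.
Proof. by move=> cq fq; exact: (derive_rV v (smooth_at_diff cq fq)). Qed.

Lemma cmap_cinv_diff c c' q : cdom c q -> cdom c' q ->
  differentiable (fun x => cmap c' (cinv c x)) (cmap c q).
Proof.
move=> cq c'q; apply: differentiable_rV => k.
exact: (smooth_at_diff cq (smooth_at_cmap k c'q)).
Qed.

Lemma cder_change c c' v f q : cdom c q -> cdom c' q -> smooth_at q f ->
  cder c v f q =
  \sum_k cder c v (fun p => cmap c' p 0 k) q * cder c' (delta_mx 0 k) f q.
Proof.
move=> cq c'q fq; rewrite /cder.
have E : \forall x \near cmap c q,
    (f \o cinv c) x = ((f \o cinv c') \o (fun x => cmap c' (cinv c x))) x.
  have := near_cinv cq (near_cdom c'q).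
  by apply: filterS => x c'p /=; rewrite (cmapK c'p).
rewrite (near_eq_derive v E) derive_comp_rV; last 2 first.
- exact: cmap_cinv_diff.
- by rewrite (cmapK cq); exact: smooth_at_diff.
by rewrite (cmapK cq).
Qed.

End ChartDerivative.

Section Tangent.
Context {R : realType} {m : nat} (N : manifold R m).
Implicit Types (c : chart N) (q p : N) (f g : N -> R) (u v : 'rV[R]_m).

Lemma ccompE c p v k : cdom c p ->
  ccomp c p v 0 k = tderiv (fun x => cmap c x 0 k) p v.
Proof.
move=> cp; rewrite /ccomp derive_rV_coord //.
exact: (cmap_cinv_diff (cdom_chart_at p) cp).
Qed.

Lemma cvecE c j p k : cdom c p ->
  cvec c j p 0 k = pderiv c j (fun x => cmap (chart_at p) x 0 k) p.
Proof.
move=> cp; rewrite /cvec derive_rV_coord //.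
exact: (cmap_cinv_diff cp (cdom_chart_at p)).
Qed.

Opaque ccomp cvec.

Lemma tderivE c f p v : cdom c p -> smooth_at p f ->
  tderiv f p v = \sum_k ccomp c p v 0 k * pderiv c k f p.
Proof.
move=> cp fp; rewrite [LHS](cder_change v (cdom_chart_at p) cp fp).
by apply: eq_bigr => k _; rewrite ccompE.
Qed.

Lemma tderiv_cvec c j f p : cdom c p -> smooth_at p f ->
  tderiv f p (cvec c j p) = pderiv c j f p.
Proof.
move=> cp fp; rewrite [RHS](cder_change _ cp (cdom_chart_at p) fp).
rewrite [LHS](cder_sum _ (cdom_chart_at p) fp).
by apply: eq_bigr => k _; rewrite cvecE.
Qed.

Lemma tderiv_linear f p (a : R) u v : smooth_at p f ->
  tderiv f p (a *: u + v) = a * tderiv f p u + tderiv f p v.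
Proof. exact: (cder_linear _ _ _ (cdom_chart_at p)). Qed.

Lemma ccomp_linear c p (a : R) u v : cdom c p ->
  ccomp c p (a *: u + v) = a *: ccomp c p u + ccomp c p v.
Proof.
move=> cp; apply/rowP => k; rewrite mxE [X in _ = X + _]mxE !(ccompE _ _ cp).
exact: (tderiv_linear _ _ _ (smooth_at_cmap k cp)).
Qed.

Lemma pderiv_cmap c j k p : cdom c p ->
  pderiv c j (fun x => cmap c x 0 k) p = (k == j)%:R.
Proof.
move=> cp; rewrite /pderiv.
have E : \forall x \near cmap c p, ((fun x => cmap c x 0 k) \o cinv c) x = x 0 k.
  by apply: filterS (near_cimage cp) => x /cimage_cinv[_ /= ->].
rewrite (near_eq_derive _ E) -(@derive_rV_coord _ _ _ id) // derive_id mxE eqxx /=.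
by [].
Qed.

Lemma ccomp_cvec c j p : cdom c p -> ccomp c p (cvec c j p) = delta_mx 0 j.
Proof.
move=> cp; apply/rowP => k.
rewrite (ccompE _ _ cp) (tderiv_cvec _ cp (smooth_at_cmap k cp)).
by rewrite (pderiv_cmap _ _ cp) mxE eqxx.
Qed.

Lemma tderiv_cmap_chart_at p v k : tderiv (fun x => cmap (chart_at p) x 0 k) p v = v 0 k.
Proof.
rewrite [LHS](cder_sum v (cdom_chart_at p) (smooth_at_cmap k (cdom_chart_at p))).
rewrite (bigD1 k) //= big1 => [|j jk].
  by have := pderiv_cmap k k (cdom_chart_at p); rewrite /pderiv /cder eqxx => ->; rewrite mulr1 addr0.
have := pderiv_cmap j k (cdom_chart_at p); rewrite /pderiv /cder => ->.
by rewrite eq_sym (negbTE jk) mulr0.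
Qed.

(** Tangent vectors are encoded in [chart_at p], which may jump with [p]. The coordinate vectors of
    one fixed chart remove this: they form a frame in which components vary smoothly, and every
    smoothness statement on vector fields goes through them. *)
Lemma ccompK c p v : cdom c p -> v = \sum_k ccomp c p v 0 k *: cvec c k p.
Proof.
move=> cp; apply/rowP => l; rewrite -[LHS](tderiv_cmap_chart_at p v l) summxE.
rewrite (tderivE _ cp (smooth_at_cmap l (cdom_chart_at p))).
apply: eq_bigr => k _; rewrite [RHS]mxE; congr (_ * _); symmetry.
exact: (cvecE k l cp).
Qed.

Lemma cvec_chart_at p j : cvec (chart_at p) j p = delta_mx 0 j.
Proof.
have cp := cdom_chart_at p; apply/rowP => k.
by rewrite (cvecE _ _ cp) (pderiv_cmap _ _ cp) mxE eqxx.
Qed.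

Lemma ccomp_sum c p (I : finType) (a : I -> R) (u : I -> 'rV[R]_m) : cdom c p ->
  ccomp c p (\sum_i a i *: u i) = \sum_i a i *: ccomp c p (u i).
Proof.
move=> cp; have c0 : ccomp c p 0 = 0.
  by have := ccomp_linear (-1) 0 0 cp; rewrite scaler0 addr0 scaleN1r addNr.
elim: (index_enum I) => [|i s IH]; first by rewrite !big_nil.
by rewrite !big_cons (ccomp_linear _ _ _ cp) IH.
Qed.

End Tangent.

Section Maps.
Context {R : realType} {d m : nat} (N : manifold R d) (M : manifold R m) (F : N -> M).
Hypothesis sF : smooth_map F.
Implicit Types (q : N) (X Y : N -> 'rV[R]_m).

Lemma tmapE q v k : tmap F q v 0 k
  = tderiv (fun p => cmap (chart_at (F q)) (F p) 0 k) q v.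
Proof.
rewrite /tmap derive_rV_coord //; apply: differentiable_rV => j.
apply: (@smooth_at_diff _ _ _ (chart_at q) q (fun p => cmap (chart_at (F q)) (F p) 0 j)).
  exact: cdom_chart_at.
by case: sF => _; apply; exact: cdom_chart_at.
Qed.

Opaque tmap.

Lemma tderiv_comp f q v : smooth_at (F q) f ->
  tderiv (f \o F) q v = tderiv f (F q) (tmap F q v).
Proof.
move=> fq; have cFq := cdom_chart_at (F q); set c := chart_at (F q) in cFq.
rewrite [RHS](cder_sum _ cFq fq).
have cq := cdom_chart_at q.
have E : \forall p \near q, (f \o F) p = ((f \o cinv c) \o (fun p => cmap c (F p))) p.
  have [cF _] := sF; have nc : \forall p \near q, cdom c (F p) := cF q _ (near_cdom cFq).
  by apply: filterS nc => p cp /=; rewrite (cmapK cp).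
rewrite [LHS](cder_near v cq E) /cder.
rewrite (derive_comp_rV (g := (fun p => cmap c (F p)) \o cinv (chart_at q))
  (f := f \o cinv c)); last 2 first.
- apply: differentiable_rV => j.
  apply: (@smooth_at_diff _ _ _ (chart_at q) q (fun p => cmap c (F p) 0 j)) => //.
  by case: sF => _; apply.
- by rewrite /= (cmapK cq); exact: smooth_at_diff.
by apply: eq_bigr => k _; rewrite tmapE /= (cmapK cq).
Qed.

Lemma tmap_linear q (a : R) u v : tmap F q (a *: u + v) = a *: tmap F q u + tmap F q v.
Proof.
apply/rowP => k; rewrite mxE [X in _ = X + _]mxE !tmapE.
apply: tderiv_linear.
by case: sF => _; apply; exact: cdom_chart_at.
Qed.

Lemma ccomp_tmap (c : chart M) q v k : cdom c (F q) ->
  ccomp c (F q) (tmap F q v) 0 k = tderiv (fun p => cmap c (F p) 0 k) q v.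
Proof.
move=> cq; rewrite ccompE //; symmetry.
exact: (tderiv_comp v (smooth_at_cmap k cq)).
Qed.

Lemma smooth_at_sum (I : finType) q (f : I -> N -> R) :
  (forall i, smooth_at q (f i)) -> smooth_at q (fun p => \sum_i f i p).
Proof.
move=> H; elim: (index_enum I) => [|i s IH].
  by under eq_fun do rewrite big_nil; exact: smooth_at_cst.
by under eq_fun do rewrite big_cons; exact: smooth_atD.
Qed.

Lemma near_cdom_map (c : chart M) q : cdom c (F q) -> \forall p \near q, cdom c (F p).
Proof. by move=> cq; case: sF => cF _; exact: (cF q _ (near_cdom cq)). Qed.

Lemma near_eq_smooth_vf q X Y : (\forall p \near q, X p = Y p) ->
  smooth_vf F q X -> smooth_vf F q Y.
Proof.
move=> XY H c cq k; apply: near_eq_smooth_at (H c cq k).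
by apply: filterS XY => p ->.
Qed.

(** The components in another chart are combinations of the given ones, with the derivatives of the
    new coordinate functions as coefficients. *)
Lemma smooth_vf_chart (c : chart M) q X : cdom c (F q) ->
  (forall k, smooth_at q (fun p => ccomp c (F p) (X p) 0 k)) -> smooth_vf F q X.
Proof.
move=> cq H c' c'q k.
apply: (@near_eq_smooth_at _ _ _ _ (fun p => \sum_l ccomp c (F p) (X p) 0 l
    * pderiv c l (fun x => cmap c' x 0 k) (F p))).
  apply: filterS2 (near_cdom_map cq) (near_cdom_map c'q) => p cp c'p.
  by rewrite ccompE // (tderivE _ cp) //; exact: smooth_at_cmap.
apply: smooth_at_sum => l; apply: smooth_atM => //.
apply: (smooth_at_comp (f := pderiv c l (fun x => cmap c' x 0 k)) sF).
by apply: smooth_at_pderiv => //; exact: smooth_at_cmap.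
Qed.

Lemma smooth_vf_sum (I : finType) q (a : I -> N -> R) (X : I -> N -> 'rV[R]_m) :
  (forall i, smooth_at q (a i)) -> (forall i, smooth_vf F q (X i)) ->
  smooth_vf F q (fun p => \sum_i a i p *: X i p).
Proof.
move=> Ha HX c cq k.
apply: (@near_eq_smooth_at _ _ _ _ (fun p => \sum_i a i p * ccomp c (F p) (X i p) 0 k)).
  apply: filterS (near_cdom_map cq) => p cp.
  by rewrite ccomp_sum // summxE; apply: eq_bigr => i _; rewrite mxE.
by apply: smooth_at_sum => i; apply: smooth_atM => //; exact: HX.
Qed.

Lemma smooth_vf_cvec (c : chart M) j q : cdom c (F q) ->
  smooth_vf F q (fun p => cvec c j (F p)).
Proof.
move=> cq; apply: (smooth_vf_chart cq) => k.
apply: (@near_eq_smooth_at _ _ _ _ (fun p => (delta_mx 0 j : 'rV[R]_m) 0 k)).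
  by apply: filterS (near_cdom_map cq) => p cp; rewrite ccomp_cvec.
exact: smooth_at_cst.
Qed.

End Maps.

Lemma smooth_map_id (R : realType) m (N : manifold R m) : smooth_map (fun x : N => x).
Proof. by split=> [x A //|q c k cq]; exact: smooth_at_cmap. Qed.

Lemma smooth_vf_tderiv (R : realType) m (N : manifold R m) (q : N) f X :
  smooth_vf (fun x : N => x) q X -> smooth_at q f ->
  smooth_at q (fun p => tderiv f p (X p)).
Proof.
move=> HX fq; have cq := cdom_chart_at q.
apply: (@near_eq_smooth_at _ _ _ _ (fun p => \sum_k ccomp (chart_at q) p (X p) 0 k
   * pderiv (chart_at q) k f p)).
  by apply: filterS2 (near_cdom cq) (near_smooth_at fq) => p cp fp; rewrite (tderivE _ cp).
apply: smooth_at_sum => k; apply: smooth_atM; first exact: HX.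
exact: smooth_at_pderiv.
Qed.

Lemma smooth_vf_tmap (R : realType) d m (N : manifold R d) (M : manifold R m)
    (F : N -> M) (q : N) X : smooth_map F ->
  smooth_vf (fun x : N => x) q X -> smooth_vf F q (fun p => tmap F p (X p)).
Proof.
move=> sF HX c cq k.
apply: (@near_eq_smooth_at _ _ _ _ (fun p => tderiv (fun p => cmap c (F p) 0 k) p (X p))).
  by apply: filterS (near_cdom_map sF cq) => p cp; rewrite ccomp_tmap.
by apply: smooth_vf_tderiv => //; case: sF => _; apply.
Qed.

Section SmoothFunctions.
Context {R : realType} {m : nat} (N : manifold R m).
Implicit Types (q p : N) (f g : N -> R).

Lemma smooth_atN q f : smooth_at q f -> smooth_at q (fun p => - f p).
Proof.
move=> fq; apply: (@near_eq_smooth_at _ _ _ _ (fun p => -1 * f p)).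
  by near=> p; rewrite mulN1r.
by apply: smooth_atM => //; exact: smooth_at_cst.
Unshelve. all: by end_near. Qed.

Lemma smooth_atB q f g : smooth_at q f -> smooth_at q g ->
  smooth_at q (fun p => f p - g p).
Proof. by move=> fq gq; apply: smooth_atD => //; exact: smooth_atN. Qed.

Lemma near_gt0 q f : smooth_at q f -> 0 < f q -> \forall p \near q, 0 < f p.
Proof.
move=> /smooth_at_continuous cf f0.
exact: (cf _ (open_nbhs_nbhs (conj (@open_gt R 0) f0))).
Qed.

Lemma smooth_at_powR q f (a : R) : smooth_at q f -> 0 < f q ->
  smooth_at q (fun p => f p `^ a).
Proof.
move=> fq f0.
(* [c i] is the falling factorial a (a - 1) ... (a - i + 1), so that [phi i] is the i-th derivative
   of y^a on the positive half-line. *)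
pose c := fix c (i : nat) : R := if i is i'.+1 then c i' * (a - i'%:R) else 1.
pose phi i (y : R) := c i * y `^ (a - i%:R).
apply: (@near_eq_smooth_at _ _ _ _ (fun p => phi 0%N (f p))).
  by near=> p; rewrite /phi mul1r subr0.
apply: (@smooth_at_comp1 _ _ _ phi _ 0%N _ _ (@open_gt R 0) f0 _ fq).
move=> i y y0; rewrite /phi /=.
have D := is_derive1_powR (a - i%:R) y0.
apply: is_derive_eq.
by rewrite -mulrA -(natr1 i) opprD addrA.
Unshelve. all: by end_near. Qed.

Lemma smooth_at_sqrt q f : smooth_at q f -> 0 < f q ->
  smooth_at q (fun p => Num.sqrt (f p)).
Proof.
move=> fq f0; apply: near_eq_smooth_at (smooth_at_powR 2^-1 fq f0).
by apply: filterS (near_gt0 fq f0) => p p0; rewrite powR12_sqrt // ltW.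
Qed.

Lemma smooth_at_inv q f : smooth_at q f -> f q != 0 ->
  smooth_at q (fun p => (f p)^-1).
Proof.
(* Real powers are smooth on positive numbers only, and [f q] may be negative; hence 1 / f is
   written as f times the power -1 of f * f. *)
move=> fq f0; have f2 : 0 < f q * f q by rewrite -expr2 exprn_even_gt0.
have sf2 := smooth_atM fq fq.
apply: near_eq_smooth_at (smooth_atM fq (smooth_at_powR (-1) sf2 f2)).
apply: filterS (near_gt0 sf2 f2) => p p0; rewrite powR_inv1 ?ltW // invfM mulVKf //.
by apply: contraTneq p0 => ->; rewrite mul0r ltxx.
Qed.

(** The i-th derivative of the cosine is the cosine shifted by i quarter turns, so one sequence of
    derivatives serves the cosine (i = 0) and the sine (i = 1, up to sign). *)
Lemma smooth_at_cos_shift i q f : smooth_at q f ->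
  smooth_at q (fun p => cos (f p + (pi / 2) *+ i)).
Proof.
pose phi i (y : R) := cos (y + (pi / 2) *+ i).
apply: (@smooth_at_comp1 _ _ _ phi setT i); first exact: openT; first by [].
move=> j y _; rewrite /phi [X in cos (_ + X)]mulrSr addrA cosDpihalf.
apply: is_derive_eq.
by rewrite addr0 mulr1.
Qed.

Lemma smooth_at_cos q f : smooth_at q f -> smooth_at q (fun p => cos (f p)).
Proof.
move=> /(smooth_at_cos_shift 0); apply: near_eq_smooth_at.
by near=> p; rewrite mulr0n addr0.
Unshelve. all: by end_near. Qed.

Lemma smooth_at_sin q f : smooth_at q f -> smooth_at q (fun p => sin (f p)).
Proof.
move=> /(smooth_at_cos_shift 1) /smooth_atN; apply: near_eq_smooth_at.
by near=> p; rewrite mulr1n cosDpihalf opprK.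
Unshelve. all: by end_near. Qed.

End SmoothFunctions.

(** * Complex-valued smooth functions *)

Section ComplexParts.
Context {R : rcfType}.
Implicit Types x y : R[i].

Lemma cReD x y : Re (x + y) = Re x + Re y. Proof. by case: x y => [? ?] [? ?]. Qed.
Lemma cImD x y : Im (x + y) = Im x + Im y. Proof. by case: x y => [? ?] [? ?]. Qed.
Lemma cReM x y : Re (x * y) = Re x * Re y - Im x * Im y.
Proof. by case: x y => [? ?] [? ?]. Qed.
Lemma cImM x y : Im (x * y) = Re x * Im y + Im x * Re y.
Proof. by case: x y => [? ?] [? ?]. Qed.
Lemma complex_eq x y : Re x = Re y -> Im x = Im y -> x = y.
Proof. by case: x y => [? ?] [? ?] /= -> ->. Qed.

End ComplexParts.

Section ComplexSmooth.
Context {R : realType} {m : nat} (N : manifold R m).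
Implicit Types (q p : N) (f g : N -> R[i]) (v : 'rV[R]_m).

Lemma near_eq_csmooth_at q f g : (\forall p \near q, f p = g p) ->
  csmooth_at q f -> csmooth_at q g.
Proof.
by move=> fg [fr fi]; split; [apply: near_eq_smooth_at fr|apply: near_eq_smooth_at fi];
  apply: filterS fg => p ->.
Qed.

Lemma eq_csmooth_at q f g : f =1 g -> csmooth_at q f -> csmooth_at q g.
Proof. by move=> /funext ->. Qed.

Lemma near_csmooth_at q f : csmooth_at q f -> \forall p \near q, csmooth_at p f.
Proof. by move=> [fr fi]; apply: filterS2 (near_smooth_at fr) (near_smooth_at fi). Qed.

Lemma csmooth_at_cst q (a : R[i]) : csmooth_at q (fun=> a).
Proof. by split; exact: smooth_at_cst. Qed.

Lemma csmooth_at_real q (f : N -> R) : smooth_at q f -> csmooth_at q (fun p => (f p)%:C%C).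
Proof. by move=> fq; split => //=; exact: smooth_at_cst. Qed.

Lemma csmooth_atD q f g : csmooth_at q f -> csmooth_at q g ->
  csmooth_at q (fun p => f p + g p).
Proof.
move=> [fr fi] [gr gi]; split.
  by under eq_fun do rewrite cReD; exact: smooth_atD.
by under eq_fun do rewrite cImD; exact: smooth_atD.
Qed.

Lemma csmooth_atM q f g : csmooth_at q f -> csmooth_at q g ->
  csmooth_at q (fun p => f p * g p).
Proof.
move=> [fr fi] [gr gi]; split.
  by under eq_fun do rewrite cReM; apply: smooth_atB; exact: smooth_atM.
by under eq_fun do rewrite cImM; apply: smooth_atD; exact: smooth_atM.
Qed.

Lemma csmooth_at_conj q f : csmooth_at q f -> csmooth_at q (fun p => (f p)^*%C).
Proof.
move=> [fr fi]; split.
  by have -> : (fun p => Re (f p)^*%C) = (fun p => Re (f p)) by apply/funext => p; case: (f p).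
have -> : (fun p => Im (f p)^*%C) = (fun p => - Im (f p)) by apply/funext => p; case: (f p).
exact: smooth_atN.
Qed.

Lemma normc_sqr_real (z : R[i]) : z * z^*%C = (Re z ^+ 2 + Im z ^+ 2)%:C%C.
Proof.
case: z => a b; apply: complex_eq; rewrite ?cReM ?cImM /=; ring.
Qed.

Lemma Re2Im2_gt0 (z : R[i]) : z != 0 -> 0 < Re z ^+ 2 + Im z ^+ 2.
Proof.
move=> z0; rewrite lt_neqAle addr_ge0 ?sqr_ge0 // andbT eq_sym.
apply: contra z0; rewrite paddr_eq0 ?sqr_ge0 // !sqrf_eq0 => /andP[/eqP a /eqP b].
by apply/eqP; apply: complex_eq.
Qed.

Lemma smooth_at_normc2 q f : csmooth_at q f ->
  smooth_at q (fun p => Re (f p) ^+ 2 + Im (f p) ^+ 2).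
Proof.
move=> [fr fi]; under eq_fun do rewrite !expr2.
by apply: smooth_atD; exact: smooth_atM.
Qed.

Lemma near_neq0 q f : csmooth_at q f -> f q != 0 -> \forall p \near q, f p != 0.
Proof.
move=> sf f0; apply: filterS (near_gt0 (smooth_at_normc2 sf) (Re2Im2_gt0 f0)) => p.
by apply: contraTneq => ->; rewrite expr0n addr0 ltxx.
Qed.

Lemma csmooth_at_inv q f : csmooth_at q f -> f q != 0 ->
  csmooth_at q (fun p => (f p)^-1).
Proof.
move=> sf f0; have n0 := Re2Im2_gt0 f0; have sn := smooth_at_normc2 sf.
have := csmooth_atM (csmooth_at_conj sf) (csmooth_at_real (smooth_at_inv sn (lt0r_neq0 n0))).
apply: near_eq_csmooth_at; apply: filterS (near_neq0 sf f0) => p fp.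
have -> : ((Re (f p) ^+ 2 + Im (f p) ^+ 2)^-1)%:C%C = (f p * (f p)^*%C)^-1.
  by rewrite normc_sqr_real fmorphV.
by rewrite invfM mulrC -mulrA mulVf ?mulr1 // conjc_eq0.
Qed.

Lemma csmooth_at_sum (I : finType) q (f : I -> N -> R[i]) (P : pred I) :
  (forall i, csmooth_at q (f i)) -> csmooth_at q (fun p => \sum_(i | P i) f i p).
Proof.
move=> H; elim: (index_enum I) => [|i s IH].
  by under eq_fun do rewrite big_nil; exact: csmooth_at_cst.
under eq_fun do rewrite big_cons; case: (P i) => //; exact: csmooth_atD.
Qed.

Lemma csmooth_at_prod (I : finType) q (f : I -> N -> R[i]) :
  (forall i, csmooth_at q (f i)) -> csmooth_at q (fun p => \prod_i f i p).
Proof.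
move=> H; elim: (index_enum I) => [|i s IH].
  by under eq_fun do rewrite big_nil; exact: csmooth_at_cst.
by under eq_fun do rewrite big_cons; exact: csmooth_atM.
Qed.

Lemma csmooth_at_det n q (A : N -> 'M[R[i]]_n) :
  (forall i j, csmooth_at q (fun p => A p i j)) -> csmooth_at q (fun p => \det (A p)).
Proof.
move=> H; rewrite /determinant; apply: csmooth_at_sum => s.
by apply: csmooth_atM; [exact: csmooth_at_cst|exact: csmooth_at_prod].
Qed.

(* [cphase 0 = 0] *)
Definition cphase (z : R[i]) : R[i] := z * ((Num.sqrt (Re z ^+ 2 + Im z ^+ 2))^-1)%:C%C.

Definition expi (t : R) : R[i] := (cos t +i* sin t)%C.

Lemma csmooth_at_expi q (f : N -> R) : smooth_at q f -> csmooth_at q (fun p => expi (f p)).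
Proof. by move=> fq; split; [exact: smooth_at_cos|exact: smooth_at_sin]. Qed.

Lemma near_ctderiv q v f g : (\forall p \near q, f p = g p) ->
  ctderiv f q v = ctderiv g q v.
Proof.
move=> fg; congr (_ +i* _)%C; apply: (cder_near _ (cdom_chart_at q));
  by apply: filterS fg => p ->.
Qed.

Lemma ctderiv_cst q v (a : R[i]) : ctderiv (fun=> a : R[i]) q v = 0.
Proof. by apply: complex_eq; exact: cder_cst. Qed.

Lemma ctderivD q v f g : csmooth_at q f -> csmooth_at q g ->
  ctderiv (fun p => f p + g p) q v = ctderiv f q v + ctderiv g q v.
Proof.
move=> [fr fi] [gr gi]; apply: complex_eq; rewrite ?cReD ?cImD /=.
  by under eq_fun do rewrite cReD; exact: (cderD v (cdom_chart_at q) fr gr).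
by under eq_fun do rewrite cImD; exact: (cderD v (cdom_chart_at q) fi gi).
Qed.

Lemma tderivM q v (f g : N -> R) : smooth_at q f -> smooth_at q g ->
  tderiv (fun p => f p * g p) q v = f q * tderiv g q v + g q * tderiv f q v.
Proof. exact: (cderM v (cdom_chart_at q)). Qed.

Lemma tderivN q v (f : N -> R) : smooth_at q f ->
  tderiv (fun p => - f p) q v = - tderiv f q v.
Proof.
move=> fq; transitivity (tderiv (fun p => -1 * f p) q v).
  by apply: (cder_near _ (cdom_chart_at q)); near=> p; rewrite mulN1r.
rewrite (tderivM _ (smooth_at_cst q (-1)) fq) mulN1r.
by rewrite [X in _ + f q * X](cder_cst _ _ (-1) q) mulr0 addr0.
Unshelve. all: by end_near. Qed.

Lemma tderivD q v (f g : N -> R) : smooth_at q f -> smooth_at q g ->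
  tderiv (fun p => f p + g p) q v = tderiv f q v + tderiv g q v.
Proof. exact: (cderD v (cdom_chart_at q)). Qed.

Lemma ctderivM q v f g : csmooth_at q f -> csmooth_at q g ->
  ctderiv (fun p => f p * g p) q v = f q * ctderiv g q v + ctderiv f q v * g q.
Proof.
move=> [fr fi] [gr gi]; apply: complex_eq.
  rewrite cReD !cReM /=; under eq_fun do rewrite cReM.
  rewrite (tderivD _ (smooth_atM fr gr) (smooth_atN (smooth_atM fi gi))).
  rewrite (tderivN _ (smooth_atM fi gi)) (tderivM v fr gr) (tderivM v fi gi); ring.
rewrite cImD !cImM /=; under eq_fun do rewrite cImM.
rewrite (tderivD _ (smooth_atM fr gi) (smooth_atM fi gr)).
by rewrite (tderivM v fr gi) (tderivM v fi gr); ring.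
Qed.

Lemma ctderiv_conj q v f : csmooth_at q f ->
  ctderiv (fun p => (f p)^*%C) q v = (ctderiv f q v)^*%C.
Proof.
move=> [fr fi]; apply: complex_eq.
  by rewrite /ctderiv /=; congr tderiv; apply/funext => p; case: (f p).
rewrite /ctderiv /= -(tderivN _ fi).
by congr tderiv; apply/funext => p; case: (f p).
Qed.

Lemma ctderiv_linear q f (a : R) u v : csmooth_at q f ->
  ctderiv f q (a *: u + v) = a%:C%C * ctderiv f q u + ctderiv f q v.
Proof.
move=> [fr fi]; apply: complex_eq; rewrite ?cReD ?cImD ?cReM ?cImM /= (tderiv_linear _ _ _ _) //; ring.
Qed.

Lemma ctderiv_expi q v (f : N -> R) : smooth_at q f ->
  ctderiv (fun p => expi (f p)) q v = (0 +i* tderiv f q v)%C * expi (f q).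
Proof.
move=> fq; apply: complex_eq; rewrite ?cReM ?cImM /=.
  rewrite [LHS](cder_comp1 v (cdom_chart_at q) fq (is_derive_cos (f q))) /tderiv /cder; ring.
rewrite [LHS](cder_comp1 v (cdom_chart_at q) fq (is_derive_sin (f q))) /tderiv /cder; ring.
Qed.

Lemma csmooth_at_ctderiv q f X : smooth_vf (fun x : N => x) q X -> csmooth_at q f ->
  csmooth_at q (fun p => ctderiv f p (X p)).
Proof. by move=> HX [fr fi]; split; exact: smooth_vf_tderiv. Qed.

End ComplexSmooth.

Section ComplexMaps.
Context {R : realType} {d m : nat} (N : manifold R d) (M : manifold R m) (F : N -> M).
Hypothesis sF : smooth_map F.

Lemma csmooth_at_comp q (f : M -> R[i]) : csmooth_at (F q) f -> csmooth_at q (f \o F).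
Proof.
move=> [fr fi]; split; first exact: (smooth_at_comp sF fr).
exact: (smooth_at_comp sF fi).
Qed.

Lemma ctderiv_comp q v (f : M -> R[i]) : csmooth_at (F q) f ->
  ctderiv (f \o F) q v = ctderiv f (F q) (tmap F q v).
Proof.
move=> [fr fi]; congr (_ +i* _)%C; first exact: (tderiv_comp sF v fr).
exact: (tderiv_comp sF v fi).
Qed.

End ComplexMaps.

Section Forms.
Context {R : realType} {d n : nat} (N : manifold R d) (M : manifold R (2 * n)).
Variables (F : N -> M) (sF : smooth_map F) (w : M -> 'M[R]_(2 * n)).
Hypothesis symp : symplectic w.
Implicit Types (q : N) (X Y : N -> 'rV[R]_(2 * n)).

Lemma bil_linearl p (a : R) u u' v :
  bil w p (a *: u + u') v = a * bil w p u v + bil w p u' v.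
Proof. by rewrite /bil !mulmxDl -!scalemxAl mxE [X in X + _]mxE. Qed.

Lemma bil_linearr p (a : R) u v v' :
  bil w p u (a *: v + v') = a * bil w p u v + bil w p u v'.
Proof. by rewrite /bil linearP /= mulmxDr -scalemxAr mxE [X in X + _]mxE. Qed.

Lemma bil_skew p u v : bil w p u v = - bil w p v u.
Proof.
have [sk _ _ _] := symp; rewrite /bil -[in LHS](trmxK (_ *m _)) [in LHS]mxE.
rewrite !trmx_mul trmxK mulmxA sk.
by rewrite mulmxN mulNmx !mxE.
Qed.

Lemma bil_suml p (I : finType) (a : I -> R) (u : I -> 'rV[R]_(2 * n)) v :
  bil w p (\sum_i a i *: u i) v = \sum_i a i * bil w p (u i) v.
Proof.
have z : bil w p 0 v = 0 by rewrite /bil !mul0mx mxE.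
elim: (index_enum I) => [|i s IH]; first by rewrite !big_nil.
by rewrite !big_cons bil_linearl IH.
Qed.

Lemma bil_sumr p (I : finType) (a : I -> R) u (v : I -> 'rV[R]_(2 * n)) :
  bil w p u (\sum_i a i *: v i) = \sum_i a i * bil w p u (v i).
Proof.
rewrite bil_skew bil_suml -sumrN; apply: eq_bigr => i _.
by rewrite -mulrN -bil_skew.
Qed.

Lemma smooth_at_bil q X Y : smooth_vf F q X -> smooth_vf F q Y ->
  smooth_at q (fun p => bil w (F p) (X p) (Y p)).
Proof.
move=> HX HY; have cq := cdom_chart_at (F q); set c := chart_at (F q) in cq.
apply: (@near_eq_smooth_at _ _ _ _ (fun p => \sum_j \sum_l
  (ccomp c (F p) (X p) 0 j * ccomp c (F p) (Y p) 0 l) * bil_coord w c j l (F p))).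
  apply: filterS (near_cdom_map sF cq) => p cp.
  rewrite [in RHS](ccompK (X p) cp) [in RHS](ccompK (Y p) cp) bil_suml.
  apply: eq_bigr => j _; rewrite bil_sumr mulr_sumr.
  by apply: eq_bigr => l _; rewrite mulrA.
apply: smooth_at_sum => j; apply: smooth_at_sum => l.
apply: smooth_atM; first by apply: smooth_atM; [exact: HX|exact: HY].
apply: (smooth_at_comp (f := bil_coord w c j l) sF).
by have [_ _ H _] := symp; exact: H.
Qed.

Lemma smooth_vf_J q I X : compatible w I -> smooth_vf F q X ->
  smooth_vf F q (fun p => X p *m I (F p)).
Proof.
move=> [_ sI _ _] HX; have cq := cdom_chart_at (F q); set c := chart_at (F q) in cq.
apply: (@near_eq_smooth_vf _ _ _ _ _ _ _
   (fun p => \sum_j ccomp c (F p) (X p) 0 j *: (cvec c j (F p) *m I (F p)))).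
  apply: filterS (near_cdom_map sF cq) => p cp.
  rewrite [in RHS](ccompK (X p) cp) mulmx_suml.
  by apply: eq_bigr => j _; rewrite scalemxAl.
apply: (smooth_vf_sum sF) => j; first exact: HX.
apply: (smooth_vf_chart sF cq) => k.
exact: (smooth_at_comp sF (sI c (F q) j cq c cq k)).
Qed.

Lemma smooth_vfD q X Y : smooth_vf F q X -> smooth_vf F q Y ->
  smooth_vf F q (fun p => X p + Y p).
Proof.
move=> HX HY; have := @smooth_vf_sum _ _ _ _ _ _ sF bool q (fun _ _ => 1)
  (fun b => if b then X else Y) (fun=> smooth_at_cst q 1).
rewrite (_ : (fun p => \sum_i _) = (fun p => X p + Y p)).
  by apply; case.
by apply/funext => p; rewrite big_bool /= !scale1r.
Qed.

Lemma smooth_vfZ q (a : N -> R) X : smooth_at q a -> smooth_vf F q X ->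
  smooth_vf F q (fun p => a p *: X p).
Proof.
move=> Ha HX; have := @smooth_vf_sum _ _ _ _ _ _ sF unit q (fun _ => a) (fun _ => X)
  (fun=> Ha) (fun=> HX).
rewrite (_ : (fun p => \sum_i _) = (fun p => a p *: X p)) //.
by apply/funext => p; rewrite big_const card_unit /= addr0.
Qed.

Lemma csmooth_at_herm q I X Y : compatible w I -> smooth_vf F q X -> smooth_vf F q Y ->
  csmooth_at q (fun p => herm w I (F p) (X p) (Y p)).
Proof.
move=> cI HX HY; split => /=; first exact: (smooth_at_bil HX (smooth_vf_J cI HY)).
exact: (smooth_atN (smooth_at_bil HX HY)).
Qed.

End Forms.

(** * Exterior powers and Hermitian forms *)

Section Alternating.
Context {R : realType} {m n : nat} (J : 'M[R]_m).
Implicit Types (al be : ('I_n -> 'rV[R]_m) -> R[i]) (v u : 'I_n -> 'rV[R]_m).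

Lemma upd_same v j x : upd v j x j = x. Proof. by rewrite /upd eqxx. Qed.

Lemma upd_id v j : upd v j (v j) = v.
Proof. by apply/funext => i; rewrite /upd; case: eqP => [->|]. Qed.

Lemma updC v i j x y : i != j -> upd (upd v i x) j y = upd (upd v j y) i x.
Proof.
move=> ij; apply/funext => k; rewrite /upd.
by case: (eqVneq k j) => [->|//]; rewrite eq_sym (negbTE ij).
Qed.

Lemma calt_upd0 al v j : calt J al -> al (upd v j 0) = 0.
Proof.
move=> [lin _]; have := lin v j (-1) 0 0.
by rewrite /cact mul0mx !scaler0 !addr0 mulN1r addNr.
Qed.

Lemma calt_updD al v j x y : calt J al ->
  al (upd v j (x + y)) = al (upd v j x) + al (upd v j y).
Proof.
move=> [lin _]; have := lin v j 1 x y.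
by rewrite /cact /= scale1r scale0r addr0 mul1r.
Qed.

Lemma calt_upd_sum al v j (z : 'I_n -> R[i]) (x : 'I_n -> 'rV[R]_m) : calt J al ->
  al (upd v j (\sum_k cact J (z k) (x k))) = \sum_k z k * al (upd v j (x k)).
Proof.
move=> H; elim: (index_enum _) => [|k s IH]; first by rewrite !big_nil calt_upd0.
by rewrite !big_cons -IH; case: H => lin _; rewrite lin.
Qed.

Lemma calt_swap al v i j : calt J al -> i != j ->
  al (fun k => v (tperm i j k)) = - al v.
Proof.
move=> H ij; apply/eqP; rewrite -addr_eq0; apply/eqP.
pose w x y := upd (upd v i x) j y.
have E : al (w (v i + v j) (v i + v j)) = 0.
  case: H => _ H; apply: (H _ i j ij).
  by rewrite /w upd_same (updC _ _ _ ij) upd_same.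
have A x y x' : al (w (x + x') y) = al (w x y) + al (w x' y).
  by rewrite /w !(updC _ _ _ ij) calt_updD.
have B x y y' : al (w x (y + y')) = al (w x y) + al (w x y').
  by rewrite /w calt_updD.
have Z x : al (w x x) = 0.
  case: H => _ H; apply: (H _ i j ij).
  by rewrite /w upd_same (updC _ _ _ ij) upd_same.
move: E; rewrite A !B !Z add0r addr0 addrC => E; rewrite -[RHS]E; congr (al _ + al _).
  apply/funext => k; rewrite /w /upd.
  by case: tpermP => [->|->|/eqP/negbTE-> /eqP/negbTE->] //;
    rewrite ?eqxx // (negbTE ij).
by rewrite /w (updC _ _ _ ij) upd_id upd_id.
Qed.

Lemma calt_comb al be z : calt J al -> calt J be -> calt J ((z \*o al) \+ be).
Proof.
move=> [la aa] [lb ab]; split.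
  by move=> v j z' x y /=; rewrite la lb; ring.
by move=> v i j ij vij /=; rewrite (aa v i j) // (ab v i j) // mulr0 addr0.
Qed.

Lemma calt_perm_eq0 al v (s : {perm 'I_n}) : calt J al -> al v = 0 ->
  al (fun k => v (s k)) = 0.
Proof.
move=> H v0; have [ts -> _] := prod_tpermP s.
elim: ts v v0 => [|t ts IH] v v0.
  by rewrite big_nil; under eq_fun do rewrite perm1.
rewrite big_cons; under eq_fun do rewrite permM.
have [tt|tt] := eqVneq t.1 t.2.
  by rewrite tt; under eq_fun do rewrite tperm1 perm1; exact: IH.
rewrite (@calt_swap al (fun k => v ((\prod_(i <- ts) tperm i.1 i.2)%g k))) //.
by rewrite IH // oppr0.
Qed.

Definition cspanning v := forall x, exists z : 'I_n -> R[i], x = \sum_k cact J (z k) (v k).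

(** Expanding every argument over the n spanning vectors leaves values of [al] on families [v \o f];
    either [f] is a permutation, or two arguments coincide. This is why the top exterior power is at
    most a line. *)
Lemma calt_eq0 al v : calt J al -> cspanning v -> al v = 0 -> forall u, al u = 0.
Proof.
move=> H sp v0.
have base (f : 'I_n -> 'I_n) : al (fun k => v (f k)) = 0.
  have [/injectiveP fi|/injectivePn[i [j ij fij]]] := boolP (injectiveb f).
    rewrite -[RHS](calt_perm_eq0 (perm fi) H v0); congr al.
    by apply/funext => k; rewrite permE.
  by case: H => _; apply; [exact: ij|rewrite fij].
(* Induction on the number [k] of leading slots that still hold arbitrary vectors; the other slots
   already hold members of [v]. *)
suff step k : (k <= n)%N -> forall u, (forall i : 'I_n, (k <= i)%N -> exists l, u i = v l) ->
    al u = 0.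
  by move=> u; apply: (step n) => // i; rewrite leqNgt ltn_ord.
elim: k => [_ u uv|k IH kn u uv].
  pose f i := xget i [set l | u i = v l].
  have -> : u = fun i => v (f i).
    apply/funext => i; have [l ul] := uv i isT.
    by rewrite /f; case: xgetP => [y _ //|/(_ l)/(_ ul)].
  exact: base.
pose j := Ordinal kn; have [z uj] := sp (u j).
rewrite -(upd_id u j) uj calt_upd_sum // big1 // => l _.
rewrite IH ?mulr0 //; first exact: ltnW.
move=> i; rewrite leq_eqVlt => /orP[/eqP ki|ki].
  by exists l; rewrite (_ : i = j) ?upd_same //; exact: val_inj.
have [l' ul'] := uv i ki; exists l'; rewrite /upd ifF //.
by apply/eqP => ij; rewrite ij ltnn in ki.
Qed.

Lemma wedgeE v al : calt J al -> wedge J v al = al v.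
Proof. by move=> H; rewrite /wedge; case: asboolP. Qed.

Lemma ext_power_wedge v : ext_power J (wedge J v).
Proof.
split=> [al nal|z al be ca cb]; first by rewrite /wedge; case: asboolP.
by rewrite !wedgeE //; exact: calt_comb.
Qed.

Lemma ext_power_comb z (L L' : mvec R m n) : ext_power J L -> ext_power J L' ->
  ext_power J ((z \*o L) \+ L').
Proof.
move=> [L0 Ll] [L0' Ll']; split=> [al nal /=|c al be ca cb /=].
  by rewrite L0 // L0' // mulr0 addr0.
by rewrite Ll // Ll' //; ring.
Qed.

Lemma ext_power0 : @ext_power R m n J (fun=> 0).
Proof. by split=> // z al be _ _; rewrite mulr0 addr0. Qed.

Lemma ext_powerZ z (L : mvec R m n) : ext_power J L -> ext_power J (z \*o L).
Proof.
move=> HL; have := ext_power_comb z HL ext_power0.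
by rewrite (_ : _ \+ _ = z \*o L) //; apply/funext => al /=; rewrite addr0.
Qed.

Lemma calt_zero : @calt R m n J (fun=> 0).
Proof. by split=> // u j z x y; rewrite mulr0 addr0. Qed.

Lemma ext_power_linear0 (L : mvec R m n) : ext_power J L -> L (fun=> 0) = 0.
Proof.
move=> [_ HL]; have := HL (-1) _ _ calt_zero calt_zero.
rewrite mulN1r addNr => E; rewrite -[RHS]E; congr L.
by apply/funext => u /=; rewrite mulr0 addr0.
Qed.

Lemma ext_power_linearZ (L : mvec R m n) z al : ext_power J L -> calt J al ->
  L (z \*o al) = z * L al.
Proof.
move=> HL ca; have L0 := ext_power_linear0 HL; case: HL => _ HL.
have := HL z al _ ca calt_zero; rewrite L0 addr0 => E; rewrite -[RHS]E; congr L.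
by apply/funext => u /=; rewrite addr0.
Qed.

(** The form [be - be v * al] vanishes on the spanning family [v], hence everywhere, so [L] takes
    the same value on [be] and on [be v * al]. *)
Lemma ext_power_eq (L : mvec R m n) v al : ext_power J L -> cspanning v ->
  calt J al -> al v = 1 -> L = L al \*o wedge J v.
Proof.
move=> HL sp ca a1; have [L0 Ll] := HL; apply/funext => be /=.
have [cb|nb] := pselect (calt J be); last first.
  by rewrite L0 // /wedge; case: asboolP => //; rewrite mulr0.
rewrite wedgeE // mulrC -[LHS]addr0.
have be0 : calt J ((- be v \*o al) \+ be) by exact: calt_comb.
have Z : L ((- be v \*o al) \+ be) = 0.
  rewrite -[RHS](ext_power_linear0 HL); congr L; apply/funext => u.
  by rewrite (calt_eq0 be0 sp) //= a1 mulr1 addNr.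
by move: Z; rewrite Ll // => /eqP; rewrite mulNr addrC subr_eq0 => /eqP ->; rewrite addr0.
Qed.

End Alternating.

Section Push.
Context {R : realType} {m n : nat} (J J' T : 'M[R]_m).
Hypothesis JT : J *m T = T *m J'.

(** The map induced by [T] on top exterior powers, as the transpose of the pull-back of forms along
    [T]. The value 0 on other functions is the convention of [ext_power]. *)
Definition push (L : mvec R m n) : mvec R m n := fun al =>
  if `[< calt J' al >] then L (fun v => al (fun i => v i *m T)) else 0.

Lemma cact_mulmx z x : cact J z x *m T = cact J' z (x *m T).
Proof. by rewrite /cact mulmxDl -!scalemxAl -!mulmxA JT. Qed.

Lemma calt_push (al : ('I_n -> 'rV[R]_m) -> R[i]) : calt J' al -> calt J (fun v => al (fun i => v i *m T)).
Proof.
move=> [lin alt].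
have U v j x : (fun i => upd v j x i *m T) = upd (fun i => v i *m T) j (x *m T).
  by apply/funext => i; rewrite /upd; case: eqP.
split=> [v j z x y|v i j ij vij]; last by apply: (alt _ i j ij); rewrite vij.
by rewrite !U mulmxDl cact_mulmx lin.
Qed.

Lemma push_wedge v : push (wedge J v) = wedge J' (fun i => v i *m T).
Proof.
apply/funext => al; rewrite /push /wedge; case: asboolP => // ca.
by case: asboolP => // -[]; exact: calt_push.
Qed.

Lemma pushZ z L : push (z \*o L) = z \*o push L.
Proof. by apply/funext => al; rewrite /push /=; case: asboolP => //; rewrite mulr0. Qed.

End Push.

Section HermitianForm.
Context {R : realType} {n : nat} (M : manifold R (2 * n)).
Variables (w I : M -> 'M[R]_(2 * n)).
Hypotheses (symp : symplectic w) (comp : compatible w I).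
Variable (p : M).
Local Notation H := (herm w I p).
Local Notation G := (metric w I p).

Lemma bilNl u v : bil w p (- u) v = - bil w p u v.
Proof. by rewrite /bil !mulNmx mxE. Qed.

Lemma bilNr u v : bil w p u (- v) = - bil w p u v.
Proof. by rewrite /bil linearN mulmxN mxE. Qed.

Lemma bilZl a u v : bil w p (a *: u) v = a * bil w p u v.
Proof. by rewrite /bil -!scalemxAl mxE. Qed.

Lemma bilZr a u v : bil w p u (a *: v) = a * bil w p u v.
Proof. by rewrite /bil linearZ /= -scalemxAr mxE. Qed.

Lemma JJ (v : 'rV[R]_(2 * n)) : v *m I p *m I p = - v.
Proof. by case: comp => JJ _ _ _; rewrite -mulmxA JJ mulmxN mulmx1. Qed.

Lemma metric_sym u v : G u v = G v u.
Proof.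
case: comp => _ _ inv _; rewrite /metric bil_skew // -inv JJ.
by rewrite bilNl opprK.
Qed.

Lemma metric_Jl u v : G (u *m I p) v = bil w p u v.
Proof. by case: comp => _ _ inv _; rewrite /metric inv. Qed.

Lemma metric_Jr u v : G u (v *m I p) = - bil w p u v.
Proof. by rewrite /metric JJ bilNr. Qed.

Lemma metric_gt0 v : v != 0 -> 0 < G v v.
Proof. by case: comp => _ _ _; apply. Qed.

Lemma bil_self v : bil w p v v = 0.
Proof. by have := bil_skew symp p v v; lra. Qed.

Lemma metric_linearl (a : R) u u' v : G (a *: u + u') v = a * G u v + G u' v.
Proof. exact: bil_linearl. Qed.

Lemma herm_linearl z u u' v : H (cact (I p) z u + u') v = z * H u v + H u' v.
Proof.
apply: complex_eq; rewrite ?cReD ?cImD ?cReM ?cImM /= /cact.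
  by rewrite -addrA !metric_linearl metric_Jl; ring.
rewrite -addrA !bil_linearl.
have -> : bil w p (u *m I p) v = - G u v.
  by case: comp => _ _ inv _; rewrite /metric -(inv p u) JJ bilNr opprK.
ring.
Qed.

Lemma herm_conj u v : H v u = (H u v)^*%C.
Proof. by apply: complex_eq; rewrite /= ?(metric_sym v u) // (bil_skew symp p v u). Qed.

Lemma hermvv v : H v v = (G v v)%:C%C.
Proof. by apply: complex_eq; rewrite //= bil_self oppr0. Qed.

(** This is the Hermitian product with the wedge of [u]. It provides the dual form that
    [ext_power_eq] asks for. *)
Lemma calt_det (u : 'I_n -> 'rV[R]_(2 * n)) :
  calt (I p) (fun v => \det (\matrix_(i, j) H (v i) (u j))).
Proof.
split=> [v j z x y|v i j ij vij].
  rewrite (determinant_multilinear (i0 := j) (b := z) (c := 1)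
    (B := \matrix_(i, k) H (upd v j x i) (u k))
    (C := \matrix_(i, k) H (upd v j y i) (u k))) ?mul1r //.
  - by apply/rowP => k; rewrite !mxE !upd_same herm_linearl mul1r.
  - by apply/matrixP => a b; rewrite !mxE /upd eq_sym (negbTE (neq_lift _ _)).
  - by apply/matrixP => a b; rewrite !mxE /upd eq_sym (negbTE (neq_lift _ _)).
by apply: (determinant_alternate ij) => k; rewrite !mxE vij.
Qed.

Lemma det_herm_conj (u v : 'I_n -> 'rV[R]_(2 * n)) :
  (\det (\matrix_(i, j) H (u i) (v j)))^*%C = \det (\matrix_(i, j) H (v i) (u j)).
Proof.
rewrite -det_map_mx -det_tr; congr (\det _).
by apply/matrixP => i j; rewrite !mxE (herm_conj (u j) (v i)).
Qed.

Definition ext_dot (L L' : mvec R (2 * n) n) : R[i] := ext_herm H L L'.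

Lemma ext_dot_wedger (L : mvec R (2 * n) n) b v :
  ext_power (I p) L ->
  ext_dot L (b \*o wedge (I p) v)
   = b^*%C * L (fun u => \det (\matrix_(i, j) H (u i) (v j))).
Proof.
move=> HL; rewrite /ext_dot /ext_herm /=.
have -> : (fun u => ((b * wedge (I p) v (fun w0 => \det (\matrix_(i, j) H (w0 i) (u j))))^*)%C)
   = b^*%C \*o (fun u => \det (\matrix_(i, j) H (u i) (v j))).
  apply/funext => u; rewrite wedgeE ?rmorphM /= ?det_herm_conj //.
  exact: calt_det.
exact: (ext_power_linearZ _ HL (calt_det v)).
Qed.

Lemma ext_dot_wedge u v : ext_dot (wedge (I p) u) (wedge (I p) v)
  = \det (\matrix_(i, j) H (u i) (v j)).
Proof.
have := ext_dot_wedger 1 v (ext_power_wedge (I p) u).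
rewrite conjc1 mul1r (wedgeE _ (calt_det v)) => <-; congr (ext_dot _ _).
by apply/funext => al /=; rewrite mul1r.
Qed.

Definition unitary_frame (v : 'I_n -> 'rV[R]_(2 * n)) :=
  forall i j, H (v i) (v j) = (i == j)%:R.

Lemma mulmx_tr_row a b c (A : 'M[R]_(a, c)) (B : 'M[R]_(b, c)) i j :
  (A *m B^T) i j = (row i A *m (row j B)^T) 0 0.
Proof. by rewrite !mxE; apply: eq_bigr => l _; rewrite !mxE. Qed.

Section Orthonormal.
Variables (k : nat) (E : 'M[R]_(k, 2 * n)).
Hypothesis orth : forall i j, H (row i E) (row j E) = (i == j)%:R.
Let S := col_mx E (E *m I p).
Let Gm := w p *m (I p)^T.

Lemma metricE u v : G u v = (u *m Gm *m v^T) 0 0.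
Proof. by rewrite /metric /bil /Gm trmx_mul !mulmxA. Qed.

(** A Hermitian orthonormal family and its image under I are together orthonormal for G. For k = n
    this gives 2n independent vectors, whence complex spanning. *)
Lemma gram_orthonormal : S *m Gm *m S^T = 1%:M.
Proof.
have G1 i j : G (row i E) (row j E) = (i == j)%:R.
  by have := congr1 (@complex.Re R) (orth i j); rewrite /= => ->; case: eqP.
have B1 i j : bil w p (row i E) (row j E) = 0.
  have := congr1 (@complex.Im R) (orth i j); rewrite /= => e; apply: oppr_inj.
  by rewrite e oppr0; case: eqP.
have e (i j : 'I_(k + k)) : (S *m Gm *m S^T) i j = G (row i S) (row j S).
  by rewrite metricE mulmx_tr_row row_mul.
apply/matrixP => i j; rewrite e [RHS]mxE /S.
case: (split_ordP i) => i' ->; case: (split_ordP j) => j' ->.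
- by rewrite !rowKu G1 (inj_eq (@lshift_inj _ _)).
- rewrite rowKu rowKd row_mul metric_Jr B1 oppr0.
  by rewrite eq_lrshift.
- by rewrite rowKu rowKd row_mul metric_Jl B1 eq_rlshift.
- rewrite !rowKd !row_mul metric_Jl -/(G _ _) G1.
  by rewrite (inj_eq (@rshift_inj _ _)).
Qed.

Lemma row_free_orthonormal : row_free S.
Proof.
apply/row_freeP; exists (Gm *m S^T).
by rewrite mulmxA gram_orthonormal.
Qed.

Lemma orthonormal_extend : (k < n)%N -> exists x, x != 0 /\
  forall i, H x (row i E) = 0.
Proof.
(* The vector sought must be G-orthogonal to the rows of [E] and to their images under I, which are
   the real and imaginary parts of Hermitian orthogonality: k + k < 2n linear conditions. *)
move=> kn; set A := (S *m Gm)^T; have rA : (\rank A < 2 * n)%N.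
  by rewrite (leq_ltn_trans (rank_leq_col A)) // mul2n -addnn -addnS leq_add // ltnW.
have : kermx A != 0 by rewrite -mxrank_eq0 mxrank_ker subn_eq0 -ltnNge.
move=> /rowV0Pn[x /sub_kermxP xA x0]; exists x; split=> // i.
have e (j : 'I_(k + k)) : G (row j S) x = 0.
  have := congr1 (fun B : 'rV_(k + k) => B 0 j) xA; rewrite /A [RHS]mxE => <-.
  rewrite metricE -row_mul -[x in RHS]trmxK -trmx_mul [RHS]mxE.
  by rewrite [RHS]mulmx_tr_row row_id.
apply: complex_eq => /=.
  by rewrite metric_sym -(e (lshift k i)) rowKu.
by rewrite (bil_skew symp) opprK -metric_Jl -(e (rshift k i)) rowKd row_mul.
Qed.

End Orthonormal.

Lemma exists_orthonormal k : (k <= n)%N -> exists E : 'M[R]_(k, 2 * n),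
  forall i j, H (row i E) (row j E) = (i == j)%:R.
Proof.
elim: k => [_|k IH kn]; first by exists 0; case.
have [E orth] := IH (ltnW kn).
have [x [x0 xE]] := orthonormal_extend E kn.
have g0 := metric_gt0 x0; set r := (Num.sqrt (G x x))^-1.
have r0 : 0 < r by rewrite invr_gt0 sqrtr_gt0.
have Hr (u v : 'rV[R]_(2 * n)) (a b : R) : H (a *: u) (b *: v) = (a * b)%:C%C * H u v.
  by apply: complex_eq; rewrite ?cReM ?cImM /= /metric -?scalemxAl bilZl bilZr; ring.
have z (v : 'rV[R]_(2 * n)) : v = 1 *: v by rewrite scale1r.
pose C : 'M[R]_(1 + k, 2 * n) := col_mx (r *: (x : 'rV_(2 * n))) E.
suff H1 (i j : 'I_(1 + k)) : H (row i C) (row j C) = (i == j)%:R by exists C.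
rewrite /C; case: (split_ordP i) => i' ->; case: (split_ordP j) => j' ->.
- rewrite !rowKu !row_id Hr hermvv (inj_eq (@lshift_inj _ _)) !ord1 eqxx.
  rewrite -rmorphM /= -[X in _ * X](sqr_sqrtr (ltW g0)) /r expr2.
  by rewrite mulrACA mulVf ?mulr1 // lt0r_neq0 // sqrtr_gt0.
- by rewrite rowKu rowKd row_id (z (row _ _)) Hr xE mulr0 eq_lrshift.
- by rewrite rowKu rowKd row_id (z (row _ _)) Hr herm_conj xE conjc0 mulr0 eq_rlshift.
- by rewrite !rowKd orth (inj_eq (@rshift_inj _ _)).
Qed.

Lemma exists_unitary_frame : exists v, unitary_frame v /\ cspanning (I p) v.
Proof.
have [E orth] := exists_orthonormal (leqnn n); exists (fun i => row i E); split=> // x.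
have rf := @row_free_orthonormal _ E orth.
have fl : row_full (col_mx E (E *m I p)).
  by rewrite /row_full (eqP rf) mul2n addnn.
have /submxP[c ->] : (x <= col_mx E (E *m I p))%MS by rewrite submx_full.
exists (fun k => (c 0 (lshift n k) +i* c 0 (rshift n k))%C).
rewrite -{1}(hsubmxK c) mul_row_col !mulmx_sum_row -big_split /=.
by apply: eq_bigr => k _; rewrite /cact /= !mxE -row_mul.
Qed.

(** A unitary frame wedges to a unit vector, and its dual form shows that this vector spans. From
    here on, identities in a fibre of K^-1 reduce to identities between complex scalars. *)
Lemma exists_line : exists v, ext_dot (wedge (I p) v) (wedge (I p) v) = 1
  /\ forall L : mvec R (2 * n) n, ext_power (I p) L ->
       L = ext_dot L (wedge (I p) v) \*o wedge (I p) v.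
Proof.
have [v [uv sp]] := exists_unitary_frame; exists v.
have d1 : \det (\matrix_(i, j) H (v i) (v j)) = 1.
  rewrite -[RHS](det1 _ n); congr (\det _); apply/matrixP => i j.
  by rewrite !mxE uv.
split; first by rewrite ext_dot_wedge.
move=> L HL; have e := ext_power_eq HL sp (calt_det v) d1.
rewrite {1}e; congr (_ \*o _).
have := ext_dot_wedger 1 v HL; rewrite conjc1 mul1r => <-; congr (ext_dot _ _).
by apply/funext => al /=; rewrite mul1r.
Qed.

Lemma ext_dot_line v c c' : ext_dot (wedge (I p) v) (wedge (I p) v) = 1 ->
  ext_dot (c \*o wedge (I p) v) (c' \*o wedge (I p) v) = c * c'^*%C.
Proof.
move=> v1; have -> : ext_dot (c \*o wedge (I p) v) (c' \*o wedge (I p) v)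
  = c * ext_dot (wedge (I p) v) (c' \*o wedge (I p) v) by [].
rewrite (ext_dot_wedger _ _ (ext_power_wedge (I p) v)) (wedgeE _ (calt_det v)).
by rewrite -ext_dot_wedge v1 mulr1.
Qed.

Lemma ext_dot_conj (L L' : mvec R (2 * n) n) :
  ext_power (I p) L -> ext_power (I p) L' -> ext_dot L' L = (ext_dot L L')^*%C.
Proof.
have [v [v1 sp]] := exists_line => HL HL'.
move: (sp L HL) (sp L' HL'); move: (ext_dot L _) (ext_dot L' _) => a b -> ->.
by rewrite !ext_dot_line // rmorphM /= conjcK mulrC.
Qed.

Lemma ext_dot_unit (L e : mvec R (2 * n) n) :
  ext_power (I p) L -> ext_power (I p) e -> ext_dot e e = 1 ->
  L = ext_dot L e \*o e.
Proof.
have [v [v1 sp]] := exists_line => HL He.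
move: (sp L HL) (sp e He); move: (ext_dot L _) (ext_dot e _) => a b -> ->.
rewrite !ext_dot_line // => b1; apply/funext => al /=.
by rewrite mulrA -(mulrA a) (mulrC _ b) b1 mulr1.
Qed.

Lemma ext_dot_mulr (a b : R[i]) (e : mvec R (2 * n) n) :
  ext_power (I p) e -> ext_dot e e = 1 -> ext_dot (a \*o e) (b \*o e) = a * b^*%C.
Proof.
move=> He e1; have -> : ext_dot (a \*o e) (b \*o e) = a * ext_dot e (b \*o e) by [].
rewrite (ext_dot_conj (ext_powerZ b He) He).
have -> : ext_dot (b \*o e) e = b * ext_dot e e by [].
by rewrite e1 mulr1.
Qed.

End HermitianForm.

(** * Sections and Hermitian connections *)

Lemma cconjD (R : rcfType) (x y : R[i]) : (x + y)^*%C = x^*%C + y^*%C.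
Proof. exact: rmorphD. Qed.

Lemma cconjM (R : rcfType) (x y : R[i]) : (x * y)^*%C = x^*%C * y^*%C.
Proof. exact: rmorphM. Qed.

Lemma near_near (T : topologicalType) (q : T) (P : set T) :
  (\forall p \near q, P p) -> \forall p \near q, \forall x \near p, P x.
Proof. exact: nbhs_interior. Qed.

Section Sections.
Context {R : realType} {d n : nat} (N : manifold R d) (M : manifold R (2 * n)).
Variables (F : N -> M) (sF : smooth_map F) (w I : M -> 'M[R]_(2 * n)).
Hypotheses (symp : symplectic w) (comp : compatible w I).
Implicit Types (q p : N) (s t e : @section R n d N).

Local Notation hk := (hK F w I).
Local Notation ext p := (ext_power (I (F p))).

Lemma near_smooth_vf q X : smooth_vf F q X -> \forall p \near q, smooth_vf F p X.
Proof.
move=> HX; have cq := cdom_chart_at (F q).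
have H : \forall p \near q, forall k,
    smooth_at p (fun x => ccomp (chart_at (F q)) (F x) (X x) 0 k).
  by apply: filter_forall => k; apply: near_smooth_at; exact: HX.
by apply: filterS2 (near_cdom_map sF cq) H => p cp; exact: smooth_vf_chart.
Qed.

Lemma near_smooth_section q s : smooth_section F I q s ->
  \forall p \near q, smooth_section F I p s.
Proof.
move=> [X [f [HX Hf Hs]]].
have HX' : \forall p \near q, forall i, smooth_vf F p (X i).
  by apply: filter_forall => i; exact: near_smooth_vf.
near=> p; exists X, f; split.
- by near: p.
- by near: p; exact: near_csmooth_at.
- by near: p; exact: near_near.
Unshelve. all: by end_near. Qed.

Lemma near_eq_smooth_section q s t : (\forall p \near q, s p = t p) ->
  smooth_section F I q s -> smooth_section F I q t.
Proof.
move=> st [X [f [HX Hf Hs]]]; exists X, f; split=> //.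
by apply: filterS2 st Hs => p ->.
Qed.

Lemma smooth_section_ext q s : smooth_section F I q s -> \forall p \near q, ext p (s p).
Proof.
move=> [X [f [_ _ Hs]]]; apply: filterS Hs => p ->.
by apply: ext_powerZ; exact: ext_power_wedge.
Qed.

Lemma smooth_section_extq q s : smooth_section F I q s -> ext q (s q).
Proof. by move=> /smooth_section_ext /nbhs_singleton. Qed.

Lemma hKZl p c L L' : hk p (c \*o L) L' = c * hk p L L'.
Proof. by []. Qed.

Lemma hKDl p L1 L2 L' : hk p (L1 \+ L2) L' = hk p L1 L' + hk p L2 L'.
Proof. by []. Qed.

Lemma hK_conj p L L' : ext p L -> ext p L' -> hk p L' L = (hk p L L')^*%C.
Proof. exact: ext_dot_conj. Qed.

Lemma hKZr p c L L' : ext p L -> ext p L' -> hk p L (c \*o L') = c^*%C * hk p L L'.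
Proof.
move=> HL HL'; rewrite (hK_conj (ext_powerZ c HL') HL) hKZl rmorphM /=.
by rewrite -(hK_conj HL' HL).
Qed.

Lemma hK_unit p (L e : mvec R (2 * n) n) : ext p L -> ext p e -> hk p e e = 1 -> L = hk p L e \*o e.
Proof. exact: ext_dot_unit. Qed.

Lemma csmooth_hK_wedge q (X Y : 'I_n -> N -> 'rV[R]_(2 * n)) :
  (forall i, smooth_vf F q (X i)) -> (forall i, smooth_vf F q (Y i)) ->
  csmooth_at q (fun p => hk p (wedge (I (F p)) (fun i => X i p))
                             (wedge (I (F p)) (fun i => Y i p))).
Proof.
move=> HX HY; apply: (@eq_csmooth_at _ _ _ _
  (fun p => \det (\matrix_(i, j) herm w I (F p) (X i p) (Y j p)))).
  by move=> p; rewrite -(ext_dot_wedge symp comp).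
apply: csmooth_at_det => i j.
apply: (@eq_csmooth_at _ _ _ _ (fun p => herm w I (F p) (X i p) (Y j p))).
  by move=> p; rewrite mxE.
exact: csmooth_at_herm.
Qed.

Lemma csmooth_hK q s t : smooth_section F I q s -> smooth_section F I q t ->
  csmooth_at q (fun p => hk p (s p) (t p)).
Proof.
move=> [X [f [HX Hf Hs]]] [Y [g [HY Hg Ht]]].
apply: (@near_eq_csmooth_at _ _ _ _ (fun p => f p * ((g p)^*%C *
   hk p (wedge (I (F p)) (fun i => X i p)) (wedge (I (F p)) (fun i => Y i p))))).
  apply: filterS2 Hs Ht => p -> ->.
  by rewrite hKZl hKZr //; exact: ext_power_wedge.
apply: csmooth_atM => //; apply: csmooth_atM; first exact: csmooth_at_conj.
exact: csmooth_hK_wedge.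
Qed.

Lemma smooth_sectionZ q s f : csmooth_at q f -> smooth_section F I q s ->
  smooth_section F I q (fun p => f p \*o s p).
Proof.
move=> Hf [X [g [HX Hg Hs]]]; exists X, (fun p => f p * g p); split=> //.
  exact: csmooth_atM.
apply: filterS Hs => p ->; apply/funext => al /=; exact: mulrA.
Qed.

Lemma smooth_section_wedge q (X : 'I_n -> N -> 'rV[R]_(2 * n)) :
  (forall i, smooth_vf F q (X i)) ->
  smooth_section F I q (fun p => wedge (I (F p)) (fun i => X i p)).
Proof.
move=> HX; exists X, (fun=> 1); split=> //; first exact: csmooth_at_cst.
by near=> p; apply/funext => al /=; rewrite mul1r.
Unshelve. all: by end_near. Qed.

Definition unit_section q e : Prop :=
  \forall p \near q, smooth_section F I p e /\ hk p (e p) (e p) = 1.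

Lemma near_unit_section q e : unit_section q e -> \forall p \near q, unit_section p e.
Proof. exact: near_near. Qed.

Lemma unit_section_smooth q e : unit_section q e -> smooth_section F I q e.
Proof. by move=> /nbhs_singleton[]. Qed.

Lemma unit_section1 q e : unit_section q e -> hk q (e q) (e q) = 1.
Proof. by move=> /nbhs_singleton[]. Qed.

Lemma unit_section_ext q e : unit_section q e -> ext q (e q).
Proof. by move=> /unit_section_smooth /smooth_section_extq. Qed.

Lemma unit_frame q e s : unit_section q e -> smooth_section F I q s ->
  \forall p \near q, s p = hk p (s p) (e p) \*o e p.
Proof.
move=> ue ss; apply: filterS2 (smooth_section_ext ss) (near_unit_section ue) => p es up.
apply: hK_unit => //; first exact: unit_section_ext.
exact: unit_section1.
Qed.

Lemma hK_real p L : ext p L -> Im (hk p L L) = 0.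
Proof.
move=> HL; have := hK_conj HL HL; case: (hk p L L) => a b [] /= e.
by lra.
Qed.

Lemma normalize_section q s : smooth_section F I q s -> 0 < Re (hk q (s q) (s q)) ->
  unit_section q
   (fun p => ((Num.sqrt (Re (hk p (s p) (s p))))^-1)%:C%C \*o s p).
Proof.
move=> ss r0; have sr : smooth_at q (fun p => Re (hk p (s p) (s p))).
  by have [] := csmooth_hK ss ss.
have s1 : smooth_section F I q
   (fun p => ((Num.sqrt (Re (hk p (s p) (s p))))^-1)%:C%C \*o s p).
  apply: smooth_sectionZ => //; apply: csmooth_at_real; apply: smooth_at_inv.
    exact: smooth_at_sqrt.
  by rewrite lt0r_neq0 // sqrtr_gt0.
apply: filterS3 (near_smooth_section s1) (near_gt0 sr r0) (smooth_section_ext ss).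
move=> p sp p0 ep; split=> //.
rewrite hKZl hKZr //.
have -> : hk p (s p) (s p) = (Re (hk p (s p) (s p)))%:C%C.
  by apply: complex_eq => //=; exact: hK_real.
set a := Re _ in p0 *; rewrite conjc_real -!rmorphM /=.
rewrite -{3}(sqr_sqrtr (ltW p0)) expr2 mulrA mulrACA.
by rewrite mulVf ?mulr1 // lt0r_neq0 // sqrtr_gt0.
Qed.

Lemma exists_unit_section q : exists e, unit_section q e.
Proof.
have [v [v1 _]] := exists_line symp comp (F q).
have cq := cdom_chart_at (F q); set c := chart_at (F q) in cq.
(* The frame [v] of the fibre at [F q] is extended to neighbouring fibres with constant components
   in the chart [c]; its wedge stays nonzero near [q] and can be normalised. *)
pose X i p : 'rV[R]_(2 * n) := \sum_k ccomp c (F q) (v i) 0 k *: cvec c k (F p).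
have sX i : smooth_vf F q (X i).
  apply: (smooth_vf_sum sF) => k; first exact: smooth_at_cst.
  exact: smooth_vf_cvec.
have Xq : (fun i => X i q) = v by apply/funext => i; rewrite /X -ccompK.
eexists; apply: (normalize_section (smooth_section_wedge sX)) => /=.
by rewrite Xq /hK -/(ext_dot _ _ _ _ _) v1 /= ltr01.
Qed.

Section ConnectionForm.
Variables (b : @connection R n d N) (Hb : hermitian_connection F w I b).

(** The local form A of d + A in the frame [e]: since [e] is a unit section of a line bundle,
    pairing the derivative of [e] with [e] extracts its coefficient. *)
Definition conn_form e q v : R[i] := hk q (b e q v) (e q).

Lemma conn_formE q e v : unit_section q e -> b e q v = conn_form e q v \*o e q.
Proof.
move=> ue; apply: hK_unit; [|exact: unit_section_ext|exact: unit_section1].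
exact: (conn_fiber Hb v (unit_section_smooth ue)).
Qed.

Lemma conn_frame q e s v : unit_section q e -> smooth_section F I q s ->
  b s q v = (ctderiv (fun p => hk p (s p) (e p)) q v
              + hk q (s q) (e q) * conn_form e q v) \*o e q.
Proof.
move=> ue ss; have se := unit_section_smooth ue.
have cs := csmooth_hK ss se.
rewrite (conn_local Hb v ss (smooth_sectionZ cs se) (unit_frame ue ss)).
rewrite (conn_leibniz Hb v se cs) (conn_formE v ue).
by apply/funext => al /=; rewrite mulrDl mulrA.
Qed.

Lemma conn_formN q e v : unit_section q e ->
  (conn_form e q v)^*%C = - conn_form e q v.
Proof.
move=> ue; have se := unit_section_smooth ue; have ee := unit_section_ext ue.
have := conn_metric Hb v se se.
rewrite (near_ctderiv v (g := fun=> 1)); last by apply: filterS ue => p [].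
rewrite ctderiv_cst (hK_conj (conn_fiber Hb v se) ee) -/(conn_form e q v) => /esym/eqP.
by rewrite addrC addr_eq0 => /eqP.
Qed.

Lemma csmooth_conn_form q e X : unit_section q e ->
  smooth_vf (fun x : N => x) q X -> csmooth_at q (fun p => conn_form e p (X p)).
Proof.
move=> ue sX; have se := unit_section_smooth ue.
exact: (csmooth_hK (conn_smooth Hb se sX) se).
Qed.

Lemma conn_form_linear q e a u v : unit_section q e ->
  conn_form e q (a *: u + v) = a%:C%C * conn_form e q u + conn_form e q v.
Proof.
by move=> ue; rewrite /conn_form (conn_linear Hb _ _ _ (unit_section_smooth ue)).
Qed.

End ConnectionForm.

Section FramedConnection.
Variables (sg : N -> @section R n d N) (theta : N -> 'rV[R]_d -> R[i]).
Hypothesis sg_unit : forall q, unit_section q (sg q).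
Hypothesis sg_const : forall q, \forall p \near q, forall v,
  ctderiv (fun x => hk x (sg p x) (sg q x)) p v = 0.
Hypothesis theta_linear : forall q a u v,
  theta q (a *: u + v) = a%:C%C * theta q u + theta q v.
Hypothesis theta_imag : forall q v, (theta q v)^*%C = - theta q v.
Hypothesis theta_smooth : forall q X, smooth_vf (fun x : N => x) q X ->
  csmooth_at q (fun p => theta p (X p)).

(** The connection d + theta, where the fibre over each [q] uses its own frame [sg q]. The formulas
    fit together because the transition functions between neighbouring frames have zero differential
    ([sg_const]). *)
Definition framed_connection : @connection R n d N := fun s q v =>
  (ctderiv (fun p => hk p (s p) (sg q p)) q v + hk q (s q) (sg q q) * theta q v) \*o sg q q.

(** The frames used at the points near [q] can all be replaced by the single frame [sg q], as
    differentiating the transition function contributes nothing. Smoothness of the derivative is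
    then visible. *)
Lemma framed_connection_near q s : smooth_section F I q s ->
  \forall p \near q, forall v, framed_connection s p v =
  (ctderiv (fun x => hk x (s x) (sg q x)) p v + hk p (s p) (sg q p) * theta p v) \*o sg q p.
Proof.
move=> ss; near=> p.
have sp : smooth_section F I p s by near: p; exact: near_smooth_section.
have up : unit_section p (sg q) by near: p; exact: near_unit_section.
have d0 : forall v, ctderiv (fun x => hk x (sg p x) (sg q x)) p v = 0.
  by near: p; exact: sg_const.
move=> v.
have upp := sg_unit p; have se := unit_section_smooth up; have sp' := unit_section_smooth upp.
have E : \forall x \near p, hk x (s x) (sg q x) = hk x (s x) (sg p x) * hk x (sg p x) (sg q x).
  by apply: filterS (unit_frame upp sp) => x {1}->; rewrite hKZl.
rewrite (near_ctderiv v E) (ctderivM v (csmooth_hK sp sp') (csmooth_hK sp' se)) d0 mulr0 add0r.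
rewrite (nbhs_singleton E) mulrAC -mulrDl /framed_connection.
apply/funext => al.
rewrite [LHS]/= (congr1 (fun L => L al)
  (hK_unit (unit_section_ext upp) (unit_section_ext up) (unit_section1 up))).
by rewrite /= mulrA.
Unshelve. all: by end_near. Qed.

Lemma framed_connection_hermitian : hermitian_connection F w I framed_connection.
Proof.
split.
- move=> q s t v ss st stn; rewrite /framed_connection (nbhs_singleton stn).
  rewrite (near_ctderiv v (g := fun p => hk p (t p) (sg q p))) //.
  by apply: filterS stn => p ->.
- by move=> q s v ss; apply: ext_powerZ; exact: unit_section_ext.
- move=> q s x u v ss; apply/funext => al /=.
  rewrite /framed_connection /= theta_linear.
  rewrite (ctderiv_linear _ _ _ (csmooth_hK ss (unit_section_smooth (sg_unit q)))).
  move: (ctderiv _ q u) (ctderiv _ q v) (hk q _ _) (theta q u) (theta q v) (sg q q al) x%:C%C.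
  by move=> a1 a2 a3 a4 a5 a6 a7; ring.
- move=> q s t v ss st; apply/funext => al /=; have se := unit_section_smooth (sg_unit q).
  rewrite /framed_connection /= (ctderivD v (csmooth_hK ss se) (csmooth_hK st se)) hKDl.
  move: (ctderiv _ q v) (ctderiv _ q v) (hk q _ _) (hk q _ _) (theta q v) (sg q q al).
  by move=> a1 a2 a3 a4 a5 a6; ring.
- move=> q s f v ss sf; have ue := sg_unit q; have se := unit_section_smooth ue.
  have e := hK_unit (smooth_section_extq ss) (unit_section_ext ue) (unit_section1 ue).
  apply/funext => al; rewrite /framed_connection /= (congr1 (fun L => L al) e) /=.
  rewrite (ctderivM v sf (csmooth_hK ss se)) hKZl.
  move: (ctderiv _ q v) (ctderiv _ q v) (hk q _ _) (f q) (theta q v) (sg q q al).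
  by move=> a1 a2 a3 a4 a5 a6; ring.
- move=> q s X ss sX; have ue := sg_unit q; have se := unit_section_smooth ue.
  apply: (near_eq_smooth_section (s := fun p =>
     (ctderiv (fun x => hk x (s x) (sg q x)) p (X p)
        + hk p (s p) (sg q p) * theta p (X p)) \*o sg q p)).
    by apply: filterS (framed_connection_near ss) => p ->.
  have cs := csmooth_hK ss se.
  apply: smooth_sectionZ => //; apply: csmooth_atD; first exact: csmooth_at_ctderiv.
  by apply: csmooth_atM => //; exact: theta_smooth.
move=> q s t v ss st; have ue := sg_unit q; have se := unit_section_smooth ue.
have cs := csmooth_hK ss se; have ct := csmooth_hK st se.
have E : \forall p \near q, hk p (s p) (t p)
    = hk p (s p) (sg q p) * (hk p (t p) (sg q p))^*%C.
  apply: filterS3 (unit_frame ue ss) (unit_frame ue st) (near_unit_section ue).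
  move=> p es et up; have ep := unit_section_ext up.
  by rewrite {1}es {1}et hKZl (hKZr _ ep ep) (unit_section1 up) mulr1.
rewrite (near_ctderiv v E) (ctderivM v cs (csmooth_at_conj ct)) (ctderiv_conj v ct).
have ee := unit_section_ext ue.
rewrite /framed_connection hKZl (hKZr _ (smooth_section_extq ss) ee).
rewrite (hK_conj (smooth_section_extq st) ee) cconjD cconjM theta_imag.
move: (ctderiv _ q v) (ctderiv _ q v)^*%C (hk q _ _) (hk q _ _)^*%C (theta q v).
by move=> a1 a2 a3 a4 a5; ring.
Qed.

End FramedConnection.

Lemma framed_connectionD sg theta q s v : (forall q, unit_section q (sg q)) ->
  smooth_section F I q s ->
  framed_connection sg theta s q v
    = framed_connection sg (fun _ _ => 0) s q v \+ (theta q v \*o s q).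
Proof.
move=> us ss; have ue := us q.
have e := hK_unit (smooth_section_extq ss) (unit_section_ext ue) (unit_section1 ue).
apply/funext => al; rewrite /framed_connection /= (congr1 (fun L => L al) e) /=.
by rewrite mulr0 addr0 mulrDl mulrA (mulrC (theta q v)).
Qed.

End Sections.

(** * The unitary isomorphism between the two anticanonical bundles *)

Section PushBundle.
Context {R : realType} {d n : nat} (N : manifold R d) (M : manifold R (2 * n)).
Variables (F : N -> M) (sF : smooth_map F) (w I I' : M -> 'M[R]_(2 * n)).
Hypotheses (symp : symplectic w) (comp : compatible w I) (comp' : compatible w I').
Implicit Types (q p : N) (L : mvec R (2 * n) n) (s e : @section R n d N).

Local Notation hk := (hK F w I).
Local Notation hk' := (hK F w I').

(* complex linear from (TM, I) to (TM, I') *)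
Definition tangent_iso (x : M) : 'M[R]_(2 * n) := 1%:M - I x *m I' x.

Lemma tangent_isoE (x : M) : I x *m tangent_iso x = tangent_iso x *m I' x.
Proof.
case: comp => JJ _ _ _; case: comp' => JJ' _ _ _.
rewrite /tangent_iso mulmxBr mulmxBl mulmx1 mul1mx mulmxA JJ -mulmxA JJ'.
by rewrite mulNmx mul1mx mulmxN mulmx1 !opprK addrC.
Qed.

(** A kernel vector satisfies v I' = - v I, so omega (v, v I) and omega (v, v I') would be opposite
    numbers, although compatibility makes both positive when v is nonzero. *)
Lemma tangent_iso_unit (x : M) : tangent_iso x \in unitmx.
Proof.
rewrite -row_free_unit -kermx_eq0; apply/eqP/row_matrixP => i; rewrite row0.
apply/eqP; apply: contraT => v0; set v := row i _ in v0.
have vT : v *m tangent_iso x = 0.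
  by rewrite /v -row_mul mulmx_ker row0.
have e : v *m I' x = - (v *m I x).
  move: vT; rewrite /tangent_iso mulmxBr mulmx1 mulmxA => /subr0_eq {1}->.
  by rewrite (JJ comp').
have := metric_gt0 comp' x v0; have := metric_gt0 comp x v0.
by rewrite /metric e bilNr => g0; rewrite oppr_gt0 ltNge ltW.
Qed.

Definition pushF p L : mvec R (2 * n) n := push (I' (F p)) (tangent_iso (F p)) L.

Lemma pushF_ext p L : ext_power (I (F p)) L -> ext_power (I' (F p)) (pushF p L).
Proof.
have [v [_ sp]] := exists_line symp comp (F p).
move=> /sp ->; rewrite /pushF pushZ (push_wedge (tangent_isoE (F p))).
by apply: ext_powerZ; exact: ext_power_wedge.
Qed.

Lemma pushF_neq0 p L : ext_power (I (F p)) L -> pushF p L = (fun=> 0) -> L = (fun=> 0).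
Proof.
move=> [L0 _] P0; apply/funext => al.
have [ca|/L0 //] := pselect (calt (I (F p)) al).
pose Ti := invmx (tangent_iso (F p)).
have TI : I' (F p) *m Ti = Ti *m I (F p).
  have u := tangent_iso_unit (F p).
  by rewrite -[LHS](mulKmx u) (mulmxA (tangent_iso _)) -tangent_isoE -mulmxA mulmxV // mulmx1.
have ca' := calt_push TI ca.
have := congr1 (fun P => P (fun v => al (fun i => v i *m Ti))) P0.
rewrite /pushF /push; case: asboolP => // _ <-; congr L; apply/funext => v; congr al.
by apply/funext => i; rewrite /Ti (mulmxK (tangent_iso_unit (F p))).
Qed.

(** Both fibres are Hermitian lines, so the map multiplies a unit vector by a scalar c times a unit
    vector, and the Hermitian form by r = |c|^2; c is nonzero by injectivity. *)
Lemma exists_pushnorm p : exists r : R, 0 < r /\ forall L L',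
  ext_power (I (F p)) L -> ext_power (I (F p)) L' ->
  hk' p (pushF p L) (pushF p L') = r%:C%C * hk p L L'.
Proof.
have [v [v1 sp]] := exists_line symp comp (F p).
have [v' [v1' sp']] := exists_line symp comp' (F p).
set e := wedge (I (F p)) v in v1 sp; set e' := wedge (I' (F p)) v' in v1' sp'.
have ee : ext_power (I (F p)) e by exact: ext_power_wedge.
have ee' : ext_power (I' (F p)) e' by exact: ext_power_wedge.
set c := ext_dot w I' (F p) (pushF p e) e'.
have pe : pushF p e = c \*o e' by exact/sp'/pushF_ext.
have c0 : c != 0.
  apply: contra_eq_neq v1 => c0; have : e = (fun=> 0).
    apply: (pushF_neq0 ee); rewrite pe; apply/funext => al /=; rewrite c0; exact: mul0r.
  by move=> {1}->; rewrite /ext_dot /ext_herm eq_sym oner_eq0.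
exists (Re c ^+ 2 + Im c ^+ 2); split; first exact: Re2Im2_gt0.
move=> L L' HL HL'; rewrite (sp L HL) (sp L' HL').
move: (ext_dot _ _ _ L _) (ext_dot _ _ _ L' _) => a b.
have E z : pushF p (z \*o e) = (z * c) \*o e'.
  by rewrite /pushF pushZ -/(pushF p e) pe; apply/funext => al /=; rewrite mulrA.
rewrite !E.
rewrite [hk' _ _ _](ext_dot_mulr symp comp' _ _ ee' v1') [hk _ _ _](ext_dot_mulr symp comp _ _ ee v1).
by rewrite -normc_sqr_real cconjM; ring.
Qed.

Definition pushnorm p : R := sval (cid (exists_pushnorm p)).

Lemma pushnorm_gt0 p : 0 < pushnorm p.
Proof. by rewrite /pushnorm; case: cid => r []. Qed.

Lemma hK_pushF p L L' : ext_power (I (F p)) L -> ext_power (I (F p)) L' ->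
  hk' p (pushF p L) (pushF p L') = (pushnorm p)%:C%C * hk p L L'.
Proof. by have [_] := svalP (cid (exists_pushnorm p)); exact. Qed.

Definition bundle_map p L : mvec R (2 * n) n :=
  ((Num.sqrt (pushnorm p))^-1)%:C%C \*o pushF p L.

Lemma bundle_mapZ p z L : bundle_map p (z \*o L) = z \*o bundle_map p L.
Proof.
rewrite /bundle_map /pushF pushZ; apply/funext => al /=.
by rewrite mulrCA.
Qed.

Lemma bundle_map_ext p L : ext_power (I (F p)) L -> ext_power (I' (F p)) (bundle_map p L).
Proof. by move=> HL; apply: ext_powerZ; exact: pushF_ext. Qed.

Lemma hK_bundle_map p L L' : ext_power (I (F p)) L -> ext_power (I (F p)) L' ->
  hk' p (bundle_map p L) (bundle_map p L') = hk p L L'.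
Proof.
move=> HL HL'; have P := pushF_ext HL; have P' := pushF_ext HL'.
rewrite /bundle_map hKZl (hKZr symp comp' _ P P') hK_pushF // conjc_real !mulrA -!rmorphM /=.
have r0 := pushnorm_gt0 p.
rewrite -{3}(sqr_sqrtr (ltW r0)) expr2 mulrACA mulVf ?mulr1 ?mul1r //.
by rewrite lt0r_neq0 // sqrtr_gt0.
Qed.

Lemma smooth_section_pushF q s : smooth_section F I q s ->
  smooth_section F I' q (fun p => pushF p (s p)).
Proof.
move=> [X [f [HX Hf Hs]]].
exists (fun i p => X i p + (-1) *: (X i p *m I (F p) *m I' (F p))), f; split=> [i||].
- apply: (smooth_vfD sF (HX i)); apply: (smooth_vfZ sF); first exact: smooth_at_cst.
  exact: (smooth_vf_J sF comp' (smooth_vf_J sF comp (HX i))).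
- exact: Hf.
apply: filterS Hs => p ->; rewrite /pushF pushZ (push_wedge (tangent_isoE (F p))).
congr (_ \*o wedge _ _); apply/funext => i.
by rewrite /tangent_iso mulmxBr mulmx1 mulmxA scaleN1r.
Qed.

(** The number is chosen fibre by fibre, but it equals the squared norm of the image of any unit
    section, which is a smooth function when the section is. *)
Lemma smooth_at_pushnorm q : smooth_at q pushnorm.
Proof.
have [e ue] := exists_unit_section sF symp comp q.
have se := smooth_section_pushF (unit_section_smooth ue).
have [sr _] := csmooth_hK sF symp comp' se se.
apply: near_eq_smooth_at sr; apply: filterS (near_unit_section ue) => p up.
have ep := unit_section_ext up.
by rewrite hK_pushF // (unit_section1 up) mulr1.
Qed.

Lemma smooth_section_bundle_map q s : smooth_section F I q s ->
  smooth_section F I' q (fun p => bundle_map p (s p)).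
Proof.
move=> ss; apply: smooth_sectionZ; last exact: smooth_section_pushF.
apply: csmooth_at_real; apply: smooth_at_inv.
  by apply: smooth_at_sqrt; [exact: smooth_at_pushnorm|exact: pushnorm_gt0].
by rewrite lt0r_neq0 // sqrtr_gt0 pushnorm_gt0.
Qed.

Lemma unit_section_bundle_map q e : unit_section F w I q e ->
  unit_section F w I' q (fun p => bundle_map p (e p)).
Proof.
move=> ue; apply: filterS (near_unit_section ue) => p up; split.
  exact: (smooth_section_bundle_map (unit_section_smooth up)).
have ep := unit_section_ext up.
by rewrite hK_bundle_map // (unit_section1 up).
Qed.

End PushBundle.

Section PhaseChange.
Context {R : realType} {d n : nat} (N : manifold R d) (M : manifold R (2 * n)).
Variables (F : N -> M) (sF : smooth_map F) (w I : M -> 'M[R]_(2 * n)).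
Hypotheses (symp : symplectic w) (comp : compatible w I).
Variables (q : N) (z : N -> R[i]).
Hypotheses (sz : csmooth_at q z) (z1 : \forall p \near q, z p * (z p)^*%C = 1).
Implicit Types (e : @section R n d N).

Lemma unit_section_phase e : unit_section F w I q e ->
  unit_section F w I q (fun p => z p \*o e p).
Proof.
move=> ue; apply: filterS3 (near_unit_section ue) (near_csmooth_at sz) z1 => p up zp z1p.
split; first exact: (smooth_sectionZ zp (unit_section_smooth up)).
have ep := unit_section_ext up.
by rewrite hKZl (hKZr symp comp _ ep ep) (unit_section1 up) mulr1.
Qed.

(** The gauge rule A + z^-1 dz, with the conjugate of z in place of its inverse since z has modulus
    1. *)
Lemma conn_form_phase b e v : hermitian_connection F w I b -> unit_section F w I q e ->
  conn_form F w I b (fun p => z p \*o e p) q v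
   = (z q)^*%C * ctderiv z q v + conn_form F w I b e q v.
Proof.
move=> Hb ue; have se := unit_section_smooth ue; have ee := unit_section_ext ue.
rewrite /conn_form (conn_leibniz Hb v se sz) (hKZr symp comp _ _ ee); last first.
  by apply: ext_power_comb; [|apply: ext_powerZ; exact: (conn_fiber Hb v se)].
rewrite hKDl !hKZl (unit_section1 ue) mulr1 mulrDr mulrA.
by rewrite (mulrC _ (z q)) (nbhs_singleton z1) mul1r.
Qed.

End PhaseChange.

Lemma conn_form_near (R : realType) d n (N : manifold R d) (M : manifold R (2 * n)) (F : N -> M)
    (w J : M -> 'M[R]_(2 * n)) (b : @connection R n d N) (e e' : @section R n d N) q v :
  hermitian_connection F w J b ->
  smooth_section F J q e -> smooth_section F J q e' -> (\forall p \near q, e p = e' p) ->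
  conn_form F w J b e q v = conn_form F w J b e' q v.
Proof.
by move=> Hb se se' E; rewrite /conn_form (conn_local Hb v se se' E) (nbhs_singleton E).
Qed.

(** * Primitives on simply connected spaces *)

Lemma near_comp (T T' : topologicalType) (h : T -> T') (y : T) (P : set T') :
  {for y, continuous h} -> (\forall z \near h y, P z) -> \forall y' \near y, P (h y').
Proof. by move=> ch; exact: ch. Qed.

Section NearBoxes.
Context {R : realType}.

Lemma near_realP (t : R) (P : set R) :
  (\forall t' \near t, P t') <-> exists e, 0 < e /\ forall t', `|t - t'| < e -> P t'.
Proof.
split=> [/nbhs_ballP[e /= e0 H]|[e [e0 H]]]; first by exists e.
by apply/nbhs_ballP; exists e.
Qed.

Lemma near_pairP (t r : R) (P : set (R * R)) : (\forall y \near (t, r), P y) <->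
  exists e, 0 < e /\ forall t' r', `|t - t'| < e -> `|r - r'| < e -> P (t', r').
Proof.
split=> [/nbhs_ballP[e /= e0 H]|[e [e0 H]]]; first by exists e; split=> // t' r' ? ?; exact: H.
by apply/nbhs_ballP; exists e => // -[t' r'] [/= ? ?]; exact: H.
Qed.

(** Cousin's form of the compactness of [l, u]: a property of intervals that is additive and holds
    for all small intervals around each point holds for the whole. The supremum of the t with
    [P l t] could otherwise be passed by half of its local radius. *)
Lemma cousin (P : R -> R -> Prop) (l u : R) : l <= u ->
  (forall a b c, a <= b -> b <= c -> P a b -> P b c -> P a c) ->
  (forall t, l <= t <= u -> exists e, 0 < e /\
     forall a b, a <= t <= b -> t - e < a -> b < t + e -> P a b) -> P l u.
Proof.
move=> lu glue loc; pose S := [set t : R | l <= t <= u /\ P l t].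
have Sl : S l.
  split; first by rewrite lexx lu.
  have [|e [e0 He]] := loc l; first by rewrite lexx lu.
  by apply: He; rewrite ?lexx // ?ltrBlDr ltrDl.
have Su : ubound S u by move=> t [/andP[]].
have hS : has_sup S by split; [exists l|exists u].
set s := sup S; have sl : l <= s by apply: ub_le_sup => //; exists u.
have su : s <= u by apply: ge_sup => //; exists l.
have [|e [e0 He]] := loc s; first by rewrite sl su.
have [t [/andP[lt tu] Pt] st] := sup_adherent e0 hS.
have ts : t <= s by apply: ub_le_sup; [exists u|split=> //; rewrite lt tu].
pose s' := Num.min u (s + e / 2).
have ss' : s <= s' by rewrite le_min su lerDl divr_ge0 // ltW.
have s'e : s' < s + e by rewrite gt_min ltrD2l ltr_pdivrMr // ltr_pMr // ltrDr ltr01 orbT.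
have Ps' : P l s'.
  apply: (glue l t s') => //; first exact: le_trans ss'.
  by apply: He => //; rewrite ts ss'.
have : s' <= s.
  apply: ub_le_sup; first by exists u.
  by split=> //; rewrite (le_trans sl ss') /s' ge_min lexx.
rewrite /s' ge_min => /orP[us|]; last by rewrite leNgt ltrDl divr_gt0.
by move: Ps'; rewrite /s' min_l // (le_trans us) // lerDl divr_ge0 // ltW.
Qed.

Lemma locally_constant (D : R -> R) (l u : R) :
  (forall t, l <= t <= u -> \forall t' \near t, l <= t' <= u -> D t' = D t) ->
  forall t, l <= t <= u -> D t = D l.
Proof.
move=> loc t /andP[lt tu].
suff H : (fun a b => l <= a -> b <= u -> D b = D a) l t by exact: H.
apply: (@cousin (fun a b => l <= a -> b <= u -> D b = D a) l t lt).
  move=> a b c ab bc Hab Hbc la cu.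
  by rewrite Hbc ?(le_trans la ab) // Hab // (le_trans bc).
move=> s /andP[ls st]; have lsu : l <= s <= u by rewrite ls (le_trans st).
have [e [e0 He]] := (iffLR (near_realP _ _)) (loc s lsu).
exists e; split=> // a b /andP[as_ sb] ea eb la bu.
rewrite (He a) ?(He b) //.
- by rewrite ltr_norml; lra.
- by rewrite (le_trans ls sb) bu.
- by rewrite ltr_norml; lra.
- by rewrite la (le_trans as_) // (le_trans st).
Qed.

Lemma paste_continuous (T : topologicalType) (f g : R -> T) (c : R) :
  continuous f -> continuous g -> f c = g c ->
  continuous (fun t => if t <= c then f t else g t).
Proof.
move=> cf cg fg t A; have [tc|ct|tc] := ltgtP t c.
- move=> nA; have := near_comp (cf t) nA.
  apply: filterS2; last exact: (open_nbhs_nbhs (conj (@open_lt R c) tc)).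
  by move=> x /= /ltW -> Ax.
- move=> nA; have := near_comp (cg t) nA.
  apply: filterS2; last exact: (open_nbhs_nbhs (conj (@open_gt R c) ct)).
  by move=> x /= cx Ax; rewrite leNgt cx.
rewrite tc => nA; have nf := near_comp (cf c) nA; rewrite fg in nA.
by apply: filterS2 nf (near_comp (cg c) nA) => x /= fx gx; case: ifP.
Qed.

(** The retraction of the line onto [0, 1]. Composing with it turns a path that is continuous only
    within [0, 1] into one continuous everywhere and unchanged on [0, 1]. *)
Definition clamp (t : R) : R := Num.max 0 (Num.min 1 t).

Lemma clamp01 t : 0 <= clamp t <= 1.
Proof. by rewrite /clamp le_max lexx /= ge_max ler01 ge_min lexx. Qed.

Lemma clampK t : 0 <= t <= 1 -> clamp t = t.
Proof. by move=> /andP[t0 t1]; rewrite /clamp min_r // max_r. Qed.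

Lemma continuous_clamp : continuous clamp.
Proof.
move=> t; apply: continuous_max; first exact: cst_continuous.
by apply: continuous_min; [exact: cst_continuous|exact: cvg_id].
Qed.

Lemma continuous_comp_within (T T' T'' : topologicalType) (A : set T') (g : T -> T') (f : T' -> T'') :
  continuous g -> (forall t, A (g t)) -> {within A, continuous f} -> continuous (f \o g).
Proof.
move=> cg gA /subspace_continuousP cf t B nB.
have nb : \forall x \near g t, A x -> B (f x) := cf (g t) (gA t) B nB.
have nb' := near_comp (cg t) nb.
suff : \forall x \near t, B (f (g x)) by [].
by apply: filterS nb' => x /(_ (gA x)).
Qed.

End NearBoxes.

Lemma continuous_affine (R : realType) (a b : R) : continuous (fun t : R => a * t + b).
Proof. by move=> t; apply: cvgD; [exact: mulrl_continuous|exact: cvg_cst]. Qed.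

Lemma continuous_reparam (R : realType) (T : topologicalType) (s : R -> T) (a b : R) :
  continuous s -> continuous (s \o (fun t => a * t + b)).
Proof.
move=> cs t; apply: continuous_comp; [exact: (@continuous_affine R a b t)|exact: cs].
Qed.

(** * Continuation of local primitives along paths and squares *)

Section GlobalPrimitive.
Context {R : realType} {X : topologicalType}.
Variables (U : X -> set X) (phi : X -> X -> R).
Hypothesis U_open : forall x, open (U x).
Hypothesis U_center : forall x, U x x.
Hypothesis phi_compat : forall x y z, U x z -> U y z ->
  \forall z' \near z, phi x z' - phi y z' = phi x z - phi y z.

Definition rect (a b c d : R) : set (R * R) :=
  [set y | a <= y.1 <= b /\ c <= y.2 <= d].

(** [G] continues the local primitives along [H] over [K]: wherever [H] meets the domain of [phi x],
    it differs from [phi x \o H] by a local constant. No differentiability enters, so [H] need only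
    be continuous. *)
Definition prim_on (T : topologicalType) (K : set T) (H : T -> X) (G : T -> R) :=
  forall y, K y -> forall x, U x (H y) ->
    \forall y' \near y, K y' -> G y' - phi x (H y') = G y - phi x (H y).

Implicit Types (s : R -> X) (H : R * R -> X).

Lemma prim_on_comp (T T' : topologicalType) (K : set T) (K' : set T')
    (H : T -> X) (G : T -> R) (h : T' -> T) :
  continuous h -> (forall y, K' y -> K (h y)) -> prim_on K H G -> prim_on K' (H \o h) (G \o h).
Proof.
move=> ch KK prim y Ky x Ux; have n := near_comp (ch y) (prim (h y) (KK _ Ky) x Ux).
by apply: filterS n => y' /= H1 /KK /H1.
Qed.

Lemma prim_on_chart (T : topologicalType) (K : set T) (H : T -> X) x : continuous H ->
  (forall y, K y -> U x (H y)) -> prim_on K H (phi x \o H).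
Proof.
move=> cH KU y Ky x' Ux'; have n := near_comp (cH y) (phi_compat (KU y Ky) Ux').
by apply: filterS n => y' /= E _.
Qed.

Definition has_prim (H : R * R -> X) a b c d := exists G, prim_on (rect a b c d) H G.

Lemma continuous_swap : continuous (fun y : R * R => (y.2, y.1)).
Proof. move=> [a b] A /near_pairP[e [e0 He]]; apply/near_pairP; exists e; split=> // t r ta rb.
exact: He. Qed.

Lemma has_prim_swap H a b c d : has_prim H a b c d ->
  has_prim (fun y => H (y.2, y.1)) c d a b.
Proof.
move=> [G prim]; exists (G \o (fun y : R * R => (y.2, y.1))).
by apply: (prim_on_comp continuous_swap) prim => y [].
Qed.

Lemma prim_on_diff (K : set R) (s : R -> X) (G1 G2 : R -> R) t : K t ->
  prim_on K s G1 -> prim_on K s G2 -> \forall t' \near t, K t' -> G1 t' - G2 t' = G1 t - G2 t.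
Proof.
move=> Kt p1 p2; apply: filterS2 (p1 t Kt _ (U_center _)) (p2 t Kt _ (U_center _)).
move=> t' H1 H2 Kt'; move: (H1 Kt') (H2 Kt'); move: (phi _ _) (phi _ _) => u v e1 e2.
by lra.
Qed.

Lemma prim_unique (s : R -> X) (G1 G2 : R -> R) a b :
  prim_on [set t : R | a <= t <= b] s G1 -> prim_on [set t : R | a <= t <= b] s G2 ->
  forall t, a <= t <= b -> G1 t - G2 t = G1 a - G2 a.
Proof.
move=> p1 p2; apply: (@locally_constant _ (fun t => G1 t - G2 t)) => t tab.
exact: (prim_on_diff tab p1 p2).
Qed.

Lemma continuous_pairl (r : R) : continuous (fun t : R => (t, r)).
Proof. move=> t A /near_pairP[e [e0 He]]; apply/near_realP; exists e; split=> // t' tt.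
by apply: He => //; rewrite subrr normr0. Qed.

Lemma continuous_pairr (t : R) : continuous (fun r : R => (t, r)).
Proof. move=> r A /near_pairP[e [e0 He]]; apply/near_realP; exists e; split=> // t' tt.
by apply: He => //; rewrite subrr normr0. Qed.

(** Along the common edge both primitives continue the same local ones, so their difference is
    locally constant there, hence a constant [k]; shifting the second by [k] makes them agree on the
    edge. *)
Lemma has_prim_glue H a b c d e : c <= d -> d <= e ->
  has_prim H a b c d -> has_prim H a b d e -> has_prim H a b c e.
Proof.
move=> cd de [G1 p1] [G2 p2].
pose k := G1 (a, d) - G2 (a, d).
have edge t : a <= t <= b -> G1 (t, d) = G2 (t, d) + k.
  move=> tab.
  have q1 : prim_on [set t : R | a <= t <= b] (H \o (fun t => (t, d))) (G1 \o (fun t => (t, d))).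
    apply: (prim_on_comp _ _ p1); first exact: continuous_pairl.
    move=> t' /= t'ab.
    by split=> //=; rewrite cd lexx.
  have q2 : prim_on [set t : R | a <= t <= b] (H \o (fun t => (t, d))) (G2 \o (fun t => (t, d))).
    apply: (prim_on_comp _ _ p2); first exact: continuous_pairl.
    move=> t' /= t'ab.
    by split=> //=; rewrite de lexx.
  by have /= := prim_unique q1 q2 tab; rewrite -/k => <-; rewrite addrCA subrr addr0.
exists (fun y => if y.2 <= d then G1 y else G2 y + k) => -[t r] [/= tab /andP[cr re]] x Ux.
have [rd|dr|rd] := ltgtP r d.
- have K1 : rect a b c d (t, r) by split=> //=; rewrite cr ltW.
  have n1 := p1 _ K1 x Ux.
  have n2 : \forall y \near (t, r), y.2 < d.
    apply/near_pairP; exists (d - r); split; first by rewrite subr_gt0.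
    by move=> t' r' _; rewrite ltr_norml /= => /andP[]; lra.
  apply: filterS2 n1 n2 => y Hy yd [ya /andP[yc ye]].
  by rewrite ltW // Hy //; split=> //; rewrite yc ltW.
- have K2 : rect a b d e (t, r) by split=> //=; rewrite re ltW.
  have n1 := p2 _ K2 x Ux.
  have n2 : \forall y \near (t, r), d < y.2.
    apply/near_pairP; exists (r - d); split; first by rewrite subr_gt0.
    by move=> t' r' _; rewrite ltr_norml /= => /andP[]; lra.
  apply: filterS2 n1 n2 => y Hy yd [ya /andP[yc ye]].
  rewrite leNgt yd /= addrAC Hy 1?addrAC //.
  by split=> //; rewrite ye ltW.
subst r.
have K1 : rect a b c d (t, d) by split=> //=; rewrite cd lexx.
have K2 : rect a b d e (t, d) by split=> //=; rewrite lexx de.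
apply: filterS2 (p1 _ K1 x Ux) (p2 _ K2 x Ux) => y H1 H2 [ya /andP[yc ye]].
case: ifPn => [yd|]; first by rewrite H1 //; split=> //; rewrite yc yd.
rewrite -ltNge => /ltW yd.
rewrite addrAC H2; last by split=> //; rewrite yd ye.
by rewrite addrAC -edge.
Qed.

(** Two interval inductions: the first, in the second coordinate, builds a thin strip around each t,
    gluing keeping the smaller of two widths; the second glues the strips, the coordinates being
    exchanged. *)
Lemma has_prim_square H : continuous H -> has_prim H 0 1 0 1.
Proof.
move=> cH.
have loc t r : exists e, 0 < e /\ forall a b c d, t - e < a -> b < t + e ->
    r - e < c -> d < r + e -> has_prim H a b c d.
  have nU : \forall y \near (t, r), U (H (t, r)) (H y).
    by apply: near_comp (cH (t, r)) _; apply: open_nbhs_nbhs.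
  have [e [e0 He]] := (iffLR (near_pairP _ _ _)) nU.
  exists e; split=> // a b c d ta bt rc dr; exists (phi (H (t, r)) \o H).
  apply: prim_on_chart => // -[t' r'] [/= /andP[a1 a2] /andP[a3 a4]].
  by apply: He; rewrite ltr_norml; lra.
have strip t : exists e, 0 < e /\ forall a b, a <= t <= b -> t - e < a -> b < t + e ->
    has_prim H a b 0 1.
  apply: (@cousin _ (fun c d => exists e, 0 < e /\ forall a b, a <= t <= b -> t - e < a -> b < t + e ->
    has_prim H a b c d)) => // [c d e cd de [e1 [e10 H1]] [e2 [e20 H2]]|r _].
    exists (Num.min e1 e2); split; first by rewrite lt_min e10 e20.
    move=> a b tab ta tb; apply: (has_prim_glue cd de).
      by apply: H1 => //; [apply: le_lt_trans ta|apply: lt_le_trans tb _];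
        rewrite ?lerD2l ?lerN2 ge_min lexx.
    by apply: H2 => //; [apply: le_lt_trans ta|apply: lt_le_trans tb _];
      rewrite ?lerD2l ?lerN2 ge_min lexx orbT.
  have [e [e0 He]] := loc t r; exists e; split=> // c d _ rc dr.
  by exists e; split=> // a b _ ta bt; exact: He.
apply: (@cousin _ (fun a b => has_prim H a b 0 1)) ; first exact: ler01.
  move=> a b c ab bc H1 H2.
  have := has_prim_glue ab bc (has_prim_swap H1) (has_prim_swap H2).
  move/has_prim_swap; rewrite (_ : (fun y => _) = H) //.
  by apply/funext => -[].
by move=> t _; exact: strip.
Qed.

Definition path_prim (s : R -> X) (G : R -> R) := prim_on [set t : R | 0 <= t <= 1] s G.

(** Plays the part of the integral of the closed form along the path [s]. It is single-valued by
    [change_unique] and defined on every continuous path by [path_primP]. *)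
Definition change (s : R -> X) (v : R) := exists2 G, path_prim s G & v = G 1 - G 0.

Lemma path_prim_eq s s' G : (forall t, 0 <= t <= 1 -> s t = s' t) ->
  path_prim s G -> path_prim s' G.
Proof.
move=> ss p t t01 x; rewrite -(ss t t01) => Ux.
by apply: filterS (p t t01 x Ux) => t' H t'01; rewrite -(ss t' t'01) H.
Qed.

Lemma path_primP s : continuous s -> exists G, path_prim s G.
Proof.
(* The path is read as a square that is constant in the second coordinate. *)
move=> cs; have [|G prim] := @has_prim_square (s \o fst).
  by move=> y; apply: continuous_comp; [exact: cvg_fst|exact: cs].
exists (G \o (fun t => (t, 0))).
apply: (@path_prim_eq ((s \o fst) \o (fun t => (t, 0)))) => [//|].
apply: (prim_on_comp (H := s \o fst) _ _ prim); first exact: continuous_pairl.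
move=> t /= t01.
by split=> //=; rewrite lexx ler01.
Qed.

Lemma change_unique s v v' : change s v -> change s v' -> v = v'.
Proof.
move=> [G p ->] [G' p' ->]; have := prim_unique p p' (t := 1).
by rewrite lexx ler01 => /(_ isT); lra.
Qed.

Lemma path_prim_cst s : (forall t, 0 <= t <= 1 -> s t = s 0) -> path_prim s (fun=> 0).
Proof.
move=> ss t t01 x _; near=> t' => t'01.
by rewrite (ss t) // (ss t').
Unshelve. all: by end_near. Qed.

Lemma path_prim_const s G : path_prim s G -> (forall t, 0 <= t <= 1 -> s t = s 0) -> G 1 = G 0.
Proof.
move=> p /path_prim_cst p'.
have c1 : change s (G 1 - G 0) by exists G.
have c2 : change s 0 by exists (fun=> 0) => //; rewrite subrr.
by apply/eqP; rewrite -subr_eq0 (change_unique c1 c2).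
Qed.

(** A primitive on the square of a null-homotopy is constant along the three sides that are sent to
    the base point; these join the two ends of the side that carries the loop. *)
Lemma change_loop s : simply_connected R X -> continuous s -> s 0 = s 1 -> change s 0.
Proof.
move=> [_ sc] cs s01.
have [|H [cH HE]] := sc s _ s01; first exact: continuous_subspaceT.
(* The homotopy is continuous only within the unit square; clamping both coordinates makes it
   continuous on the plane and leaves it unchanged on the square. *)
pose K y := H (clamp y.1, clamp y.2).
have cK : continuous K.
  have cl : continuous (fun y : R * R => (clamp y.1, clamp y.2)).
    move=> [a b] A /near_pairP[e [e0 He]].
    have na := near_comp (@continuous_clamp R a) (iffRL (near_realP (clamp a)
      (fun z => `|clamp a - z| < e)) (ex_intro _ e (conj e0 (fun _ h => h)))).
    have nb := near_comp (@continuous_clamp R b) (iffRL (near_realP (clamp b)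
      (fun z => `|clamp b - z| < e)) (ex_intro _ e (conj e0 (fun _ h => h)))).
    have [e1 [e10 H1]] := (iffLR (near_realP _ _)) na.
    have [e2 [e20 H2]] := (iffLR (near_realP _ _)) nb.
    apply/near_pairP; exists (Num.min e1 e2); split; first by rewrite lt_min e10.
    move=> t r; rewrite !lt_min => /andP[ta _] /andP[_ rb].
    by apply: He; [exact: H1|exact: H2].
  apply: (continuous_comp_within cl _ cH).
  by move=> y; split; rewrite /= in_itv /= clamp01.
have [G prim] := has_prim_square cK.
have sub1 r : 0 <= r <= 1 -> path_prim (K \o (fun t => (t, r))) (G \o (fun t => (t, r))).
  move=> r01; apply: (prim_on_comp _ _ prim); first exact: continuous_pairl.
  by move=> t t01; split.
have sub2 t : 0 <= t <= 1 -> path_prim (K \o (fun r => (t, r))) (G \o (fun r => (t, r))).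
  move=> t01; apply: (prim_on_comp _ _ prim); first exact: continuous_pairr.
  by move=> r r01; split.
have i0 : 0 <= (0 : R) <= 1 by rewrite lexx ler01.
have i1 : 0 <= (1 : R) <= 1 by rewrite lexx ler01.
have KE t r : 0 <= t <= 1 -> 0 <= r <= 1 -> K (t, r) = H (t, r).
  by move=> t01 r01; rewrite /K /= !clampK.
have e1 : G (1, 1) = G (0, 1).
  apply: (path_prim_const (sub1 1 i1)) => t t01 /=; rewrite !KE //.
  by have [_ -> _ _] := HE t t01; have [_ -> _ _] := HE 0 i0.
have e2 : G (0, 1) = G (0, 0).
  apply: (path_prim_const (sub2 0 i0)) => t t01 /=; rewrite !KE //.
  by have [_ _ -> _] := HE t t01; have [_ _ -> _] := HE 0 i0.
have e3 : G (1, 1) = G (1, 0).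
  apply: (path_prim_const (sub2 1 i1)) => t t01 /=; rewrite !KE //.
  by have [_ _ _ ->] := HE t t01; have [_ _ _ ->] := HE 0 i0.
exists (G \o (fun t => (t, 0))); last by rewrite /= -e3 e1 e2 subrr.
apply: path_prim_eq (sub1 0 i0) => t t01 /=.
by rewrite KE //; have [-> _ _ _] := HE t t01.
Qed.

Definition path_cat (s s' : R -> X) (t : R) : X :=
  if t <= 2^-1 then s (2 * t) else s' (2 * t - 1).

Lemma path_cat_continuous s s' : continuous s -> continuous s' -> s 1 = s' 0 ->
  continuous (path_cat s s').
Proof.
move=> cs cs' ss'; apply: paste_continuous; last by rewrite divff ?subrr.
  have e : (fun t : R => s (2 * t)) = s \o (fun t => 2 * t + 0).
    by apply/funext => t /=; rewrite addr0.
  rewrite e; exact: (@continuous_reparam R X s 2 0 cs).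
exact: (@continuous_reparam R X s' 2 (- 1) cs').
Qed.

Lemma change_cat s s' v v' : continuous s -> continuous s' -> s 1 = s' 0 ->
  change s v -> change s' v' -> change (path_cat s s') (v + v').
Proof.
move=> cs cs' ss' c c'; have cc := path_cat_continuous cs cs' ss'.
have [G p] := path_primP cc.
have c1 : change s (G 2^-1 - G 0).
  exists (G \o (fun t => 2^-1 * t + 0)); last by rewrite /= !addr0 mulr1 mulr0.
  apply: (@path_prim_eq (path_cat s s' \o (fun t => 2^-1 * t + 0))).
    move=> t /andP[t0 t1]; rewrite /path_cat /= addr0 ifT; last by rewrite ler_piMr ?invr_ge0.
    by rewrite mulVKf.
  apply: (prim_on_comp _ _ p); first exact: continuous_affine.
  by move=> t /= /andP[t0 t1]; lra.
have c2 : change s' (G 1 - G 2^-1).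
  exists (G \o (fun t => 2^-1 * t + 2^-1)); last first.
    by rewrite /= mulr1 mulr0 add0r; congr (G _ - _); lra.
  apply: (@path_prim_eq (path_cat s s' \o (fun t => 2^-1 * t + 2^-1))).
    move=> t /andP[t0 t1]; rewrite /path_cat /=; have [le|_] := leP.
      have -> : t = 0 by lra.
      by rewrite mulr0 add0r divff ?ss'.
    by congr s'; lra.
  apply: (prim_on_comp _ _ p).
    exact: continuous_affine.
  by move=> t /= /andP[t0 t1]; lra.
exists G => //; rewrite (change_unique c c1) (change_unique c' c2); lra.
Qed.

Lemma change_rev s v : change s v -> change (s \o (fun t => -1 * t + 1)) (- v).
Proof.
move=> [G p ->]; exists (G \o (fun t => -1 * t + 1)); last by rewrite /= mulr0 mulr1 addNr add0r opprB.
apply: (prim_on_comp (H := s) _ _ p).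
  exact: continuous_affine.
by move=> t /= /andP[t0 t1]; lra.
Qed.

Hypothesis sc : simply_connected R X.
Hypothesis locally_connected : forall z (W : set X), nbhs z W -> \forall z' \near z,
  exists s : R -> X, [/\ continuous s, s 0 = z, s 1 = z' & forall t, 0 <= t <= 1 -> W (s t)].

Lemma continuous_path (x y : X) : exists s : R -> X, [/\ continuous s, s 0 = x & s 1 = y].
Proof.
case: sc => /(_ x y)[s [cs s0 s1]] _; exists (s \o clamp); split => /=.
- apply: continuous_comp_within cs; first exact: continuous_clamp.
  by move=> t; rewrite /= in_itv /= clamp01.
- by rewrite clampK ?lexx ?ler01.
- by rewrite clampK ?lexx ?ler01.
Qed.

(** [f z] is the change along a path from a base point to [z]. Two paths with the same ends form a
    loop, so the choice is immaterial; extending the path by a short one inside [U x] adds the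
    increment of [phi x]. *)
Lemma global_primitive : exists f : X -> R, forall x z, U x z ->
  \forall z' \near z, f z' - phi x z' = f z - phi x z.
Proof.
(* An empty space offers no base point, and then any function will do. *)
have [[x0 _]|no] := pselect (exists x0 : X, True); last first.
  by exists (fun=> 0) => x; exfalso; apply: no; exists x.
pose s z := sval (cid (continuous_path x0 z)).
have sP z : [/\ continuous (s z), s z 0 = x0 & s z 1 = z] by rewrite /s; case: cid.
have fP z : exists v, change (s z) v.
  have [cs _ _] := sP z; have [G p] := path_primP cs.
  by exists (G 1 - G 0); exists G.
pose f z := sval (cid (fP z)).
have fE z (s' : R -> X) v : continuous s' -> s' 0 = x0 -> s' 1 = z -> change s' v -> f z = v.
  move=> cs' s'0 s'1 cv; have cf : change (s z) (f z) by rewrite /f; case: cid.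
  have [cs s0 s1] := sP z.
  have cr := @continuous_reparam R X s' (-1) 1 cs'.
  have m : s z 1 = (s' \o (fun t => -1 * t + 1)) 0 by rewrite /= mulr0 add0r s1 s'1.
  have c1 := change_cat cs cr m cf (change_rev cv).
  have c2 : change (path_cat (s z) (s' \o (fun t => -1 * t + 1))) 0.
    apply: change_loop => //; first exact: path_cat_continuous.
    rewrite /path_cat invr_ge0 ler0n mulr0 s0 ifF; last by lra.
    by rewrite /= (_ : -1 * _ + 1 = 0) ?s'0 //; lra.
  by have := change_unique c1 c2; lra.
exists f => x z Uz; have [cs s0 s1] := sP z.
have nU : nbhs z (U x) by apply: open_nbhs_nbhs.
apply: filterS (locally_connected nU) => z' [q [cq q0 q1 qU]].
have cf : change (s z) (f z) by rewrite /f; case: cid.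
have cq' : change q (phi x z' - phi x z).
  exists (phi x \o q); last by rewrite /= q0 q1.
  by apply: prim_on_chart.
have m : s z 1 = q 0 by rewrite s1 q0.
rewrite (fE z' _ _ _ _ _ (change_cat cs cq m cf cq')).
- by lra.
- exact: path_cat_continuous.
- by rewrite /path_cat invr_ge0 ler0n mulr0.
- rewrite /path_cat ifF; last by lra.
  by rewrite (_ : 2 * 1 - 1 = 1) //; lra.
Qed.

End GlobalPrimitive.

(** * Closed 1-forms *)

Section LineDerivative.
Context {R : realType}.

Lemma affine_derive (V : normedModType R) (y0 v : V) (s : R) :
  differentiable (fun s : R => y0 + s *: v) s /\ 'D_1 (fun s : R => y0 + s *: v) s = v.
Proof.
have D : is_diff s ( *:%R^~ v) ( *:%R^~ v) := is_diff_scalel s v.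
have d : differentiable (fun s : R => s *: v) s by exact: ex_diff.
have c : differentiable (fun _ : R => y0) s by exact: differentiable_cst.
split; first exact: differentiableD.
have /(@diff_derivable _ _ _ _ s (1 : R)) c' := c.
have /(@diff_derivable _ _ _ _ s (1 : R)) d' := d.
rewrite (deriveD c' d') derive_cst add0r.
by rewrite (deriveE _ d) (@diff_val _ _ _ _ _ _ _ D) scale1r.
Qed.

Lemma line_derive (V : normedModType R) (f : V -> R) (y0 v : V) (s : R) :
  differentiable f (y0 + s *: v) ->
  is_derive s (1 : R) (fun s : R => f (y0 + s *: v)) ('D_v f (y0 + s *: v)).
Proof.
move=> df; have [dg gE] := affine_derive y0 v s.
apply: DeriveDef; first by apply: diff_derivable; exact: (differentiable_comp dg df).
by rewrite (derive_comp (1 : R) dg df) gE.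
Qed.

Lemma is_derive_continuous (f : R -> R) (s d : R) : is_derive s (1 : R) f d -> {for s, continuous f}.
Proof. by move=> [df _]; apply: differentiable_continuous; exact/derivable1_diffP. Qed.

Local Notation mu := (@lebesgue_measure R).

(** Differentiation under the integral sign, in the case where the differentiated integrand at s = 0
    is itself the derivative in t of a known [q]; the remaining integral is then the increment of
    [q]. *)
Lemma leibniz_rule (p dp : R -> R -> R) (q : R -> R) (r : R) : 0 < r ->
  (forall s t : R, `|s| <= r -> 0 <= t <= 1 -> is_derive s (1 : R) (fun s => p s t) (dp s t)) ->
  (forall t : R, 0 <= t <= 1 -> is_derive t (1 : R) q (dp 0 t)) ->
  (forall s t : R, `|s| <= r -> 0 <= t <= 1 ->
     {for (s, t), continuous (fun y : R * R => dp y.1 y.2)}) ->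
  (forall s t : R, `|s| <= r -> 0 <= t <= 1 -> {for t, continuous (p s)}) ->
  is_derive (0 : R) (1 : R) (fun s => \int[mu]_(t in `[0, 1]) p s t) (q 1 - q 0).
Proof.
move=> r0 Hp Hq cdp cp.
(* The dominating constant: a maximum of the continuous function [|dp|] on the compact rectangle. *)
have [C HC] : exists C : R, forall s t : R, `|s| <= r -> 0 <= t <= 1 -> `|dp s t| <= C.
  have [|||c _ cmax] := @compact_EVT_max _ R (fun y : R * R => `|dp y.1 y.2|)
      (`[- r, r] `*` `[0, 1]).
  - exists (0, 0); split; rewrite /= in_itv /= ?lexx ?ler01 // oppr_le0 ltW //=.
  - by apply: compact_setX; exact: segment_compact.
  - apply: continuous_in_subspaceT => -[s t]; rewrite inE => -[/=].
    rewrite !in_itv /= => sr t01; apply: (@continuous_comp _ _ _ (fun y : R * R => dp y.1 y.2)).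
      by apply: cdp => //; rewrite ler_norml.
    exact: norm_continuous.
  exists `|dp c.1 c.2| => s t sr t01; apply: (cmax (s, t)).
  by rewrite inE; split; rewrite /= in_itv //= -ler_norml.
have Ir s : (`]- r, r[%classic : set R) s -> `|s| <= r.
  by rewrite /= in_itv /= => /andP[a b]; rewrite ler_norml !ltW.
have I0 : (`]- r, r[%classic : set R) 0 by rewrite /= in_itv /= oppr_lt0 r0.
have B01 t : (`[0, 1]%classic : set R) t -> 0 <= t <= 1 by rewrite /= in_itv.
have mB : measurable (`[0, 1]%classic : set R) by [].
have int1 (f : R -> R) : (forall t : R, 0 <= t <= 1 -> {for t, continuous f}) ->
    mu.-integrable `[0, 1] (EFin \o f).
  move=> cf; apply: continuous_compact_integrable; first exact: segment_compact.
  by apply: continuous_in_subspaceT => t; rewrite inE => /B01; exact: cf.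
have H1 s : (`]- r, r[%classic : set R) s -> mu.-integrable `[0, 1] (EFin \o p s).
  by move=> /Ir sr; apply: int1 => t; exact: cp.
have H2 s t : (`]- r, r[%classic : set R) s -> (`[0, 1]%classic : set R) t ->
    derivable (p^~ t) s 1.
  by move=> /Ir sr /B01 t01; case: (Hp s t sr t01).
have H3 s t : (`]- r, r[%classic : set R) s -> (`[0, 1]%classic : set R) t ->
    partial1of2 p s t = dp s t.
  by move=> /Ir sr /B01 t01; rewrite partial1of2E; case: (Hp s t sr t01).
have H4 s t : (`]- r, r[%classic : set R) s -> (`[0, 1]%classic : set R) t ->
    `|partial1of2 p s t| <= `|C|.
  by move=> Is Bt; rewrite H3 // (le_trans (HC s t (Ir _ Is) (B01 _ Bt))) // ler_norm.
have H5 : mu.-integrable `[0, 1] (EFin \o (fun=> `|C|)).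
  by apply: int1 => t _; exact: cst_continuous.
have C0 : forall t : R, 0 <= (fun=> `|C|) t by [].
have D := @derivable_under_integral R _ _ mu p _ mB 0 (- r) r I0 H1 H2 (fun=> `|C|) C0 H5 H4.
apply: DeriveDef; first exact: D.
rewrite -derive1E (@differentiation_under_integral R _ _ mu p _ mB 0 (- r) r I0 H1 H2 (fun=> `|C|) C0 H5 H4).
rewrite (@eq_Rintegral _ _ _ mu _ (dp 0)); last by move=> t; rewrite inE => Bt; exact: H3.
have i01 : 0 <= (0 : R) <= 1 by rewrite lexx ler01.
have i11 : 0 <= (1 : R) <= 1 by rewrite lexx ler01.
have n0 : `|0 : R| <= r by rewrite normr0 ltW.
rewrite /Rintegral (@continuous_FTC2 _ (dp 0) q) //.
- apply: continuous_in_subspaceT => t; rewrite inE => /B01 t01.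
  apply: (@continuous_comp _ _ _ (fun t => (0, t)) (fun y : R * R => dp y.1 y.2)).
    exact: continuous_pairr.
  exact: cdp.
- split.
  + by move=> t; rewrite in_itv /= => /andP[t0 t1]; case: (Hq t); rewrite // !ltW.
  + apply: cvg_at_right_filter; exact: is_derive_continuous (Hq 0 i01).
  + apply: cvg_at_left_filter; exact: is_derive_continuous (Hq 1 i11).
- move=> t; rewrite in_itv /= => /andP[t0 t1]; rewrite derive1E.
  by case: (Hq t); rewrite // !ltW.
Qed.

End LineDerivative.

Section PointwiseRules.
Context {R : realType}.

Lemma is_derive_sumf n (f : 'I_n -> R -> R) (d : 'I_n -> R) (s : R) :
  (forall j, is_derive s (1 : R) (f j) (d j)) ->
  is_derive s (1 : R) (fun s => \sum_j f j s) (\sum_j d j).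
Proof.
move=> H; rewrite (_ : (fun s => _) = \sum_j f j); first exact: is_derive_sum.
by apply/funext => y; rewrite fct_sumE.
Qed.

Lemma is_deriveMf (f g : R -> R) (df dg s : R) : is_derive s (1 : R) f df ->
  is_derive s (1 : R) g dg -> is_derive s (1 : R) (fun s => f s * g s) (f s * dg + g s * df).
Proof. by move=> Hf Hg; exact: is_deriveM. Qed.

Lemma is_derive_affine (u v s : R) : is_derive s (1 : R) (fun s => u + s * v) v.
Proof.
have [d e] := @affine_derive R R u v s.
by apply: DeriveDef => //; exact: (diff_derivable (1 : R) d).
Qed.

Lemma is_derive_translate (h : R -> R) (s d : R) :
  is_derive (0 : R) (1 : R) (fun r => h (s + r)) d -> is_derive s (1 : R) h d.
Proof.
have E : (fun r : R => r^-1 *: (((fun r => h (s + r)) \o shift 0) (r *: (1 : R)) - h (s + 0)))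
   = (fun r : R => r^-1 *: ((h \o shift s) (r *: (1 : R)) - h s)).
  apply/funext => r; congr (_ *: (h _ - h _)); last exact: addr0.
  by rewrite /= addr0 addrC.
case; rewrite /derivable /derive E => H1 H2; exact: DeriveDef.
Qed.

Lemma continuous_sumf (T : topologicalType) n (f : 'I_n -> T -> R) (y : T) :
  (forall j, {for y, continuous (f j)}) -> {for y, continuous (fun y => \sum_j f j y)}.
Proof.
move=> H; elim: (index_enum _) => [|j l IH].
  apply: (@near_continuous _ _ (fun=> 0) _ y); last exact: cst_continuous.
  by near=> z; rewrite big_nil.
apply: (@near_continuous _ _ (fun z => f j z + \sum_(j <- l) f j z) _ y).
  by near=> z; rewrite big_cons.
exact: (cvgD (H j) IH).
Unshelve. all: by end_near. Qed.

Lemma near_all (T : topologicalType) (I : finType) (x : T) (P : I -> T -> Prop) :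
  (forall i, \forall z \near x, P i z) -> \forall z \near x, forall i, P i z.
Proof. exact: filter_forall. Qed.

Lemma sum_div_succ_le m (c eps : R) : 0 <= c -> 0 < eps ->
  \sum_(j < m) c * (eps / m.+1%:R) <= eps * c.
Proof.
move=> c0 eps0; rewrite -mulr_sumr mulrC ler_wpM2r // sumr_const card_ord -[_ *+ m]mulr_natr.
rewrite mulrAC ler_pdivrMr ?ltr0Sn // (ler_wpM2l (ltW eps0)) // ler_nat.
exact: leqnSn.
Qed.

Lemma coord_le_norm m (h : 'rV[R]_m) j : `|h 0 j| <= `|h|.
Proof.
rewrite [leRHS]/Num.Def.normr /= mx_normrE.
exact: (le_bigmax _ (fun i : 'I_1 * 'I_m => `|h i.1 i.2|) (0, j)).
Qed.

End PointwiseRules.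

(** * The Poincare lemma on a ball *)

Section Poincare.
Context {R : realType} {m : nat}.
Variables (x0 : 'rV[R]_m) (e : R) (a : 'I_m -> 'rV[R]_m -> R).
Local Notation B := (ball x0 e).
Hypothesis sa : forall j, smooth_on B (a j).
Hypothesis closed_a : forall x j l, B x ->
  'D_(delta_mx 0 j) (a l) x = 'D_(delta_mx 0 l) (a j) x.
Local Notation mu := (@lebesgue_measure R).

(** The integral of the form with coefficients [a] along the segment from the centre [x0] to [x]. *)
Definition radial_primitive (x : 'rV[R]_m) : R :=
  \int[mu]_(t in `[0, 1]) \sum_j (x - x0) 0 j * a j (x0 + t *: (x - x0)).

Lemma ballE y : B y <-> `|y - x0| < e.
Proof. by rewrite -ball_normE /ball_ /= distrC. Qed.

Lemma radial_derive (x v : 'rV[R]_m) : B x ->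
  is_derive (0 : R) (1 : R) (fun s => radial_primitive (x + s *: v)) (\sum_j v 0 j * a j x).
Proof.
move=> /ballE Bx; set u := x - x0 in Bx.
(* With this radius [r * (|v| + 1)] is half the distance left to the boundary of the ball, so every
   segment point [Y s t] with [|s| <= r] stays inside; the added 1 covers v = 0. *)
pose r := (e - `|u|) / (2 * (`|v| + 1)).
have v1 : 0 < `|v| + 1 by rewrite ltr_wpDl.
have r0 : 0 < r by rewrite divr_gt0 ?subr_gt0 // mulr_gt0.
pose Y (s t : R) := x0 + t *: (u + s *: v).
have BY s t : `|s| <= r -> 0 <= t <= 1 -> B (Y s t).
  move=> sr /andP[t0 t1]; apply/ballE; rewrite /Y addrAC subrr add0r normrZ ger0_norm //.
  have le : `|u + s *: v| < e.
    rewrite (le_lt_trans (ler_normD _ _)) // normrZ -ltrBrDl.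
    apply: (@le_lt_trans _ _ (r * (`|v| + 1))).
      by rewrite ler_pM // lerDl.
    rewrite /r invfM mulrA -mulrA mulVf ?lt0r_neq0 // mulr1.
    by rewrite ltr_pdivrMr // ltr_pMr ?subr_gt0 // ltr1n.
  by apply: le_lt_trans le; rewrite ler_piMl.
have YE s t : Y s t = (x0 + t *: u) + s *: (t *: v).
  by rewrite /Y scalerDr scalerA mulrC -scalerA addrA.
pose c j (s : R) := u 0 j + s * v 0 j.
pose p s t := \sum_j c j s * a j (Y s t).
pose dp s t := \sum_j (c j s * (\sum_k (t * v 0 k) * 'D_(delta_mx 0 k) (a j) (Y s t))
                        + a j (Y s t) * v 0 j).
(* Closedness exchanges the indices of the partial derivatives in [dp 0 t], which thereby becomes
   the derivative of [q]; its increment from 0 to 1 is the value of the form at x on v. *)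
pose q t := t * \sum_j v 0 j * a j (Y 0 t).
have F_E s : radial_primitive (x + s *: v) = \int[mu]_(t in `[0, 1]) p s t.
  rewrite /radial_primitive; congr (Rintegral _ _ _); apply/funext => t.
  by apply: eq_bigr => j _; rewrite /Y /c (addrAC x) -/u !mxE.
under eq_fun do rewrite F_E.
have -> : \sum_j v 0 j * a j x = q 1 - q 0.
  rewrite /q mul0r subr0 mul1r; apply: eq_bigr => j _.
  by rewrite /Y scale1r scale0r addr0 /u addrC subrK.
have n0 : `|0 : R| <= r by rewrite normr0 ltW.
have da j s t : `|s| <= r -> 0 <= t <= 1 -> differentiable (a j) (Y s t).
  by move=> sr t01; apply: (smooth_on_diff (sa j)); exact: BY.
apply: (leibniz_rule (dp := dp) r0).
- move=> s t sr t01; apply: is_derive_sumf => j; apply: is_deriveMf.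
    exact: is_derive_affine.
  have := da j s t sr t01; rewrite YE => /line_derive.
  rewrite (derive_rV (t *: v)) -?YE; last exact: da.
  under eq_fun do rewrite -YE.
  by under eq_bigr do rewrite mxE.
- move=> t t01; have da0 j : differentiable (a j) (x0 + t *: u).
    by have := da j 0 t n0 t01; rewrite YE scale0r addr0.
  have d1 : is_derive t (1 : R) (fun t => \sum_j v 0 j * a j (Y 0 t))
     (\sum_j (v 0 j * 'D_u (a j) (x0 + t *: u) + a j (x0 + t *: u) * 0)).
    apply: is_derive_sumf => j.
    have := is_deriveMf (is_derive_cst (v 0 j) t (1 : R)) (line_derive (da0 j)).
    by rewrite (_ : (fun s => _) = (fun t => v 0 j * a j (Y 0 t))) // ;
      apply/funext => t'; rewrite YE scale0r addr0.
  suff E : t * (\sum_j (v 0 j * 'D_u (a j) (x0 + t *: u) + a j (x0 + t *: u) * 0))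
      + (\sum_j v 0 j * a j (Y 0 t)) * 1 = dp 0 t.
    by have := is_deriveMf (is_derive_id t (1 : R)) d1; rewrite E.
  rewrite /dp [RHS]big_split /=; congr (_ + _); last first.
    by rewrite mulr1; apply: eq_bigr => j _; exact: mulrC.
  rewrite mulr_sumr.
  transitivity (\sum_j \sum_k t * (v 0 j * (u 0 k * 'D_(delta_mx 0 k) (a j) (x0 + t *: u)))).
    apply: eq_bigr => j _; rewrite mulr0 addr0 (derive_rV u) // mulr_sumr mulr_sumr.
    by apply: eq_bigr => k _.
  rewrite exchange_big /=; apply: eq_bigr => j _.
  rewrite mulr_sumr; apply: eq_bigr => k _.
  rewrite /c mul0r addr0 YE scale0r addr0 (closed_a k j) //.
    by move: ('D_(delta_mx 0 j) (a k) _) => z; ring.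
  by have := BY 0 t n0 t01; rewrite YE scale0r addr0.
- move=> s t sr t01.
  have cY : {for (s, t), continuous (fun y : R * R => Y y.1 y.2)}.
    apply: cvgD; first exact: cvg_cst.
    apply: cvgZ; first exact: cvg_snd.
    apply: cvgD; first exact: cvg_cst.
    by apply: cvgZr_tmp; exact: cvg_fst.
  have cc j : {for (s, t), continuous (fun y : R * R => c j y.1)}.
    apply: cvgD; first exact: cvg_cst.
    by apply: cvgM; [exact: cvg_fst|exact: cvg_cst].
  have cf (f : 'rV[R]_m -> R) : smooth_on B f ->
      {for (s, t), continuous (fun y : R * R => f (Y y.1 y.2))}.
    move=> sf; apply: (continuous_comp cY); apply: (sf 0%N); exact: BY.
  apply: continuous_sumf => j; apply: cvgD; last first.
    by apply: cvgM; [exact: cf|exact: cvg_cst].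
  apply: cvgM; first exact: cc.
  apply: continuous_sumf => k; apply: cvgM.
    by apply: cvgM; [exact: cvg_snd|exact: cvg_cst].
  exact: (cf _ (smooth_on_derive k (sa j))).
move=> s t sr t01; apply: continuous_sumf => j; apply: cvgM; first exact: cvg_cst.
have d := da j s t sr t01; exact: is_derive_continuous (line_derive d).
Qed.

Lemma ball_segment (x y : 'rV[R]_m) (s : R) : B x -> B y -> 0 <= s <= 1 -> B (x + s *: (y - x)).
Proof.
move=> /ballE Bx /ballE By /andP[s0 s1]; apply/ballE.
have -> : x + s *: (y - x) - x0 = (1 - s) *: (x - x0) + s *: (y - x0).
  by apply/rowP => k; rewrite !mxE; ring.
rewrite (le_lt_trans (ler_normD _ _)) // !normrZ !ger0_norm ?subr_ge0 //.
have [->|s_pos] := eqVneq s 0; first by rewrite subr0 mul1r mul0r addr0.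
have sp : 0 < s by rewrite lt_neqAle eq_sym s_pos.
have : s * `|y - x0| < s * e by rewrite ltr_pM2l.
have : (1 - s) * `|x - x0| <= (1 - s) * e by rewrite ler_wpM2l ?subr_ge0 // ltW.
lra.
Qed.

(** The mean value theorem on the segment from x to y. It expresses an increment of the primitive
    through coefficients at one intermediate point. *)
Lemma radial_mvt (x y : 'rV[R]_m) : B x -> B y -> exists s : R, 0 <= s <= 1 /\
  radial_primitive y - radial_primitive x = \sum_j (y - x) 0 j * a j (x + s *: (y - x)).
Proof.
move=> Bx By; pose h (s : R) := radial_primitive (x + s *: (y - x)).
have dh (s : R) : 0 <= s <= 1 -> is_derive s (1 : R) h (\sum_j (y - x) 0 j * a j (x + s *: (y - x))).
  move=> s01; apply: is_derive_translate.
  have E : (fun r : R => radial_primitive (x + s *: (y - x) + r *: (y - x))) = (fun r => h (s + r)).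
    by apply/funext => r; rewrite /h scalerDl addrA.
  by rewrite -E; exact: (radial_derive (y - x) (ball_segment Bx By s01)).
have [||s s01 E] := @MVT R h (fun s => \sum_j (y - x) 0 j * a j (x + s *: (y - x))) 0 1 ltr01.
- by move=> s; rewrite in_itv /= => /andP[s0 s1]; apply: dh; rewrite !ltW.
- apply: continuous_in_subspaceT => s; rewrite inE /= in_itv /= => s01.
  exact: is_derive_continuous (dh s s01).
exists s; split; first by move: s01; rewrite in_itv /= => /andP[s0 s1]; rewrite !ltW.
have h1 : h 1 = radial_primitive y by rewrite /h scale1r addrCA subrr addr0.
have h0 : h 0 = radial_primitive x by rewrite /h scale0r addr0.
by rewrite -h1 -h0 E subr0 mulr1.
Qed.

(** Derivatives along lines alone do not give differentiability. The mean value form of the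
    increment, together with continuity of the coefficients at x, gives the missing uniform
    estimate. *)
Lemma radial_diff (x : 'rV[R]_m) : B x -> differentiable radial_primitive x /\
  forall j, 'D_(delta_mx 0 j) radial_primitive x = a j x.
Proof.
move=> Bx; pose L (v : 'rV[R]_m) := \sum_j v 0 j * a j x.
have linL : linear L.
  move=> k u v; rewrite /L scaler_sumr -big_split /=; apply: eq_bigr => j _.
  by rewrite !mxE mulrDl -mulrA.
pose LM := GRing.isLinear.Build R 'rV[R]_m R *:%R L linL.
pose LL : {linear 'rV[R]_m -> R} := HB.pack L LM.
have cL : continuous LL.
  suff : continuous L by [].
  move=> v; apply: (@continuous_sumf _ 'rV[R]_m m (fun j v => v 0 j * a j x) v) => j.
  have c1 : {for v, continuous (fun v : 'rV[R]_m => v 0 j)} by exact: coord_continuous.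
  have c2 : {for v, continuous (fun _ : 'rV[R]_m => a j x)} by exact: cst_continuous.
  exact: (cvgM c1 c2).
have D : is_diff x radial_primitive LL.
  apply: is_diff_estimateP => // eps eps0.
  (* The m coefficients share the tolerance [eps]; dividing by m + 1 rather than m keeps the
     quotient positive in dimension 0. *)
  have near_j j : \forall z \near x, `|a j x - a j z| < eps / m.+1%:R.
    have cj : {for x, continuous (a j)} by exact: (sa j 0%N).
    have d0 : 0 < eps / m.+1%:R by rewrite divr_gt0.
    exact: (near_comp cj (iffRL (near_realP (a j x) (fun z => `|a j x - z| < eps / m.+1%:R))
      (ex_intro _ _ (conj d0 (fun _ h => h))))).
  have near_a : \forall z \near x, forall j, `|a j x - a j z| < eps / m.+1%:R.
    exact: (near_all near_j).
  have [d d0 Hd] := (iffLR (nbhs_ballP _ _)) (filterI near_a (open_nbhs_nbhs (conj (ball_open x0 e) Bx))).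
  near=> h.
  have hd : `|h| < d.
    by near: h; apply/nbhs_ballP; exists d => // h; rewrite -ball_normE /= sub0r normrN.
  have Bh : B (h + x).
    by apply: (proj2 (Hd _ _)); rewrite -ball_normE /= opprD addrCA subrr addr0 normrN.
  have [s [/andP[s0 s1] ->]] := radial_mvt Bx Bh.
  rewrite addrK -sumrB (le_trans (ler_norm_sum _ _ _)) //.
  apply: (@le_trans _ _ (\sum_(j < m) (`|h| * (eps / m.+1%:R)))).
    apply: ler_sum => j _; rewrite -mulrBr normrM ler_pM //; first exact: coord_le_norm.
    rewrite distrC ltW //; apply: (proj1 (Hd _ _)).
    rewrite -ball_normE /= opprD addrA subrr add0r normrN normrZ ger0_norm //.
    by apply: le_lt_trans hd; rewrite ler_piMl.
  exact: sum_div_succ_le.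
have dD : differentiable radial_primitive x by exact: ex_diff.
split=> // j; rewrite (deriveE _ dD) (@diff_val _ _ _ _ _ _ _ D) /= /L.
rewrite (bigD1 j) //= big1 => [|i ij]; first by rewrite mxE !eqxx mul1r addr0.
by rewrite mxE (negbTE ij) andbF mul0r.
Unshelve. all: by end_near. Qed.

Lemma poincare : exists F, smooth_on B F /\
  forall x j, B x -> 'D_(delta_mx 0 j) F x = a j x.
Proof.
exists radial_primitive; split; last by move=> x j /radial_diff[_].
case=> [|k].
  by move=> x /radial_diff[d _]; exact: differentiable_continuous.
split=> [x /radial_diff[] //|j].
apply: (Ck_eq (ball_open _ _) _ (sa j k)) => x Bx.
by have [_ ->] := radial_diff Bx.
Qed.

End Poincare.

Lemma derive_eq0_constant (R : realType) m (x0 : 'rV[R]_m) (e : R) (G : 'rV[R]_m -> R) :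
  smooth_on (ball x0 e) G -> (forall y j, ball x0 e y -> 'D_(delta_mx 0 j) G y = 0) ->
  forall y, ball x0 e y -> G y = G x0.
Proof.
move=> sG G0 y By; have Bx : ball x0 e x0.
  apply: ballxx; move: By; rewrite -ball_normE /ball_ /=; exact: le_lt_trans.
pose h (s : R) := G (x0 + s *: (y - x0)).
have dh (s : R) : 0 <= s <= 1 -> is_derive s (1 : R) h 0.
  move=> s01; have Bs := ball_segment Bx By s01.
  have d := smooth_on_diff sG Bs; have := line_derive d.
  by rewrite (derive_rV (y - x0) d) big1 // => j _; rewrite G0 // mulr0.
have [||s _] := @MVT R h (fun=> 0) 0 1 ltr01.
- by move=> s; rewrite in_itv /= => /andP[s0 s1]; apply: dh; rewrite !ltW.
- apply: continuous_in_subspaceT => s; rewrite inE /= in_itv /= => s01.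
  exact: is_derive_continuous (dh s s01).
have h1 : h 1 = G y by rewrite /h scale1r addrCA subrr addr0.
have h0 : h 0 = G x0 by rewrite /h scale0r addr0.
by rewrite h1 h0 mul0r => /eqP; rewrite subr_eq0 => /eqP.
Qed.

Section ClosedForm.
Context {R : realType} {m : nat} (M : manifold R m).
Implicit Types (p q x y z : M).

Lemma tderiv_eq0_constant (f : M -> R) z :
  (\forall p \near z, smooth_at p f /\ forall v, tderiv f p v = 0) ->
  \forall p \near z, f p = f z.
Proof.
move=> H; have [sf _] := nbhs_singleton H.
have cz := cdom_chart_at z; set c := chart_at z in cz.
have n1 := near_ball_sub (near_cinv cz H).
have n2 := smooth_atE cz sf.
have n3 := near_ball_sub (near_cimage cz).
near (0 : R)^'+ => e.
have e0 : 0 < e by near: e; exact: nbhs_right_gt.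
have h1 : ball (cmap c z) e `<=` (fun x : 'rV[R]_m => smooth_at (cinv c x) f /\ forall v, tderiv f (cinv c x) v = 0).
  by near: e.
have h2 : smooth_on (ball (cmap c z) e) (f \o cinv c) by near: e.
have h3 : ball (cmap c z) e `<=` cmap c @` cdom c by near: e.
have nB : \forall p \near z, ball (cmap c z) e (cmap c p).
  by apply: (@near_cmap _ _ _ c z (ball (cmap c z) e) cz); exact: nbhsx_ballx.
have K := derive_eq0_constant h2; apply: filterS2 (near_cdom cz) nB => p cp Bp.
have := K _ _ Bp; rewrite /= (cmapK cp) (cmapK cz); apply.
move=> y j By; have [cy yE] := cimage_cinv (h3 y By).
have [sy ty] := h1 y By; have := ty (cvec c j (cinv c y)).
by rewrite (tderiv_cvec j cy sy) /pderiv yE.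
Unshelve. all: by end_near. Qed.

Lemma manifold_locally_connected z (W : set M) : nbhs z W -> \forall z' \near z,
  exists s : R -> M, [/\ continuous s, s 0 = z, s 1 = z' & forall t, 0 <= t <= 1 -> W (s t)].
Proof.
move=> nW; have cz := cdom_chart_at z; set c := chart_at z in cz.
have n1 := near_ball_sub (near_cinv cz nW).
have n3 := near_ball_sub (near_cimage cz).
near (0 : R)^'+ => e.
have e0 : 0 < e by near: e; exact: nbhs_right_gt.
have h1 : ball (cmap c z) e `<=` (fun x : 'rV[R]_m => W (cinv c x)) by near: e.
have h3 : ball (cmap c z) e `<=` cmap c @` cdom c by near: e.
have nB : \forall p \near z, ball (cmap c z) e (cmap c p).
  by apply: (@near_cmap _ _ _ c z (ball (cmap c z) e) cz); exact: nbhsx_ballx.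
apply: filterS2 (near_cdom cz) nB => z' cz' Bz'.
have Bz : ball (cmap c z) e (cmap c z) by exact: ballxx.
(* Clamping keeps the straight path inside the ball for every real t, as continuity is wanted on the
   whole line and [cinv c] is controlled only on the chart image. *)
pose l t := cmap c z + clamp t *: (cmap c z' - cmap c z).
have Bl t : ball (cmap c z) e (l t) by apply: ball_segment => //; exact: clamp01.
have i0 : 0 <= (0 : R) <= 1 by rewrite lexx ler01.
have i1 : 0 <= (1 : R) <= 1 by rewrite lexx ler01.
have cl : continuous l.
  move=> t; apply: cvgD; first exact: cvg_cst.
  by apply: cvgZr_tmp; exact: continuous_clamp.
exists (cinv c \o l); split => [t|||t t01] /=.
- apply: continuous_comp; first exact: cl.
  exact: (cinv_continuous (h3 _ (Bl t))).
- by rewrite /l (clampK i0) scale0r addr0 (cmapK cz).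
- by rewrite /l (clampK i1) scale1r addrCA subrr addr0 (cmapK cz').
- exact: h1.
Unshelve. all: by end_near. Qed.

Variable alpha : M -> 'rV[R]_m -> R.
Hypothesis alpha_linear : forall p a u v, alpha p (a *: u + v) = a * alpha p u + alpha p v.
Hypothesis alpha_smooth : forall (c : chart M) p j, cdom c p ->
  smooth_at p (fun x => alpha x (cvec c j x)).
Hypothesis alpha_closed : forall (c : chart M) p j l, cdom c p ->
  pderiv c j (fun x => alpha x (cvec c l x)) p = pderiv c l (fun x => alpha x (cvec c j x)) p.

Definition primitive_at f p := smooth_at p f /\ forall v, tderiv f p v = alpha p v.

Lemma alpha_sum p (u : 'I_m -> R) (v : 'I_m -> 'rV[R]_m) :
  alpha p (\sum_k u k *: v k) = \sum_k u k * alpha p (v k).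
Proof.
have z0 : alpha p 0 = 0.
  by have := alpha_linear p (-1) 0 0; rewrite scaler0 addr0 mulN1r addNr.
elim: (index_enum _) => [|k s IH]; first by rewrite !big_nil.
by rewrite !big_cons alpha_linear IH.
Qed.

Lemma local_primitive x : exists (V : set M) (f : M -> R), [/\ open V, V x &
  forall z, V z -> primitive_at f z].
Proof.
have cx := cdom_chart_at x; set c := chart_at x in cx.
pose a j := (fun z => alpha z (cvec c j z)) \o cinv c.
have n2 : \forall e \near (0 : R)^'+, forall j, smooth_on (ball (cmap c x) e) (a j).
  by apply: filter_forall => j; apply: (smooth_atE cx); exact: alpha_smooth.
have n3 := near_ball_sub (near_cimage cx).
near (0 : R)^'+ => e.
have e0 : 0 < e by near: e; exact: nbhs_right_gt.
have h2 : forall j, smooth_on (ball (cmap c x) e) (a j) by near: e.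
have h3 : ball (cmap c x) e `<=` cmap c @` cdom c by near: e.
have h4 (y : 'rV[R]_m) j l : ball (cmap c x) e y -> 'D_(delta_mx 0 j) (a l) y = 'D_(delta_mx 0 l) (a j) y.
  move=> /h3/cimage_cinv[cy yE]; have := alpha_closed j l cy.
  by rewrite /pderiv yE.
have [F [sF dF]] := poincare h2 h4.
exists (interior (cdom c `&` cmap c @^-1` ball (cmap c x) e)), (F \o cmap c); split.
- exact: open_interior.
- have nB : \forall p \near x, ball (cmap c x) e (cmap c p).
    by apply: (@near_cmap _ _ _ c x (ball (cmap c x) e) cx); exact: nbhsx_ballx.
  by apply: filterI nB; exact: near_cdom.
move=> z /interior_subset[cz Bz].
have sFz : smooth_at z (F \o cmap c).
  apply: (smooth_at_near0 cz).
  have nB : nbhs (cmap c z) (ball (cmap c x) e).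
    exact: (open_nbhs_nbhs (conj (ball_open _ _) Bz)).
  apply: filterS (near_ball_sub nB) => r rB.
  apply: (smooth_on_eq (ball_open _ _) _ (smooth_on_sub rB sF)) => y /rB/h3/cimage_cinv[_ yE] /=.
  by rewrite yE.
split=> // v; rewrite (tderivE v cz sFz) [in RHS](ccompK v cz) alpha_sum.
apply: eq_bigr => k _; congr (_ * _); rewrite /pderiv.
have E : \forall y \near cmap c z, ((F \o cmap c) \o cinv c) y = F y.
  by apply: filterS (near_cimage cz) => y /cimage_cinv[_ /= ->].
by rewrite (near_eq_derive _ E) dF // /a /= (cmapK cz).
Unshelve. all: by end_near. Qed.

(** On overlaps two local primitives have a difference with zero differential, which is the
    compatibility needed for continuation; the global function is near each point a local primitive
    plus a constant. *)
Lemma closed_form_exact : simply_connected R M ->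
  exists f : M -> R, forall p, primitive_at f p.
Proof.
move=> sc; pose V x := sval (cid (local_primitive x)).
have VP x : exists f, [/\ open (V x), V x x & forall z, V x z -> primitive_at f z].
  by rewrite /V; case: cid.
pose phi x := sval (cid (VP x)).
have phiP x : [/\ open (V x), V x x & forall z, V x z -> primitive_at (phi x) z].
  by rewrite /phi; case: cid.
have oV x : open (V x) by case: (phiP x).
have Vx x : V x x by case: (phiP x).
have pV x z : V x z -> primitive_at (phi x) z by case: (phiP x) => _ _; apply.
have nV x z : V x z -> \forall z' \near z, primitive_at (phi x) z'.
  by move=> Vz; apply: filterS (open_nbhs_nbhs (conj (oV x) Vz)) => z' /pV.
have compat x y z : V x z -> V y z ->
    \forall z' \near z, phi x z' - phi y z' = phi x z - phi y z.
  move=> Vxz Vyz; apply: (@tderiv_eq0_constant (fun z => phi x z - phi y z)).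
  apply: filterS2 (nV _ _ Vxz) (nV _ _ Vyz) => p [s1 t1] [s2 t2]; split.
    exact: smooth_atB.
  move=> v; rewrite (tderivD v s1 (smooth_atN s2)) (tderivN v s2) t1 t2.
  exact: subrr.
have [f Hf] := global_primitive oV Vx compat sc manifold_locally_connected.
exists f => p; have [s1 t1] := pV p p (Vx p).
have E : \forall p' \near p, f p' = phi p p' + (f p - phi p p).
  by apply: filterS (Hf p p (Vx p)) => p' <-; rewrite addrC subrK.
have E' : \forall p' \near p, phi p p' + (f p - phi p p) = f p'.
  by apply: filterS E => p' ->.
split; first exact: (near_eq_smooth_at E' (smooth_atD s1 (smooth_at_cst p _))).
move=> v; rewrite [LHS](cder_near v (cdom_chart_at p) E) -t1.
have := tderivD v s1 (smooth_at_cst p (f p - phi p p)).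
move=> E2; transitivity (tderiv (phi p) p v + tderiv (fun=> f p - phi p p) p v).
  exact: E2.
have -> : tderiv (fun=> f p - phi p p) p v = 0 by exact: cder_cst.
exact: addr0.
Qed.

End ClosedForm.

(** * The gauge transformation on M *)

Lemma self_opp (R : realFieldType) (x : R) : x = - x -> x = 0.
Proof. by lra. Qed.

Lemma sub_swap (R : realFieldType) (x y z t : R) : x - y = z - t -> z - x = t - y.
Proof. by lra. Qed.

Section Gauge.
Context {R : realType} {n : nat} (M : manifold R (2 * n)).
Variables (w I I' : M -> 'M[R]_(2 * n)) (k : R) (a a' : @connection R n (2 * n) M).
Hypotheses (symp : symplectic w) (comp : compatible w I) (comp' : compatible w I').
Hypotheses (ref : reference_connection w k I a) (ref' : reference_connection w k I' a').
Implicit Types (p q : M) (e : @section R n (2 * n) M).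

Local Notation id := (fun x : M => x).
Local Notation sid := (@smooth_map_id R (2 * n) M).
Local Notation hk := (hK id w I).
Local Notation Phi := (bundle_map id symp comp comp').
Local Notation cf := (conn_form id w I a).
Local Notation cf' := (conn_form id w I' a').

Let Ha : hermitian_connection id w I a. Proof. by case: ref. Qed.
Let Ha' : hermitian_connection id w I' a'. Proof. by case: ref'. Qed.

Definition form_change e p v := cf' (fun x => Phi x (e x)) p v - cf e p v.

(** Changing the frame by a phase z adds z^-1 dz to both connection forms, because Phi is complex
    linear; the difference is unaffected. *)
Lemma form_change_frame e e' p v : unit_section id w I p e -> unit_section id w I p e' ->
  form_change e p v = form_change e' p v.
Proof.
move=> ue ue'; have se := unit_section_smooth ue; have se' := unit_section_smooth ue'.
pose z x := hk x (e x) (e' x).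
have sz : csmooth_at p z := csmooth_hK sid symp comp se se'.
have E : \forall x \near p, e x = z x \*o e' x := unit_frame symp comp ue' se.
have z1 : \forall x \near p, z x * (z x)^*%C = 1.
  apply: filterS3 E (near_unit_section ue) (near_unit_section ue') => x Ex ux ux'.
  have ex := unit_section_ext ux'.
  have := unit_section1 ux; rewrite {1 2}Ex hKZl (@hKZr _ _ _ _ _ id _ _ symp comp x _ _ _ ex ex).
  by rewrite (unit_section1 ux') mulr1.
have uz := unit_section_phase symp comp sz z1 ue'.
have uPe := unit_section_bundle_map sid symp comp comp' ue.
have uPe' := unit_section_bundle_map sid symp comp comp' ue'.
have uPz := unit_section_phase symp comp' sz z1 uPe'.
rewrite /form_change (conn_form_near v Ha se (unit_section_smooth uz) E).
rewrite (@conn_form_near _ _ _ _ _ _ _ _ a' _ (fun x => z x \*o Phi x (e' x)) p v Ha'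
  (unit_section_smooth uPe) (unit_section_smooth uPz)); last first.
  by apply: filterS E => x ->; exact: bundle_mapZ.
rewrite (conn_form_phase symp comp sz z1 v Ha ue').
rewrite (conn_form_phase symp comp' sz z1 v Ha' uPe').
by rewrite opprD addrACA subrr add0r.
Qed.

Definition frame_at q : @section R n (2 * n) M :=
  sval (cid (exists_unit_section sid symp comp q)).

Lemma frame_atP q : unit_section id w I q (frame_at q).
Proof. by rewrite /frame_at; case: cid. Qed.

(** The form alpha of the overview. Connection forms in unit frames are imaginary, so the imaginary
    part loses nothing; as the difference does not depend on the frame, the arbitrary choice of
    [frame_at p] at each point does no harm to smoothness. *)
Definition gauge_form p v : R := Im (form_change (frame_at p) p v).

Lemma gauge_formE e p v : unit_section id w I p e ->
  form_change e p v = (0 +i* gauge_form p v)%C.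
Proof.
move=> ue; rewrite /gauge_form -(form_change_frame v ue (frame_atP p)).
have uPe := unit_section_bundle_map sid symp comp comp' ue.
have := conn_formN symp comp Ha v ue; have := conn_formN symp comp' Ha' v uPe.
rewrite /form_change; case: (cf e p v) => r1 i1; case: (cf' _ p v) => r2 i2.
move=> /(congr1 (fun z : R[i] => Re z)) /= e2 /(congr1 (fun z : R[i] => Re z)) /= e1.
by apply: complex_eq => //=; rewrite (self_opp e1) (self_opp e2) subr0.
Qed.

Lemma gauge_form_linear p (r : R) u v :
  gauge_form p (r *: u + v) = r * gauge_form p u + gauge_form p v.
Proof.
have ue := frame_atP p; have uPe := unit_section_bundle_map sid symp comp comp' ue.
rewrite /gauge_form /form_change (conn_form_linear Ha r u v ue).
rewrite (conn_form_linear Ha' r u v uPe).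
move: (cf _ p u) (cf _ p v) (cf' _ p u) (cf' _ p v) => [x1 y1] [x2 y2] [x3 y3] [x4 y4] /=.
by ring.
Qed.

Lemma gauge_form_near q : \forall p \near q, forall v,
  gauge_form p v = Im (cf' (fun x => Phi x (frame_at q x)) p v) - Im (cf (frame_at q) p v).
Proof.
apply: filterS (near_unit_section (frame_atP q)) => p up v.
have := gauge_formE v up; rewrite /form_change => /(congr1 (fun z : R[i] => Im z)) /= <-.
by case: (cf _ _ _) => ? ?; case: (cf' _ _ _).
Qed.

Lemma gauge_form_cvec_near (c : chart M) l q : \forall p \near q,
  gauge_form p (cvec c l p) = Im (cf' (fun x => Phi x (frame_at q x)) p (cvec c l p))
    + - Im (cf (frame_at q) p (cvec c l p)).
Proof. by apply: filterS (gauge_form_near q) => p ->. Qed.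

Lemma smooth_conn_cvec (J : M -> 'M[R]_(2 * n)) (cJ : compatible w J) b e (c : chart M) l q :
  hermitian_connection id w J b -> unit_section id w J q e -> cdom c q ->
  smooth_at q (fun p => Im (conn_form id w J b e p (cvec c l p))).
Proof.
move=> Hb ue cq.
by have [_] := csmooth_conn_form sid symp cJ Hb ue (smooth_vf_cvec sid l cq).
Qed.

Lemma gauge_form_smooth (c : chart M) q l : cdom c q ->
  smooth_at q (fun x => gauge_form x (cvec c l x)).
Proof.
move=> cq; have ue := frame_atP q; have uPe := unit_section_bundle_map sid symp comp comp' ue.
have E : \forall p \near q, Im (cf' (fun x => Phi x (frame_at q x)) p (cvec c l p))
    + - Im (cf (frame_at q) p (cvec c l p)) = gauge_form p (cvec c l p).
  by apply: filterS (gauge_form_cvec_near c l q) => p ->.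
apply: (near_eq_smooth_at E); apply: smooth_atD.
  exact: (smooth_conn_cvec comp' l Ha' uPe cq).
by apply: smooth_atN; exact: (smooth_conn_cvec comp l Ha ue cq).
Qed.

Lemma curvature_unit_section (J : M -> 'M[R]_(2 * n)) (cJ : compatible w J) b Om e (c : chart M) j l q :
  hermitian_connection id w J b -> has_curvature w J b Om ->
  unit_section id w J q e -> cdom c q ->
  Im (Om q (cvec c j q) (cvec c l q))
  = pderiv c j (fun x => Im (conn_form id w J b e x (cvec c l x))) q
    - pderiv c l (fun x => Im (conn_form id w J b e x (cvec c j x))) q.
Proof.
move=> Hb HO ue cq.
(* [has_curvature] speaks of a section that is unitary on an open set; the germ condition on [e]
   supplies one through an interior. *)
pose U := interior [set p | smooth_section id J p e /\ hK id w J p (e p) (e p) = 1].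
have uU p : U p -> unit_section id w J p e by [].
rewrite (HO U e (conn_form id w J b e)) //.
- exact: open_interior.
- by move=> p /interior_subset.
- by move=> p v /uU up; exact: (conn_formE symp cJ Hb).
Qed.

Lemma gauge_form_closed (c : chart M) q j l : cdom c q ->
  pderiv c j (fun x => gauge_form x (cvec c l x)) q
  = pderiv c l (fun x => gauge_form x (cvec c j x)) q.
Proof.
move=> cq; have ue := frame_atP q; have uPe := unit_section_bundle_map sid symp comp comp' ue.
have D r s : pderiv c r (fun x => gauge_form x (cvec c s x)) q
   = pderiv c r (fun p => Im (cf' (fun x => Phi x (frame_at q x)) p (cvec c s p))) q
     - pderiv c r (fun p => Im (cf (frame_at q) p (cvec c s p))) q.
  have s1 := smooth_conn_cvec comp' s Ha' uPe cq; have s2 := smooth_conn_cvec comp s Ha ue cq.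
  rewrite [LHS](cder_near _ cq (gauge_form_cvec_near c s q)).
  rewrite (cderD _ cq s1 (smooth_atN s2)); congr (_ + _).
  by rewrite (@cder_comp1 _ _ _ c (delta_mx 0 r) _ -%R q (-1) cq s2) ?mulN1r.
have C := curvature_unit_section comp j l Ha ref.2 ue cq.
have := curvature_unit_section comp' j l Ha' ref'.2 uPe cq; rewrite C !D.
move: (pderiv _ _ _ _) (pderiv _ _ _ _) (pderiv _ _ _ _) (pderiv _ _ _ _).
by move=> r1 r2 r3 r4 /sub_swap.
Qed.

(** The factor exp(- i f) adds - i df to the connection form of a' in the frame Phi e, which cancels
    the discrepancy i alpha since df = alpha. *)
Lemma gauge_function : simply_connected R M -> exists f : M -> R,
  (forall p, smooth_at p f) /\ forall p e v, unit_section id w I p e ->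
  cf' (fun x => expi (- f x) \*o Phi x (e x)) p v = cf e p v.
Proof.
move=> sc; have [f Hf] := closed_form_exact gauge_form_linear gauge_form_smooth gauge_form_closed sc.
have sf p : smooth_at p f by have [] := Hf p.
exists f; split=> // p e v ue.
have uPe := unit_section_bundle_map sid symp comp comp' ue.
have sm : smooth_at p (fun x => - f x) by exact: smooth_atN.
have z1 : \forall x \near p, expi (- f x) * (expi (- f x))^*%C = 1.
  by near=> x; rewrite normc_sqr_real /= cos2Dsin2.
rewrite (conn_form_phase symp comp' (csmooth_at_expi sm) z1 v Ha' uPe).
rewrite (ctderiv_expi v sm) mulrCA (mulrC (expi _)^*%C) (nbhs_singleton z1) mulr1.
rewrite (tderivN v (sf p)) (Hf p).2.
have := gauge_formE v ue; rewrite /form_change => /eqP; rewrite subr_eq => /eqP ->.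
rewrite addrA -[RHS]add0r; congr (_ + _).
by apply: complex_eq; rewrite /= ?addr0 ?addNr.
Unshelve. all: by end_near. Qed.

End Gauge.

(** * Lagrangian subspaces *)

Section PositiveMatrices.
Context {R : realType}.

Definition quad n (Q : 'M[R]_n) (v : 'rV[R]_n) : R := (v *m Q *m v^T) 0 0.

Definition posdef n (Q : 'M[R]_n) := Q^T = Q /\ forall v, v != 0 -> 0 < quad Q v.

Lemma quad_eigen0 n (Q : 'M[R]_n) (v : 'rV[R]_n) : posdef Q -> v *m Q = 0 -> v = 0.
Proof.
move=> [_ pQ] vQ; apply/eqP; apply: contraT => /pQ.
by rewrite /quad vQ mul0mx mxE ltxx.
Qed.

Lemma posdef_unit n (Q : 'M[R]_n) : posdef Q -> Q \in unitmx.
Proof.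
move=> pQ; rewrite -row_free_unit -kermx_eq0; apply/eqP/row_matrixP => i; rewrite row0.
by apply: (quad_eigen0 pQ); rewrite -row_mul mulmx_ker row0.
Qed.

Variables (n : nat) (Q : 'M[R]_(1 + n)).
Hypothesis pQ : posdef Q.

Let a := Q 0 0.
Let b := ursubmx Q.

Definition schur_complement : 'M[R]_n := drsubmx Q - a^-1 *: (b^T *m b).

Lemma posdef_corner_gt0 : 0 < a.
Proof.
have := pQ.2 (delta_mx 0 0); rewrite /quad -rowE trmx_delta -colE !mxE; apply.
by apply/eqP => /matrixP/(_ 0 0)/eqP; rewrite !mxE !eqxx oner_eq0.
Qed.

Let Q_block : Q = block_mx a%:M b b^T (drsubmx Q).
Proof.
rewrite -[LHS]submxK; congr (block_mx _ _ _ _).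
  rewrite [LHS]mx11_scalar; congr (_%:M); rewrite !mxE; congr (Q _ _); exact: val_inj.
by rewrite /b trmx_ursub pQ.1.
Qed.

(** One step of symmetric elimination, with free parameters: r = 1 and P = 1 give the positivity of
    the determinant, while r = a^(-1/2) and a factor P for the Schur complement give the Cholesky
    recursion. *)
Lemma schur_eliminate (P : 'M[R]_n) (r : R) :
  let L := block_mx r%:M 0 (- (a^-1 *: (P *m b^T))) P in
  L *m Q *m L^T = block_mx (r ^+ 2 * a)%:M 0 0 (P *m schur_complement *m P^T).
Proof.
move=> L; have a0 : a != 0 by rewrite lt0r_neq0 // posdef_corner_gt0.
rewrite /L tr_block_mx trmx0 tr_scalar_mx [in LHS]Q_block !mulmx_block.
have E : - (a^-1 *: (P *m b^T)) *m a%:M + P *m b^T = 0.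
  by rewrite mul_mx_scalar scalerN scalerA mulfV // scale1r addNr.
rewrite !E !(mul0mx, mulmx0, add0r, addr0); congr (block_mx _ _ _ _).
- by rewrite -!scalar_mxM; congr (_%:M); rewrite expr2; ring.
- rewrite raddfN /= linearZ /= trmx_mul trmxK -scalar_mxM mulmxN -scalemxAr !mul_scalar_mx.
  by rewrite scalerA mulrCA mulVf // mulr1 -scalemxAl addNr.
rewrite /schur_complement mulmxBr mulmxBl addrC -scalemxAr mulNmx -!scalemxAl.
by rewrite mulmxDl mulNmx -scalemxAl !mulmxA.
Qed.

Lemma posdef_schur : posdef schur_complement.
Proof.
split=> [|v v0].
  rewrite /schur_complement linearB linearZ /= trmx_mul trmxK trmx_drsub.
  by rewrite pQ.1.
(* Among the vectors with tail v, [u] has the first coordinate that minimises the quadratic form of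
   Q; the minimum is the form of the Schur complement at v. *)
pose u : 'rV[R]_(1 + n) := row_mx (- (a^-1 *: (v *m b^T))) v.
have u0 : u != 0.
  by apply: contraNneq v0 => u0; rewrite -[v](row_mxKr (- (a^-1 *: (v *m b^T)))) -/u u0 raddf0.
have a0 : a != 0 by rewrite lt0r_neq0 // posdef_corner_gt0.
suff -> : quad schur_complement v = quad Q u by exact: pQ.2.
rewrite /quad /u tr_row_mx [in RHS]Q_block mul_row_block mul_row_col.
have -> : - (a^-1 *: (v *m b^T)) *m a%:M + v *m b^T = 0.
  by rewrite mul_mx_scalar scalerN scalerA mulfV // scale1r addNr.
rewrite mul0mx add0r /schur_complement mulmxBr addrC -scalemxAr mulNmx -!scalemxAl.
by rewrite !mulmxA.
Qed.

End PositiveMatrices.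

Lemma posdef_det_gt0 (R : realType) n (Q : 'M[R]_n) : posdef Q -> 0 < \det Q.
Proof.
elim: n Q => [|n IH] Q pQ; first by rewrite det_mx00.
have := congr1 determinant (schur_eliminate (pQ : posdef (Q : 'M[R]_(1 + n))) 1%:M 1).
rewrite !det_mulmx det_tr det_lblock det_ublock !det1.
rewrite expr1n !mul1r !mulr1 => ->.
rewrite mul1mx trmx1 mulmx1 det_scalar1 mulr_gt0 ?IH //; last exact: posdef_schur.
exact: (posdef_corner_gt0 (pQ : posdef (Q : 'M[R]_(1 + n)))).
Qed.

(** Gram-Schmidt with smooth dependence on the point. The recursion through Schur complements uses
    only sums, products, inverses and square roots of smooth functions, with a positive pivot under
    each inverse and each root. *)
Lemma cholesky (R : realType) m (N : manifold R m) n (Q : N -> 'M[R]_n) (q : N) :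
  (\forall p \near q, posdef (Q p)) -> (forall i j, smooth_at q (fun p => Q p i j)) ->
  exists P : N -> 'M[R]_n, (forall i j, smooth_at q (fun p => P p i j)) /\
    \forall p \near q, P p *m Q p *m (P p)^T = 1%:M.
Proof.
elim: n Q => [|n IH] Q pQ sQ.
  exists (fun=> 0); split=> [[]//|]; near=> p; apply/matrixP => i; by case: i.
have near_eqf f g : (forall p, f p = g p) -> smooth_at q f -> smooth_at q g.
  by move=> E; apply: near_eq_smooth_at; near=> p.
pose a p : R := (Q p : 'M[R]_(1 + n)) 0 0.
have pq := nbhs_singleton pQ.
have a0 : 0 < a q := posdef_corner_gt0 pq.
have sa : smooth_at q a by exact: sQ.
have sai : smooth_at q (fun p => (a p)^-1) by apply: smooth_at_inv; rewrite ?lt0r_neq0.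
pose b p : 'rV[R]_n := ursubmx (Q p : 'M[R]_(1 + n)).
have sb j : smooth_at q (fun p => b p 0 j).
  apply: (near_eqf (fun p => Q p (lshift n (ord0 : 'I_1)) (rshift 1 j))); last exact: sQ.
  by move=> p; rewrite !mxE.
have [||P' [sP' HP']] := IH (fun p => schur_complement (Q p : 'M[R]_(1 + n))).
- by apply: filterS pQ => p; exact: posdef_schur.
- move=> i j.
  apply: (near_eqf (fun p => Q p (rshift 1 i) (rshift 1 j) + - ((a p)^-1 * (b p 0 i * b p 0 j)))).
    by move=> p; rewrite !mxE big_ord1 !mxE.
  by apply: smooth_atD => //; apply: smooth_atN; do !apply: smooth_atM.
pose L p : 'M[R]_(1 + n) := block_mx ((Num.sqrt (a p))^-1)%:M 0
   (- ((a p)^-1 *: (P' p *m (b p)^T))) (P' p).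
exists L; split; last first.
  apply: filterS3 (near_gt0 sa a0) pQ HP' => p ap pp E.
  rewrite /L [LHS](schur_eliminate pp) E exprVn sqr_sqrtr ?(ltW ap) //.
  by rewrite mulVf ?lt0r_neq0 // -scalar_mx_block.
have ss : smooth_at q (fun p => (Num.sqrt (a p))^-1).
  by apply: smooth_at_inv; [exact: smooth_at_sqrt|rewrite lt0r_neq0 // sqrtr_gt0].
suff sL (i j : 'I_(1 + n)) : smooth_at q (fun p => L p i j) by [].
case: (split_ordP i) => i' ->; case: (split_ordP j) => j' ->.
- apply: (near_eqf _ _ _ ss) => p; by rewrite /L block_mxEul !ord1 mxE eqxx.
- apply: (near_eqf _ _ _ (smooth_at_cst q 0)) => p; by rewrite /L block_mxEur mxE.
- apply: (near_eqf (fun p => - ((a p)^-1 * \sum_k (P' p i' k * b p 0 k)))).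
    move=> p; rewrite /L block_mxEdl !mxE; congr (- (_ * _)).
    by apply: eq_bigr => k _; rewrite !mxE !ord1.
  apply: smooth_atN; apply: smooth_atM => //; apply: smooth_at_sum => k.
  by apply: smooth_atM.
- apply: (near_eqf _ _ _ (sP' i' j')) => p; by rewrite /L block_mxEdr.
Unshelve. all: by end_near. Qed.

Lemma complex_kernel (R : realType) n (A K : 'M[R]_n) (r : R) (z : 'rV[R[i]]_n) :
  let u := map_mx (@complex.Re R) z in let v := map_mx (@complex.Im R) z in
  z *m (\matrix_(i, j) (A i j +i* - (r * K i j))%C) = 0 ->
  u *m A + r *: (v *m K) = 0 /\ v *m A - r *: (u *m K) = 0.
Proof.
move=> u v zD; split; apply/rowP => j.
  transitivity (Re ((0 : 'rV[R[i]]_n) 0 j)); last by rewrite !mxE.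
  rewrite -zD !mxE (raddf_sum (@complex.Re R)) /= mulr_sumr -big_split /=.
  by apply: eq_bigr => k _; rewrite !mxE; case: (z 0 k) => a b /=; ring.
transitivity (Im ((0 : 'rV[R[i]]_n) 0 j)); last by rewrite !mxE.
rewrite -zD !mxE (raddf_sum (@complex.Im R)) /= mulr_sumr -sumrB /=.
by apply: eq_bigr => k _; rewrite !mxE; case: (z 0 k) => a b /=; ring.
Qed.

Lemma posdefD (R : realType) n (Q Q' : 'M[R]_n) : posdef Q -> posdef Q' -> posdef (Q + Q').
Proof.
move=> [sQ pQ] [sQ' pQ']; split=> [|v v0]; first by rewrite linearD /= sQ sQ'.
by rewrite /quad mulmxDr mulmxDl mxE addr_gt0 ?pQ ?pQ'.
Qed.

Lemma quad_ge0 (R : realType) n (Q : 'M[R]_n) v : posdef Q -> 0 <= quad Q v.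
Proof.
move=> [_ pQ]; have [->|/pQ/ltW//] := eqVneq v 0.
by rewrite /quad mul0mx mul0mx mxE.
Qed.

(** With z = u + i v and T = Q'^-1 Q, multiply the real and imaginary parts of the kernel equation
    by T and pair them with u and v respectively. Symmetry of K T makes the terms in r cancel in the
    sum, leaving a vanishing sum of nonnegative terms that contains the values of Q at u and at
    v. *)
Lemma complex_posdef_kernel (R : realType) n (Q Q' K : 'M[R]_n) (r : R) (z : 'rV[R[i]]_n) :
  posdef Q -> posdef Q' ->
  (forall u v : 'rV[R]_n, let N := K *m (Q *m invmx Q')^T in
     (u *m N *m v^T) 0 0 = (v *m N *m u^T) 0 0) ->
  z *m (\matrix_(i, j) ((Q + Q') i j +i* - (r * K i j))%C) = 0 -> z = 0.
Proof.
move=> pQ pQ' sym /complex_kernel; set u := map_mx _ z; set v := map_mx _ z; move=> [e1 e2].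
pose T := (Q *m invmx Q')^T.
have sQ := pQ.1; have sQ' := pQ'.1; have uQ' := posdef_unit pQ'.
have TE : T = invmx Q' *m Q by rewrite /T trmx_mul trmx_inv sQ sQ'.
have QT a : (a *m (Q + Q') *m T *m a^T) 0 0 = quad Q' (a *m Q *m invmx Q') + quad Q a.
  rewrite TE /quad mulmxDr 2!mulmxDl mxE; congr ((_ : 'M[R]_1) _ _ + (_ : 'M[R]_1) _ _).
    by rewrite !trmx_mul trmx_inv sQ sQ' mulmxKV // !mulmxA.
  by rewrite -!mulmxA mulKVmx // !mulmxA.
have lin (c : R) (A B y : 'rV[R]_n) : A + c *: B = 0 ->
    (A *m T *m y^T) 0 0 + c * (B *m T *m y^T) 0 0 = 0.
  move=> E0; transitivity (((A + c *: B) *m T *m y^T) 0 0).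
    by rewrite !mulmxDl -!scalemxAl [RHS]mxE [in X in _ = _ + X]mxE.
  by rewrite E0 !mul0mx mxE.
have h1 : quad Q' (u *m Q *m invmx Q') + quad Q u + r * (v *m K *m T *m u^T) 0 0 = 0.
  by rewrite -QT; exact: lin.
have h2 : quad Q' (v *m Q *m invmx Q') + quad Q v - r * (u *m K *m T *m v^T) 0 0 = 0.
  by rewrite -QT -mulNr; apply: lin; rewrite scaleNr.
have sKT : (v *m K *m T *m u^T) 0 0 = (u *m K *m T *m v^T) 0 0.
  by have := sym v u; rewrite /= !mulmxA.
rewrite sKT in h1.
have n1 := quad_ge0 (u *m Q *m invmx Q') pQ'; have n2 := quad_ge0 (v *m Q *m invmx Q') pQ'.
have n3 := quad_ge0 u pQ; have n4 := quad_ge0 v pQ.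
have nil a : quad Q a = 0 -> a = 0.
  by move=> q0; apply/eqP; apply: contraT => /pQ.2; rewrite q0 ltxx.
have [u0 v0] : u = 0 /\ v = 0.
  by split; apply: nil; move: h1 h2 n1 n2 n3 n4;
    move: (quad _ _) (quad _ _) (quad _ _) (quad _ _) (r * _) => ? ? ? ? ? *; lra.
apply/rowP => j; have := congr1 (fun y : 'rV[R]_n => y 0 j) u0.
have := congr1 (fun y : 'rV[R]_n => y 0 j) v0; rewrite !mxE => i_0 r_0.
exact: complex_eq.
Qed.

Section LagrangianPhase.
Context {R : realType} {n : nat} (M : manifold R (2 * n)).
Variables (w I I' : M -> 'M[R]_(2 * n)).
Hypotheses (symp : symplectic w) (comp : compatible w I) (comp' : compatible w I').
Variables (x : M).
Implicit Types (E : 'M[R]_(n, 2 * n)) (J : M -> 'M[R]_(2 * n)).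

Definition lagrangian_frame E := row_free E /\ E *m w x *m E^T = 0.

Definition gram J E : 'M[R]_n := E *m w x *m (E *m J x)^T.

Definition cross E : 'M[R]_n := E *m I x *m w x *m (E *m I' x)^T.

(** The matrix Q + Q' - i r K. At r = 1 it is the matrix of Hermitian products that compares the two
    volume vectors ([herm_tangent_iso]); at r = 0 it is real and positive definite. The parameter r
    is the homotopy. *)
Definition phase_mx (r : R) E : 'M[R[i]]_n :=
  \matrix_(i, j) ((gram I E + gram I' E) i j +i* - (r * cross E i j))%C.

Lemma bil_mulmx E u v : bil w x (u *m E) (v *m E) = (u *m (E *m w x *m E^T) *m v^T) 0 0.
Proof. by rewrite /bil trmx_mul !mulmxA. Qed.

Lemma lagrangian_isotropic E u v : lagrangian_frame E -> bil w x (u *m E) (v *m E) = 0.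
Proof. by move=> [_ E0]; rewrite bil_mulmx E0 mulmx0 mul0mx mxE. Qed.

Lemma metric_mulmx J E u v : metric w J x (u *m E) (v *m E) = (u *m gram J E *m v^T) 0 0.
Proof. by rewrite /metric /bil /gram !trmx_mul !mulmxA. Qed.

Lemma gramE J E i j : gram J E i j = metric w J x (row i E) (row j E).
Proof. by rewrite /gram mulmx_tr_row !row_mul. Qed.

Lemma crossE E i j : cross E i j = bil w x (row i E *m I x) (row j E *m I' x).
Proof.
by rewrite /cross mulmx_tr_row /bil !row_mul.
Qed.

Lemma posdef_gram J E : compatible w J -> row_free E -> posdef (gram J E).
Proof.
move=> cJ fE; split=> [|v v0].
  by apply/matrixP => i j; rewrite mxE !gramE (metric_sym symp cJ).
rewrite /quad -metric_mulmx; apply: (metric_gt0 cJ).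
by apply: contraNneq v0 => vE; apply/eqP/(row_free_inj fE); rewrite vE mul0mx.
Qed.

(** A Lagrangian subspace is its own symplectic orthogonal: it is contained in it by isotropy, and
    both have dimension n since omega is nondegenerate. *)
Lemma lagrangian_orthogonal E (A : 'rV[R]_(2 * n)) : lagrangian_frame E ->
  A *m w x *m E^T = 0 -> exists v, A = v *m E.
Proof.
move=> [fE E0] A0; apply/submxP; case: symp => _ uw _ _.
pose K := kermx (w x *m E^T).
have rE : \rank E = n by apply/eqP.
have rK : \rank K = n.
  rewrite mxrank_ker -mxrank_tr trmx_mul trmxK mxrankMfree ?rE.
    by rewrite mul2n -addnn addnK.
  by rewrite row_free_unit unitmx_tr.
have EK : (E <= K)%MS by apply/sub_kermxP; rewrite mulmxA.
have [_] := mxrank_leqif_eq EK; rewrite rE rK eqxx => /esym/eqmxP KE.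
by rewrite KE; apply/sub_kermxP; rewrite mulmxA.
Qed.

(** [W v] lies in I' L and [v *m E *m I x] in I L, where L is the span of E; the factor Q Q'^-1 is
    chosen so that both have the same omega-pairings with L. Their difference [A v] then lies in L.
    The spaces L, I L and I' L are all isotropic, so expanding omega (W u, W v) = 0 leaves two cross
    terms, whose equality is the symmetry. *)
Lemma cross_symmetric E (u v : 'rV[R]_n) : lagrangian_frame E ->
  let N := cross E *m (gram I E *m invmx (gram I' E))^T in
  (u *m N *m v^T) 0 0 = (v *m N *m u^T) 0 0.
Proof.
move=> lE /=; set Q := gram I E; set Q' := gram I' E.
have uQ' : Q' \in unitmx by apply: posdef_unit; exact: posdef_gram (lE.1).
pose W (v : 'rV[R]_n) := v *m Q *m invmx Q' *m E *m I' x.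
have NE a b : (a *m (cross E *m (Q *m invmx Q')^T) *m b^T) 0 0 = bil w x (a *m E *m I x) (W b).
  by rewrite /bil /cross /W !trmx_mul !mulmxA.
pose A v := W v - v *m E *m I x.
have ortho J b j : bil w x (b *m J x) (row j E) = - metric w J x (row j E) b.
  by rewrite (bil_skew symp).
have AE b : exists v, A b = v *m E.
  apply: (lagrangian_orthogonal lE); apply/rowP => j; rewrite [in RHS]mxE.
  have -> : (A b *m w x *m E^T) 0 j = bil w x (A b) (row j E).
    by rewrite /bil mulmx_tr_row row_id.
  rewrite /A /W -[- (b *m E *m I x)]scaleN1r addrC bil_linearl !ortho rowE !metric_mulmx.
  rewrite -/Q -/Q' -[in X in _ - X]mulmxA.
  have -> : Q' *m (b *m Q *m invmx Q')^T = Q *m b^T.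
    rewrite trmx_mul trmx_inv (posdef_gram comp' lE.1).1 mulKVmx // trmx_mul.
    by rewrite (posdef_gram comp lE.1).1.
  by rewrite mulN1r opprK mulmxA subrr.
have Ab a b : bil w x (a *m E *m I x) (W b) = bil w x (a *m E *m I x) (A b).
  have -> : W b = 1 *: A b + b *m E *m I x by rewrite /A scale1r subrK.
  case: comp => _ _ inv _; rewrite bil_linearr mul1r inv (lagrangian_isotropic _ _ lE).
  by rewrite addr0.
have [[u' uE] [v' vE]] := (AE u, AE v).
rewrite !NE !Ab.
have : bil w x (W u) (W v) = 0.
  by case: comp' => _ _ inv _; rewrite /W inv lagrangian_isotropic.
have -> : W u = 1 *: A u + u *m E *m I x by rewrite /A scale1r subrK.
rewrite bil_linearl mul1r Ab.
have -> : W v = 1 *: A v + v *m E *m I x by rewrite /A scale1r subrK.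
rewrite bil_linearr mul1r {1}uE {1}vE (lagrangian_isotropic _ _ lE) add0r.
by rewrite (bil_skew symp) => /eqP; rewrite addrC subr_eq0 => /eqP.
Qed.

Lemma phase_mx_det_neq0 r E : lagrangian_frame E -> \det (phase_mx r E) != 0.
Proof.
move=> lE; rewrite -unitfE -unitmxE -row_free_unit -kermx_eq0.
apply/eqP/row_matrixP => i0; rewrite row0.
have zD := mulmx_ker (phase_mx r E); move: zD => /(congr1 (row i0)); rewrite row_mul row0.
apply: complex_posdef_kernel => [||u v]; [exact: posdef_gram lE.1|exact: posdef_gram lE.1|].
exact: cross_symmetric.
Qed.

(** Origin of [phase_mx]. Invariance of omega under I' turns the term with I I' into a value of G in
    the real part and into an entry of K in the imaginary part; isotropy removes omega (e_i,
    e_j). *)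
Lemma herm_tangent_iso E i j : lagrangian_frame E ->
  herm w I' x (row i E *m tangent_iso I I' x) (row j E) = phase_mx 1 E i j.
Proof.
move=> lE; have iso : bil w x (row i E) (row j E) = 0.
  by rewrite !rowE (lagrangian_isotropic _ _ lE).
rewrite /herm [RHS]mxE crossE mul1r /metric.
have -> : (gram I E + gram I' E) i j = gram I E i j + gram I' E i j by rewrite [LHS]mxE.
rewrite !gramE /metric.
have -> : row i E *m tangent_iso I I' x = (-1) *: (row i E *m I x *m I' x) + row i E.
  by rewrite /tangent_iso mulmxBr mulmx1 mulmxA scaleN1r addrC.
rewrite !bil_linearl !mulN1r iso addr0 opprK.
case: comp' => _ _ inv' _; rewrite inv'; congr (_ +i* _)%C.
  by rewrite (bil_skew symp x (row i E *m I x)) opprK -/(metric w I x _ _) (metric_sym symp comp).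
by rewrite -[LHS]inv' (JJ comp') bilNl.
Qed.

Lemma ext_dot_push_wedge E : lagrangian_frame E ->
  ext_dot w I' x (push (I' x) (tangent_iso I I' x) (wedge (I x) (fun i => row i E)))
    (wedge (I' x) (fun i => row i E)) = \det (phase_mx 1 E).
Proof.
move=> lE; rewrite (push_wedge (tangent_isoE comp comp' x)) (ext_dot_wedge symp comp').
by congr (\det _); apply/matrixP => i j; rewrite mxE herm_tangent_iso.
Qed.

Lemma phase_mx_change r (P : 'M[R]_n) E :
  phase_mx r (P *m E) = map_mx (real_complex R) P *m phase_mx r E *m (map_mx (real_complex R) P)^T.
Proof.
have gP J : gram J (P *m E) = P *m gram J E *m P^T.
  by rewrite /gram !trmx_mul !mulmxA.
have cP : cross (P *m E) = P *m cross E *m P^T by rewrite /cross !trmx_mul !mulmxA.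
have pE F : phase_mx r F = map_mx (real_complex R) (gram I F + gram I' F)
    + (0 +i* - r)%C *: map_mx (real_complex R) (cross F).
  by apply/matrixP => i j; rewrite !mxE; apply: complex_eq => /=; ring.
rewrite !pE !gP cP map_trmx mulmxDr mulmxDl -scalemxAr -scalemxAl -!map_mxM.
by rewrite mulmxDr mulmxDl.
Qed.

(** The change of frame enters once on each side, so the determinant is multiplied by a square. Its
    phase is thus independent of the frame and of its orientation, and is a global function on S. *)
Lemma det_phase_mx_change r (P : 'M[R]_n) E :
  \det (phase_mx r (P *m E)) = ((\det P) ^+ 2)%:C%C * \det (phase_mx r E).
Proof.
rewrite phase_mx_change !det_mulmx det_tr det_map_mx expr2 [in RHS]rmorphM /=.
by rewrite mulrAC.
Qed.

Lemma det_phase_mx0 E : lagrangian_frame E ->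
  exists2 t : R, 0 < t & \det (phase_mx 0 E) = t%:C%C.
Proof.
move=> [fE _]; exists (\det (gram I E + gram I' E)).
  by apply: posdef_det_gt0; apply: posdefD; exact: posdef_gram.
rewrite -det_map_mx; congr (\det _); apply/matrixP => i j; rewrite !mxE.
by apply: complex_eq => //=; rewrite mul0r oppr0.
Qed.

Definition lagrangian_phase r E : R[i] := cphase (\det (phase_mx r E)).

End LagrangianPhase.

Section Cphase.
Context {R : realType}.
Implicit Types z : R[i].

Lemma cphaseZ (t : R) z : 0 < t -> cphase (t%:C%C * z) = cphase z.
Proof.
move=> t0; rewrite /cphase cReM cImM /= !mul0r subr0 addr0 !exprMn -mulrDr.
rewrite sqrtrM ?sqr_ge0 // sqrtr_sqr gtr0_norm // invfM rmorphM /=.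
by rewrite mulrACA -rmorphM /= mulfV ?lt0r_neq0 // mul1r.
Qed.

Lemma cphase_normal z : z != 0 -> cphase z * (cphase z)^*%C = 1.
Proof.
move=> z0; rewrite /cphase cconjM conjc_real mulrACA normc_sqr_real -!rmorphM /=.
have := Re2Im2_gt0 z0; move: (_ + _) => s s0.
rewrite -{1}(sqr_sqrtr (ltW s0)) expr2 mulrACA mulfV ?mulr1 //.
by rewrite lt0r_neq0 // sqrtr_gt0.
Qed.

Lemma cphase_id z : z * z^*%C = 1 -> cphase z = z.
Proof.
rewrite normc_sqr_real /cphase => -[->].
by rewrite sqrtr1 invr1 mulr1.
Qed.

Lemma cphase_real (t : R) : 0 < t -> cphase t%:C%C = 1.
Proof. by move=> t0; rewrite -[t%:C%C]mulr1 cphaseZ // cphase_id // conjc1 mulr1. Qed.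

End Cphase.

(** * Restriction to the Lagrangian submanifold *)

Section LagrangianFrames.
Context {R : realType} {n : nat} (M : manifold R (2 * n)) (w : M -> 'M[R]_(2 * n)).
Variables (S : manifold R n) (iota : S -> M).
Hypotheses (symp : symplectic w) (lag : lagrangian w iota).
Implicit Types (p q : S) (c : chart S) (J : M -> 'M[R]_(2 * n)) (s t : @section R n n S).

Lemma lagrangian_smooth_map : smooth_map iota. Proof. by case: lag => -[]. Qed.
Local Notation sF := lagrangian_smooth_map.

Definition tframe c p : 'M[R]_(n, 2 * n) := \matrix_i tmap iota p (cvec c i p).

Lemma tmap_sum p (I : finType) (a : I -> R) (u : I -> 'rV[R]_n) :
  tmap iota p (\sum_i a i *: u i) = \sum_i a i *: tmap iota p (u i).
Proof.
have t0 : tmap iota p 0 = 0.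
  by have := tmap_linear sF p (-1) 0 0; rewrite scaler0 addr0 scaleN1r addNr.
elim: (index_enum _) => [|k l IH]; first by rewrite !big_nil.
by rewrite !big_cons (tmap_linear sF) IH.
Qed.

Lemma mul_tframe c p (v : 'rV[R]_n) :
  v *m tframe c p = tmap iota p (\sum_i v 0 i *: cvec c i p).
Proof.
rewrite tmap_sum mulmx_sum_row; apply: eq_bigr => i _; by rewrite rowK.
Qed.

Lemma tframe_lagrangian c p : cdom c p -> lagrangian_frame w (iota p) (tframe c p).
Proof.
case: lag => -[_ _ inj _] iso cp; split.
  rewrite -kermx_eq0; apply/eqP/row_matrixP => i; rewrite row0.
  have := mulmx_ker (tframe c p) => /(congr1 (row i)); rewrite row_mul row0.
  move: (row i _) => v; rewrite mul_tframe => /inj v0.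
  have E : ccomp c p 0 = \sum_i v 0 i *: ccomp c p (cvec c i p).
    by rewrite -[X in ccomp c p X]v0; exact: ccomp_sum.
  have E0 : ccomp c p 0 = 0.
    by have := ccomp_linear (-1) 0 0 cp; rewrite scaler0 addr0 scaleN1r addNr.
  rewrite [LHS]row_sum_delta; transitivity (\sum_i v 0 i *: ccomp c p (cvec c i p)).
    by apply: eq_bigr => j _; rewrite (ccomp_cvec j cp).
  by rewrite -E.
apply/matrixP => i j; rewrite [RHS]mxE mulmx_tr_row row_mul !rowK.
exact: iso.
Qed.

Lemma tframe_change c c' p : cdom c p -> cdom c' p ->
  exists2 P : 'M[R]_n, \det P != 0 & tframe c p = P *m tframe c' p.
Proof.
move=> cp cp'; pose P : 'M[R]_n := \matrix_i ccomp c' p (cvec c i p).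
have E : tframe c p = P *m tframe c' p.
  apply/row_matrixP => i; rewrite row_mul mul_tframe rowK [in LHS](ccompK (cvec c i p) cp').
  by congr (tmap _ _ _); apply: eq_bigr => k _; rewrite /P rowK.
exists P => //; rewrite -unitfE -unitmxE -row_free_unit -row_leq_rank.
have := (tframe_lagrangian cp).1; rewrite -row_leq_rank E => /leq_trans; apply.
exact: mxrankM_maxl.
Qed.

Lemma tframe_vf c q i : cdom c q -> smooth_vf iota q (fun p => row i (tframe c p)).
Proof.
move=> cq; apply: (near_eq_smooth_vf (X := fun p => tmap iota p (cvec c i p))).
  by near=> p; rewrite rowK.
apply: (smooth_vf_tmap sF); exact: (smooth_vf_cvec (smooth_map_id S) i cq).
Unshelve. all: by end_near. Qed.

(** The real line of K^-1 over a point of S spanned by wedges of tangent vectors of S. Hermitian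
    products of its elements are real because omega vanishes on S. *)
Definition real_vector J p (L : mvec R (2 * n) n) := exists (t : R) (v : 'I_n -> 'rV[R]_n),
  L = t%:C%C \*o wedge (J (iota p)) (fun i => tmap iota p (v i)).

Section Compatible.
Variables (J : M -> 'M[R]_(2 * n)) (cJ : compatible w J).
Local Notation hk := (hK iota w J).

Lemma hK_wedge_tmap p (u v : 'I_n -> 'rV[R]_n) :
  hk p (wedge (J (iota p)) (fun i => tmap iota p (u i)))
       (wedge (J (iota p)) (fun i => tmap iota p (v i)))
  = (\det (\matrix_(i, j) metric w J (iota p) (tmap iota p (u i)) (tmap iota p (v j))))%:C%C.
Proof.
rewrite [LHS](ext_dot_wedge symp cJ) -det_map_mx; congr (\det _).
apply/matrixP => i j; rewrite !mxE /herm lag.2 oppr0.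
exact: complex_eq.
Qed.

Lemma hK_real_vector p L L' : real_vector J p L -> real_vector J p L' ->
  exists t : R, hk p L L' = t%:C%C.
Proof.
move=> [t [u ->]] [t' [u' ->]]; rewrite hKZl (hKZr symp cJ); try exact: ext_power_wedge.
by rewrite hK_wedge_tmap conjc_real -!rmorphM; eexists.
Qed.

(* The transition function between two real unit sections is real of modulus 1. *)
Lemma ctderiv_real_unit q s t v : unit_section iota w J q s -> unit_section iota w J q t ->
  (\forall p \near q, real_vector J p (s p) /\ real_vector J p (t p)) ->
  ctderiv (fun p => hk p (s p) (t p)) q v = 0.
Proof.
move=> us ut rst; pose z p := hk p (s p) (t p).
have ss := unit_section_smooth us; have st := unit_section_smooth ut.
have sz : csmooth_at q z := csmooth_hK sF symp cJ ss st.
have cz : \forall p \near q, (z p)^*%C = z p.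
  by apply: filterS rst => p [r1 r2]; have [a za] := hK_real_vector r1 r2; rewrite /z za conjc_real.
have z1 : \forall p \near q, z p * z p = 1.
  have fr := unit_frame symp cJ ut ss.
  apply: filterS3 cz fr (filterI (near_unit_section us) (near_unit_section ut)) => p cp fp [up up'].
  have ep := unit_section_ext up'.
  rewrite -[X in _ * X]cp -[RHS](unit_section1 up) [in RHS]fp hKZl (hKZr symp cJ _ ep ep).
  by rewrite (unit_section1 up') mulr1.
have := ctderivM v sz sz; rewrite (near_ctderiv v z1) ctderiv_cst mulrC -mulrDr => /esym/eqP.
have zq := nbhs_singleton z1.
have z0 : z q != 0 by apply: contra_eq_neq zq => ->; rewrite mul0r eq_sym oner_eq0.
rewrite mulf_eq0 => /orP[/eqP //|].
by rewrite -mulr2n mulrn_eq0 (negbTE z0).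
Qed.

Definition chart_section c : @section R n n S :=
  fun p => wedge (J (iota p)) (fun i => row i (tframe c p)).

Lemma chart_section_real c p : real_vector J p (chart_section c p).
Proof.
exists 1, (fun i => cvec c i p); apply/funext => al; rewrite /= mul1r /chart_section.
by congr (wedge _ _ _); apply/funext => i; rewrite rowK.
Qed.

Lemma chart_section_smooth c q : cdom c q -> smooth_section iota J q (chart_section c).
Proof. by move=> cq; apply: smooth_section_wedge => i; exact: tframe_vf. Qed.

Lemma chart_section_gt0 c p : cdom c p -> 0 < Re (hk p (chart_section c p) (chart_section c p)).
Proof.
move=> cp; have -> : chart_section c p = wedge (J (iota p)) (fun i => tmap iota p (cvec c i p)).
  by congr wedge; apply/funext => i; rewrite rowK.
rewrite hK_wedge_tmap /=.
have := posdef_det_gt0 (posdef_gram symp (iota p) cJ (tframe_lagrangian cp).1).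
by congr (0 < \det _); apply/matrixP => i j; rewrite gramE !rowK mxE.
Qed.

(** Near q this is, up to sign, the wedge of any G-orthonormal frame of TS. Built from one chart, it
    needs no orientation; the signs may differ from one q to another. *)
Definition canonical_section q : @section R n n S := let c := chart_at q in
  fun p => ((Num.sqrt (Re (hk p (chart_section c p) (chart_section c p))))^-1)%:C%C
             \*o chart_section c p.

Lemma canonical_section_unit q : unit_section iota w J q (canonical_section q).
Proof.
have cq := cdom_chart_at q.
exact: (normalize_section sF symp cJ (chart_section_smooth cq) (chart_section_gt0 cq)).
Qed.

Lemma canonical_section_real q p : real_vector J p (canonical_section q p).
Proof.
have [t [v E]] := chart_section_real (chart_at q) p.
rewrite /canonical_section; set a := (Num.sqrt _)^-1; exists (a * t), v; rewrite E.
by apply/funext => al /=; rewrite rmorphM mulrA.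
Qed.

Lemma canonical_section_const q : \forall p \near q, forall v,
  ctderiv (fun x => hk x (canonical_section p x) (canonical_section q x)) p v = 0.
Proof.
apply: filterS (near_unit_section (canonical_section_unit q)) => p up v.
apply: (ctderiv_real_unit v (canonical_section_unit p) up).
by apply: nearW => x; split; exact: canonical_section_real.
Qed.

Lemma wedge_orthonormal q (e : 'I_n -> S -> 'rV[R]_n) :
  (forall i, smooth_vf (fun x : S => x) q (e i)) ->
  (\forall p \near q, forall i j,
     metric w J (iota p) (tmap iota p (e i p)) (tmap iota p (e j p)) = (i == j)%:R) ->
  unit_section iota w J q (fun p => wedge (J (iota p)) (fun i => tmap iota p (e i p))).
Proof.
move=> se oe.
have ss : smooth_section iota J q (fun p => wedge (J (iota p)) (fun i => tmap iota p (e i p))).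
  by apply: smooth_section_wedge => i; exact: (smooth_vf_tmap sF (se i)).
apply: filterS2 (near_smooth_section sF ss) oe => p sp op; split=> //.
rewrite hK_wedge_tmap; set A := \matrix_(_, _) _.
have -> : A = 1%:M by apply/matrixP => i j; rewrite !mxE op.
by rewrite det1.
Qed.

Lemma wedge_tmap_real p (v : 'I_n -> 'rV[R]_n) :
  real_vector J p (wedge (J (iota p)) (fun i => tmap iota p (v i))).
Proof. by exists 1, v; apply/funext => al /=; rewrite mul1r. Qed.

(** A_0 is realised as the connection d in the canonical sections, with connection form 0. An
    oriented orthonormal frame wedges to a real unit section, so its transition function to the
    canonical one has zero differential. *)
Lemma canonical_trivial_framed :
  canonical_trivial w iota J (framed_connection iota w J canonical_section (fun _ _ => 0)).
Proof.
split.
  apply: (framed_connection_hermitian sF symp cJ).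
  - exact: canonical_section_unit.
  - exact: canonical_section_const.
  - by move=> *; rewrite mulr0 addr0.
  - by move=> *; rewrite conjc0 oppr0.
  - by move=> q X _; exact: csmooth_at_cst.
move=> o q e _ se oe v; have oe' : \forall p \near q, forall i j,
    metric w J (iota p) (tmap iota p (e i p)) (tmap iota p (e j p)) = (i == j)%:R.
  by apply: filterS oe => p [].
rewrite /framed_connection
  (ctderiv_real_unit v (wedge_orthonormal se oe') (canonical_section_unit q)).
  by apply/funext => al /=; rewrite mulr0 addr0 mul0r.
by apply: nearW => p; split; [exact: wedge_tmap_real|exact: canonical_section_real].
Qed.

(** [canonical_trivial] constrains A_0 only through orthonormal frames, so a smooth one must exist
    near each point: it is the coordinate frame corrected by the Cholesky factor of its Gram
    matrix. *)
Lemma exists_orthonormal_frame q : exists e : 'I_n -> S -> 'rV[R]_n,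
  [/\ forall i, smooth_vf (fun x : S => x) q (e i), \det (frame_mx e q) != 0 &
   \forall p \near q, forall i j,
     metric w J (iota p) (tmap iota p (e i p)) (tmap iota p (e j p)) = (i == j)%:R].
Proof.
have cq := cdom_chart_at q; set c := chart_at q in cq.
have sQ i j : smooth_at q (fun p => gram w (iota p) J (tframe c p) i j).
  apply: (near_eq_smooth_at (f := fun p =>
    metric w J (iota p) (row i (tframe c p)) (row j (tframe c p)))).
    by apply: nearW => p; rewrite gramE.
  by apply: (smooth_at_bil sF symp); [|apply: (smooth_vf_J sF cJ)]; exact: tframe_vf.
have pQ : \forall p \near q, posdef (gram w (iota p) J (tframe c p)).
  by apply: filterS (near_cdom cq) => p cp; exact: (posdef_gram symp (iota p) cJ (tframe_lagrangian cp).1).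
have [P [sP PQP]] := cholesky pQ sQ.
exists (fun i p => \sum_j P p i j *: cvec c j p); split.
- move=> i; apply: (smooth_vf_sum (smooth_map_id S)) => j; first exact: sP.
  exact: (smooth_vf_cvec (smooth_map_id S) j cq).
- have -> : frame_mx (fun i p => \sum_j P p i j *: cvec c j p) q = P q.
    apply/matrixP => i j; rewrite mxE summxE (bigD1 j) //= big1.
      by rewrite cvec_chart_at !mxE !eqxx mulr1 addr0.
    by move=> k kj; rewrite cvec_chart_at !mxE eqxx eq_sym (negbTE kj) mulr0.
  have := congr1 determinant (nbhs_singleton PQP); rewrite !det_mulmx det1.
  by move=> E; apply: contra_eq_neq E => ->; rewrite !mul0r eq_sym oner_eq0.
apply: filterS PQP => p E i j.
have rE k : tmap iota p (\sum_l P p k l *: cvec c l p) = row k (P p) *m tframe c p.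
  by rewrite mul_tframe; congr tmap; apply: eq_bigr => l _; rewrite mxE.
rewrite !rE metric_mulmx -row_mul -mulmx_tr_row E mxE.
by [].
Qed.

(** The entries of [frame_mx e p] refer to [chart_at p] and need not be continuous in p. The
    components [C p] in one fixed chart are continuous, and [frame_mx e p] divides [C p], so its
    determinant inherits nonvanishing. *)
Lemma frame_mx_near q (e : 'I_n -> S -> 'rV[R]_n) :
  (forall i, smooth_vf (fun x : S => x) q (e i)) -> \det (frame_mx e q) != 0 ->
  \forall p \near q, \det (frame_mx e p) != 0.
Proof.
move=> se d0; have cq := cdom_chart_at q; set c := chart_at q in cq.
pose C p : 'M[R]_n := \matrix_i ccomp c p (e i p).
have CE p : cdom c p -> C p = frame_mx e p *m \matrix_k ccomp c p (delta_mx 0 k).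
  move=> cp; apply/row_matrixP => i; rewrite rowK row_mul mulmx_sum_row.
  rewrite [in LHS](row_sum_delta (e i p)) (ccomp_sum (fun k => e i p 0 k) _ cp).
  by apply: eq_bigr => k _; rewrite [row k _]rowK [in RHS]mxE [in RHS]mxE.
have Cq : C q = frame_mx e q.
  apply/matrixP => i j; rewrite !mxE (ccompE _ _ cq).
  exact: tderiv_cmap_chart_at.
have sC : csmooth_at q (fun p => \det (map_mx (real_complex R) (C p))).
  apply: csmooth_at_det => i j; apply: (eq_csmooth_at (f := fun p => (ccomp c p (e i p) 0 j)%:C%C)).
    by move=> p; rewrite !mxE.
  by apply: csmooth_at_real; exact: se.
have n0 : \det (map_mx (real_complex R) (C q)) != 0.
  by rewrite det_map_mx Cq fmorph_eq0.
apply: filterS2 (near_cdom cq) (near_neq0 sC n0) => p cp.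
by rewrite det_map_mx fmorph_eq0 (CE p cp) det_mulmx mulf_eq0 negb_or => /andP[].
Qed.

(** When a frame is negatively oriented, the orientation is reversed instead of the frame;
    [canonical_trivial] quantifies over all orientations, and this also covers n = 0, where there is
    no vector to change. *)
Lemma orientation_opposite o : orientation o -> orientation (fun q : S => ~~ o q).
Proof.
move=> Ho q e se d0; apply: filterS2 (Ho q e se d0) (frame_mx_near se d0) => p.
have opp x : \det (frame_mx e x) != 0 -> oriented (fun q => ~~ o q) e x <-> ~ oriented o e x.
  move=> dx; rewrite /oriented signrN mulNr oppr_gt0; set a := _ * _.
  have a0 : a != 0 by rewrite mulf_neq0 // signr_eq0.
  by rewrite lt_neqAle a0 /= leNgt; split => [/negP//|/negP].
by move=> E dp; rewrite (opp p dp) (opp q d0); split=> H /E.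
Qed.

Lemma canonical_trivial_parallel A0 q v : orientable S -> canonical_trivial w iota J A0 ->
  A0 (canonical_section q) q v = (fun=> 0).
Proof.
case=> o0 Ho0; case=> hA cA; have [e [se d0 oe]] := exists_orthonormal_frame q.
have [dir Ho oq] : exists2 dir, orientation dir & oriented dir e q.
  have [h|h] := pselect (oriented o0 e q); first by exists o0.
  exists (fun q => ~~ o0 q); first exact: orientation_opposite.
  rewrite /oriented signrN mulNr oppr_gt0; move: h; rewrite /oriented => /negP.
  by rewrite -leNgt le_eqVlt mulf_eq0 signr_eq0 (negbTE d0).
have oeq : \forall p \near q, oriented dir e p /\ forall i j,
    metric w J (iota p) (tmap iota p (e i p)) (tmap iota p (e j p)) = (i == j)%:R.
  by apply: filterS2 (Ho q e se d0) oe => p [_ h] h'; split=> //; exact: h.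
have A0e := cA dir q e Ho se oeq v.
have ue := wedge_orthonormal se oe; have uc := canonical_section_unit q.
rewrite (conn_frame sF symp cJ hA v ue (unit_section_smooth uc)).
rewrite /conn_form A0e (ctderiv_real_unit v uc ue).
  by apply/funext => al; rewrite /= add0r -/(ext_dot _ _ _ _ _) /ext_dot /ext_herm mulr0 mul0r.
by apply: nearW => p; split; [exact: canonical_section_real|exact: wedge_tmap_real].
Qed.

End Compatible.

End LagrangianFrames.

Section ComplexContinuity.
Context {R : realType} {T : topologicalType} (y : T).
Implicit Types f g : T -> R[i].

Definition ccontinuous_at f := {for y, continuous (fun x => Re (f x))} /\
  {for y, continuous (fun x => Im (f x))}.

Lemma near_eq_ccontinuous f g : (\forall x \near y, f x = g x) ->
  ccontinuous_at f -> ccontinuous_at g.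
Proof.
move=> E [cr ci]; split.
  by apply: near_continuous cr; apply: filterS E => x ->.
by apply: near_continuous ci; apply: filterS E => x ->.
Qed.

Lemma ccontinuous_cst a : ccontinuous_at (fun=> a).
Proof. by split; exact: cvg_cst. Qed.

Lemma ccontinuousD f g : ccontinuous_at f -> ccontinuous_at g ->
  ccontinuous_at (fun x => f x + g x).
Proof.
move=> [fr fi] [gr gi]; split.
  apply: (near_continuous (f := fun x => Re (f x) + Re (g x))); last exact: cvgD.
  by apply: nearW => x; rewrite cReD.
apply: (near_continuous (f := fun x => Im (f x) + Im (g x))); last exact: cvgD.
by apply: nearW => x; rewrite cImD.
Qed.

Lemma ccontinuousM f g : ccontinuous_at f -> ccontinuous_at g ->
  ccontinuous_at (fun x => f x * g x).
Proof.
move=> [fr fi] [gr gi]; split.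
  apply: (near_continuous (f := fun x => Re (f x) * Re (g x) - Im (f x) * Im (g x))).
    by apply: nearW => x; rewrite cReM.
  by apply: cvgB; exact: cvgM.
apply: (near_continuous (f := fun x => Re (f x) * Im (g x) + Im (f x) * Re (g x))).
  by apply: nearW => x; rewrite cImM.
by apply: cvgD; exact: cvgM.
Qed.

Lemma ccontinuous_conj f : ccontinuous_at f -> ccontinuous_at (fun x => (f x)^*%C).
Proof.
move=> [fr fi]; split.
  by apply: (near_continuous (f := fun x => Re (f x))) => //; apply: nearW => x; case: (f x).
apply: (near_continuous (f := fun x => - Im (f x))); last exact: cvgN.
by apply: nearW => x; case: (f x).
Qed.

Lemma ccontinuous_det n (A : T -> 'M[R[i]]_n) :
  (forall i j, ccontinuous_at (fun x => A x i j)) -> ccontinuous_at (fun x => \det (A x)).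
Proof.
move=> cA; rewrite /determinant; elim: (index_enum _) => [|s l IH].
  by apply: near_eq_ccontinuous (ccontinuous_cst 0); apply: nearW => x; rewrite big_nil.
apply: (near_eq_ccontinuous (f := fun x => (-1) ^+ s * (\prod_i A x i (s i)) +
   \sum_(s <- l) (-1) ^+ s * \prod_i A x i (s i))).
  by apply: nearW => x; rewrite big_cons.
apply: ccontinuousD IH; apply: ccontinuousM; first exact: ccontinuous_cst.
elim: (index_enum _) => [|i k IH'].
  by apply: near_eq_ccontinuous (ccontinuous_cst 1); apply: nearW => x; rewrite big_nil.
apply: (near_eq_ccontinuous (f := fun x => A x i (s i) * \prod_(i <- k) A x i (s i))).
  by apply: nearW => x; rewrite big_cons.
exact: ccontinuousM.
Qed.

Lemma ccontinuous_phase f : ccontinuous_at f -> f y != 0 -> ccontinuous_at (fun x => cphase (f x)).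
Proof.
move=> cf f0; apply: ccontinuousM => //; split; last exact: cvg_cst.
rewrite /=; have [fr fi] := cf.
have s0 : Num.sqrt (Re (f y) ^+ 2 + Im (f y) ^+ 2) != 0.
  by rewrite lt0r_neq0 // sqrtr_gt0; exact: Re2Im2_gt0.
apply: (@cvgV _ _ _ _ _ _ s0); apply: continuous_comp; last exact: sqrt_continuous.
by apply: cvgD; apply: cvgM.
Qed.

End ComplexContinuity.

(** * The phase of Phi between the canonical sections over S *)

Section CanonicalPhase.
Context {R : realType} {n : nat} (M : manifold R (2 * n)) (w : M -> 'M[R]_(2 * n)).
Variables (S : manifold R n) (iota : S -> M) (I I' : M -> 'M[R]_(2 * n)).
Hypotheses (symp : symplectic w) (lag : lagrangian w iota).
Hypotheses (comp : compatible w I) (comp' : compatible w I').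
Implicit Types (p q : S) (c : chart S) (r : R).

Local Notation sF := (lagrangian_smooth_map lag).
Local Notation Phi := (bundle_map iota symp comp comp').
Local Notation cs := (canonical_section w iota I).
Local Notation cs' := (canonical_section w iota I').

Definition chart_phase c r p := lagrangian_phase w I I' (iota p) r (tframe iota c p).

Definition phase r p : R[i] := chart_phase (chart_at p) r p.

Lemma chart_phase_neq0 c r p : cdom c p -> \det (phase_mx w I I' (iota p) r (tframe iota c p)) != 0.
Proof.
by move=> cp; exact: (phase_mx_det_neq0 symp comp comp' r (tframe_lagrangian lag cp)).
Qed.

Lemma chart_phaseE c r p : cdom c p -> chart_phase c r p = phase r p.
Proof.
move=> cp; have [P P0 E] := tframe_change lag cp (cdom_chart_at p).
rewrite /phase /chart_phase /lagrangian_phase E det_phase_mx_change cphaseZ //.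
by rewrite exprn_even_gt0.
Qed.

Lemma phase_normal r p : phase r p * (phase r p)^*%C = 1.
Proof. by apply: cphase_normal; apply: chart_phase_neq0; exact: cdom_chart_at. Qed.

Lemma phase0 p : phase 0 p = 1.
Proof.
have [t t0 E] := det_phase_mx0 symp comp comp' (tframe_lagrangian lag (cdom_chart_at p)).
by rewrite /phase /chart_phase /lagrangian_phase E cphase_real.
Qed.

(** The product has modulus 1, as Phi is unitary, and it is a positive multiple of det ([phase_mx]
    at r = 1), the factor coming from the normalisations of Phi and of the two sections. A number of
    modulus 1 is its own phase. *)
Lemma hK_bundle_map_canonical q p :
  cdom (chart_at q) p -> unit_section iota w I p (cs q) -> unit_section iota w I' p (cs' q) ->
  hK iota w I' p (Phi p (cs q p)) (cs' q p) = phase 1 p.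
Proof.
move=> cp up up'; rewrite -(chart_phaseE 1 cp) /chart_phase /lagrangian_phase.
have ep := unit_section_ext up; have ep' := unit_section_ext up'.
have ew := ext_power_wedge (I' (iota p)) (fun i => row i (tframe iota (chart_at q) p)).
have ePe := bundle_map_ext symp comp comp' ep.
set z := hK _ _ _ _ _ _.
have z1 : z * z^*%C = 1.
  rewrite -(hK_conj symp comp' ePe ep').
  have := hK_bundle_map symp comp comp' ep ep; rewrite (unit_section1 up) => <-.
  rewrite [in RHS](hK_unit symp comp' ePe ep' (unit_section1 up')) hKZl.
  rewrite (hKZr symp comp' _ ep' ep') (unit_section1 up') mulr1.
  by rewrite -/z (hK_conj symp comp' ePe ep').
have [t t0 zE] : exists2 t : R, 0 < t &
    z = t%:C%C * \det (phase_mx w I I' (iota p) 1 (tframe iota (chart_at q) p)).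
  have g0 := chart_section_gt0 symp lag comp cp; have g0' := chart_section_gt0 symp lag comp' cp.
  rewrite /z /canonical_section bundle_mapZ hKZl (hKZr symp comp' _ _ ew); last first.
    exact: (bundle_map_ext symp comp comp' (ext_power_wedge _ _)).
  rewrite /bundle_map hKZl conjc_real.
  rewrite [hK _ _ _ _ (pushF _ _ _ _ _) _](ext_dot_push_wedge symp comp comp' (tframe_lagrangian lag cp)).
  rewrite !mulrA -!rmorphM /=; eexists; last by [].
  by rewrite 2?mulr_gt0 ?invr_gt0 ?sqrtr_gt0 ?pushnorm_gt0.
by rewrite -(cphase_id z1) zE cphaseZ.
Qed.

Lemma bundle_map_canonical q : \forall p \near q, Phi p (cs q p) = phase 1 p \*o cs' q p.
Proof.
have cq := cdom_chart_at q.
have u := canonical_section_unit symp lag comp q; have u' := canonical_section_unit symp lag comp' q.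
apply: filterS3 (near_cdom cq) (near_unit_section u) (near_unit_section u') => p cp up up'.
rewrite -(hK_bundle_map_canonical cp up up').
apply: (hK_unit symp comp' _ (unit_section_ext up') (unit_section1 up')).
exact: (bundle_map_ext symp comp comp' (unit_section_ext up)).
Qed.

(** Smoothness at r = 1 is read off the Hermitian product of two smooth sections; for other r only
    joint continuity is established. *)
Lemma csmooth_phase q : csmooth_at q (phase 1).
Proof.
have cq := cdom_chart_at q.
have u := canonical_section_unit symp lag comp q; have u' := canonical_section_unit symp lag comp' q.
have sm := csmooth_hK sF symp comp'
  (unit_section_smooth (unit_section_bundle_map sF symp comp comp' u)) (unit_section_smooth u').
apply: near_eq_csmooth_at sm.
apply: filterS3 (near_cdom cq) (near_unit_section u) (near_unit_section u') => p cp up up'.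
exact: hK_bundle_map_canonical.
Qed.

Lemma phase_continuous q r : ccontinuous_at (q, r) (fun y : S * R => phase y.2 y.1).
Proof.
have cq := cdom_chart_at q; set c := chart_at q in cq.
have cfst : continuous (@fst S R) by move=> y; exact: cvg_fst.
have cont f : smooth_at q f -> {for (q, r), continuous (fun y : S * R => f y.1)}.
  move=> sf; apply: continuous_comp; first exact: cfst.
  exact: smooth_at_continuous.
have vf i : smooth_vf iota q (fun p => row i (tframe iota c p)) by exact: (tframe_vf lag i cq).
have sg J i j : compatible w J -> smooth_at q (fun p => gram w (iota p) J (tframe iota c p) i j).
  move=> cJ; apply: (near_eq_smooth_at (f := fun p =>
    metric w J (iota p) (row i (tframe iota c p)) (row j (tframe iota c p)))).
    by apply: nearW => p; rewrite gramE.
  by apply: (smooth_at_bil sF symp) => //; exact: (smooth_vf_J sF cJ).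
have sK i j : smooth_at q (fun p => cross w I I' (iota p) (tframe iota c p) i j).
  apply: (near_eq_smooth_at (f := fun p => bil w (iota p)
     (row i (tframe iota c p) *m I (iota p)) (row j (tframe iota c p) *m I' (iota p)))).
    by apply: nearW => p; rewrite crossE.
  by apply: (smooth_at_bil sF symp); [exact: (smooth_vf_J sF comp)|exact: (smooth_vf_J sF comp')].
apply: (near_eq_ccontinuous (f := fun y : S * R => chart_phase c y.2 y.1)).
  have n1 : \forall y \near (q, r), cdom c (fst y) by apply: (near_comp (cfst (q, r))); exact: near_cdom.
  by apply: filterS n1 => y cy; exact: chart_phaseE.
apply: ccontinuous_phase; last exact: chart_phase_neq0.
have ext (f g : S * R -> R) : f =1 g -> {for (q, r), continuous f} -> {for (q, r), continuous g}.
  by move=> /funext ->.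
have contD (f g : S * R -> R) : {for (q, r), continuous f} -> {for (q, r), continuous g} ->
    {for (q, r), continuous (fun y => f y + g y)}.
  by move=> cf cg; exact: (cvgD cf cg).
have contNM (f g : S * R -> R) : {for (q, r), continuous f} -> {for (q, r), continuous g} ->
    {for (q, r), continuous (fun y => - (f y * g y))}.
  by move=> cf cg; exact: (cvgN (cvgM cf cg)).
apply: ccontinuous_det => i j; split.
  apply: (ext (fun y : S * R => gram w (iota y.1) I (tframe iota c y.1) i j
     + gram w (iota y.1) I' (tframe iota c y.1) i j)).
    by move=> y; rewrite [in RHS]mxE /= [in RHS]mxE.
  exact: (contD _ _ (cont _ (sg I i j comp)) (cont _ (sg I' i j comp'))).
apply: (ext (fun y : S * R => - (y.2 * cross w I I' (iota y.1) (tframe iota c y.1) i j))).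
  by move=> y; rewrite [in RHS]mxE.
apply: contNM; first by move=> A nA; exact: (cvg_snd nA).
exact: (cont _ (sK i j)).
Qed.

End CanonicalPhase.

Lemma cconjK (R : rcfType) (x : R[i]) : x^*%C^*%C = x.
Proof. by case: x => u v /=; rewrite opprK. Qed.

Section Unimodular.
Context {R : realType} {d : nat} (N : manifold R d).
Implicit Types (q : N) (z : N -> R[i]) (v : 'rV[R]_d).

Lemma normc1P (z : R[i]) : `|z| = 1 <-> z * z^*%C = 1.
Proof.
rewrite -sqr_normc; split=> [->|/eqP]; first by rewrite expr1n.
by rewrite pexprn_eq1 // => /eqP.
Qed.

Lemma unimodular_neq0 (z : R[i]) : z * z^*%C = 1 -> z != 0.
Proof. by move=> z1; apply: contra_eq_neq z1 => ->; rewrite mul0r eq_sym oner_eq0. Qed.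

Lemma unimodularV (z : R[i]) : z * z^*%C = 1 -> z^-1 = z^*%C.
Proof. by move=> z1; apply: (mulfI (unimodular_neq0 z1)); rewrite z1 mulfV // unimodular_neq0. Qed.

(** Differentiating z times its conjugate, which is constantly 1: the form z^-1 dz is imaginary. *)
Lemma ctderiv_unimodular q z v : csmooth_at q z ->
  (\forall p \near q, z p * (z p)^*%C = 1) ->
  z q * (ctderiv z q v)^*%C = - ((z q)^*%C * ctderiv z q v).
Proof.
move=> sz z1; have := ctderivM v sz (csmooth_at_conj sz).
rewrite (near_ctderiv v z1) ctderiv_cst (ctderiv_conj v sz) => /esym/eqP.
by rewrite addr_eq0 mulrC => /eqP ->; rewrite mulrC.
Qed.

End Unimodular.

Section Pullback.
Context {R : realType} {d n : nat} (N : manifold R d) (M : manifold R (2 * n)).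
Variables (F : N -> M) (sF : smooth_map F) (w J : M -> 'M[R]_(2 * n)).

Lemma near_pullback q (P : set M) : (\forall x \near F q, P x) -> \forall p \near q, P (F p).
Proof. by apply: near_comp; exact: sF.1. Qed.

Lemma smooth_section_pullback q (s : @section R n (2 * n) M) :
  smooth_section (fun x : M => x) J (F q) s -> smooth_section F J q (s \o F).
Proof.
move=> [X [f [HX Hf Hs]]]; exists (fun i p => X i (F p)), (f \o F); split.
- move=> i c cq k; exact: (smooth_at_comp sF (HX i c cq k)).
- exact: (csmooth_at_comp sF Hf).
- by apply: (near_pullback (P := fun x => s x = f x \*o wedge (J x) (fun i => X i x))).
Qed.

Lemma unit_section_pullback q (e : @section R n (2 * n) M) :
  unit_section (fun x : M => x) w J (F q) e -> unit_section F w J q (e \o F).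
Proof.
move=> /near_pullback; apply: filterS => p [se e1]; split=> //.
exact: smooth_section_pullback.
Qed.

(** [pushnorm] is extracted from an existence proof. For [F] at [q] and for the identity at [F q]
    the existence statements coincide, so only the two proofs remain to be identified. *)
Lemma bundle_map_pullback (I : M -> 'M[R]_(2 * n)) (symp : symplectic w)
  (comp : compatible w I) (comp' : compatible w J) q L :
  bundle_map F symp comp comp' q L = bundle_map (fun x : M => x) symp comp comp' (F q) L.
Proof.
rewrite /bundle_map; congr (_ \*o _); congr (_^-1%:C%C); congr (Num.sqrt _).
rewrite /pushnorm; congr (sval (cid _)); exact: Prop_irrelevance.
Qed.

End Pullback.

(** * From a gauge transformation for (I, a) to one for (I', a') *)

Section GaugeTransfer.
Context {R : realType} {n : nat} (M : manifold R (2 * n)) (w : M -> 'M[R]_(2 * n)).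
Variables (S : manifold R n) (iota : S -> M) (I I' : M -> 'M[R]_(2 * n)).
Hypotheses (symp : symplectic w) (lag : lagrangian w iota) (ori : orientable S).
Hypotheses (comp : compatible w I) (comp' : compatible w I').
Variables (k : R) (a a' : @connection R n (2 * n) M).
Hypothesis ref' : reference_connection w k I' a'.
Variable f : M -> R.
Hypothesis sf : forall x, smooth_at x f.

Local Notation id := (fun x : M => x).
Local Notation sF := (lagrangian_smooth_map lag).
Local Notation Phi := (bundle_map iota symp comp comp').
Local Notation cs := (canonical_section w iota I).
Local Notation cs' := (canonical_section w iota I').

Hypothesis f_gauge : forall x e v, unit_section id w I x e ->
  conn_form id w I' a' (fun y => expi (- f y) \*o bundle_map id symp comp comp' y (e y)) x v
    = conn_form id w I a e x v.

(* [gauge_change 0 = 1], so that [gauge_change r] is a homotopy of [gauge_change 1] to 1. *)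
Definition gauge_change (r : R) (p : S) : R[i] :=
  expi (- (r * f (iota p))) * phase w iota I I' r p.

Lemma expi_normal (t : R) : expi t * (expi t)^*%C = 1.
Proof. by rewrite normc_sqr_real /= cos2Dsin2. Qed.

Lemma gauge_change_normal r p : gauge_change r p * (gauge_change r p)^*%C = 1.
Proof.
rewrite /gauge_change cconjM mulrACA expi_normal mul1r.
exact: (phase_normal symp lag comp comp').
Qed.

Lemma csmooth_gauge_change q : csmooth_at q (gauge_change 1).
Proof.
apply: csmooth_atM; last exact: (csmooth_phase symp lag comp comp').
apply: csmooth_at_expi; apply: smooth_atN; apply: smooth_atM; first exact: smooth_at_cst.
exact: (smooth_at_comp sF (sf (iota q))).
Qed.

Variable g : S -> R[i].
Hypotheses (sg : forall q, csmooth_at q g) (g1 : forall q, g q * (g q)^*%C = 1).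

(** With u = [gauge_change 1], the map exp(- i f) Phi sends the canonical section for I to u times
    the one for I'. In the latter frame the connection form g^-1 dg becomes g^-1 dg - u^-1 du, which
    is the form of g u^-1; the conjugate of u is its inverse. *)
Definition changed_gauge (p : S) : R[i] := g p * (gauge_change 1 p)^*%C.

Lemma changed_gauge_normal p : changed_gauge p * (changed_gauge p)^*%C = 1.
Proof.
rewrite /changed_gauge (cconjM (g p)) cconjK mulrACA g1 mul1r mulrC; exact: gauge_change_normal.
Qed.

Lemma csmooth_changed_gauge q : csmooth_at q changed_gauge.
Proof. by apply: csmooth_atM => //; apply: csmooth_at_conj; exact: csmooth_gauge_change. Qed.

Definition changed_form (q : S) (v : 'rV[R]_n) : R[i] :=
  (changed_gauge q)^-1 * ctderiv changed_gauge q v.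

Lemma changed_formE q v : changed_form q v
  = (g q)^-1 * ctderiv g q v - (gauge_change 1 q)^*%C * ctderiv (gauge_change 1) q v.
Proof.
have sk := csmooth_gauge_change q; have k1 := gauge_change_normal 1.
rewrite /changed_form (unimodularV (changed_gauge_normal q)) (unimodularV (g1 q)).
rewrite /changed_gauge cconjM cconjK (ctderivM v (sg q) (csmooth_at_conj sk)) (ctderiv_conj v sk).
have nk : \forall p \near q, gauge_change 1 p * (gauge_change 1 p)^*%C = 1 by exact: nearW.
rewrite -(ctderiv_unimodular v sk nk) mulrDr mulrACA (mulrC _ (g q)) g1 mul1r addrC.
by rewrite mulrACA k1 mulr1.
Qed.

(** By construction this connection differs from A_0 by the logarithmic derivative of
    [changed_gauge]. What remains is to see that it is the restriction of a' to S. *)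
Let b' := framed_connection iota w I' cs' changed_form.

Lemma changed_connection_hermitian : hermitian_connection iota w I' b'.
Proof.
apply: (framed_connection_hermitian sF symp comp').
- exact: canonical_section_unit.
- exact: canonical_section_const.
- move=> q r u v; rewrite /changed_form (ctderiv_linear r u v (csmooth_changed_gauge q)).
  by rewrite mulrDr mulrCA.
- move=> q v; rewrite /changed_form (unimodularV (changed_gauge_normal q)) cconjM cconjK.
  apply: (ctderiv_unimodular v (csmooth_changed_gauge q)).
  by apply: nearW; exact: changed_gauge_normal.
- move=> q X sX; apply: csmooth_atM.
    apply: csmooth_at_inv; first exact: csmooth_changed_gauge.
    exact: (unimodular_neq0 (changed_gauge_normal q)).
  exact: (csmooth_at_ctderiv sX (csmooth_changed_gauge q)).
Qed.

Variables (b A0 : @connection R n n S).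
Hypotheses (res : restriction w iota I a b) (can : canonical_trivial w iota I A0).
Hypothesis rel : forall q s v, smooth_section iota I q s ->
  b s q v = A0 s q v \+ (((g q)^-1 * ctderiv g q v) \*o s q).

(** Over S, exp(- i f) Phi carries b to b'. Writing e as z times the canonical section for I, its
    image is z u times the one for I', with u = [gauge_change 1]; the term u^-1 du from the new
    frame cancels the one subtracted in [changed_formE]. *)
Lemma conn_form_transfer q e v : unit_section id w I (iota q) e ->
  conn_form iota w I' b'
    (fun p => expi (- f (iota p)) \*o Phi p (e (iota p))) q v
  = conn_form iota w I b (e \o iota) q v.
Proof.
move=> ue; have ue' := unit_section_pullback sF ue; have se' := unit_section_smooth ue'.
have uc := canonical_section_unit symp lag comp q; have sc := unit_section_smooth uc.
have uc' := canonical_section_unit symp lag comp' q.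
pose z p := hK iota w I p (e (iota p)) (cs q p).
have sz : csmooth_at q z := csmooth_hK sF symp comp se' sc.
have E : \forall p \near q, e (iota p) = z p \*o cs q p := unit_frame symp comp uc se'.
have z1 : \forall p \near q, z p * (z p)^*%C = 1.
  apply: filterS3 E (near_unit_section ue') (near_unit_section uc) => p Ep up up'.
  have ep := unit_section_ext up'.
  rewrite -[RHS](unit_section1 up) /= Ep hKZl (hKZr symp comp _ ep ep).
  by rewrite (unit_section1 up') mulr1.
have cb : conn_form iota w I b (cs q) q v = (g q)^-1 * ctderiv g q v.
  rewrite /conn_form (rel v sc) (canonical_trivial_parallel symp lag comp q v ori can).
  by rewrite hKDl hKZl (unit_section1 uc) mulr1; exact: add0r.
have cb' : conn_form iota w I' b' (cs' q) q v = changed_form q v.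
  rewrite /conn_form hKZl (near_ctderiv v (g := fun=> 1)).
    by rewrite ctderiv_cst (unit_section1 uc') mulr1 mul1r add0r.
  by apply: filterS (near_unit_section uc') => p; exact: unit_section1.
have hb := res.1; have hb' := changed_connection_hermitian.
have szk := csmooth_atM sz (csmooth_gauge_change q).
have zk1 : \forall p \near q, z p * gauge_change 1 p * (z p * gauge_change 1 p)^*%C = 1.
  by apply: filterS z1 => p zp; rewrite cconjM mulrACA zp gauge_change_normal mulr1.
have E' : \forall p \near q, expi (- f (iota p)) \*o Phi p (e (iota p))
    = (z p * gauge_change 1 p) \*o cs' q p.
  apply: filterS2 E (bundle_map_canonical symp lag comp comp' q) => p -> Bp.
  rewrite bundle_mapZ Bp /gauge_change mul1r; apply/funext => al /=.
  by move: (expi _) (z p) (phase _ _ _ _ _ _) (cs' q p al) => x1 x2 x3 x4; ring.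
have uz := unit_section_phase symp comp sz z1 uc.
have uzk := unit_section_phase symp comp' szk zk1 uc'.
rewrite (conn_form_near v hb se' (unit_section_smooth uz) E).
rewrite (conn_form_near v hb' _ (unit_section_smooth uzk) E'); last first.
  apply: (near_eq_smooth_section _ (unit_section_smooth uzk)).
  by apply: filterS E' => p ->.
rewrite (conn_form_phase symp comp sz z1 v hb uc) cb.
rewrite (conn_form_phase symp comp' szk zk1 v hb' uc') cb' changed_formE.
rewrite (ctderivM v sz (csmooth_gauge_change q)) cconjM.
have := nbhs_singleton z1; have := gauge_change_normal 1 q.
move: (z q) (gauge_change 1 q) (ctderiv z q v) (ctderiv (gauge_change 1) q v) (_^-1 * _).
move=> y u dy du x u1 y1; rewrite mulrDr.
have -> : y^*%C * u^*%C * (y * du) = (y * y^*%C) * (u^*%C * du) by ring.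
have -> : y^*%C * u^*%C * (dy * u) = (u * u^*%C) * (y^*%C * dy) by ring.
by rewrite y1 u1 !mul1r; ring.
Qed.

(** It suffices to compare connection forms in one unit frame [eps] = exp(- i f) Phi e near iota q.
    There the form of a' equals that of a in e, which restricts to that of b, which equals that of
    b' by [conn_form_transfer]. *)
Lemma changed_restriction : restriction w iota I' a' b'.
Proof.
split=> [|q s v ss]; first exact: changed_connection_hermitian.
have hb' := changed_connection_hermitian.
have [e ue] := exists_unit_section (smooth_map_id M) symp comp (iota q).
pose eps x := expi (- f x) \*o bundle_map id symp comp comp' x (e x).
have sm : smooth_at (iota q) (fun x => - f x) by exact: smooth_atN.
have ueps : unit_section id w I' (iota q) eps.
  apply: (unit_section_phase symp comp' (csmooth_at_expi sm)).
    by apply: nearW => x; exact: expi_normal.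
  exact: (unit_section_bundle_map (smooth_map_id M) symp comp comp' ue).
have ueps' := unit_section_pullback sF ueps.
have ss' := smooth_section_pullback sF ss.
rewrite (conn_frame sF symp comp' hb' v ueps' ss').
rewrite (conn_frame (smooth_map_id M) symp comp' ref'.1 (tmap iota q v) ueps ss).
have cst := csmooth_hK (smooth_map_id M) symp comp' ss (unit_section_smooth ueps).
rewrite -(ctderiv_comp sF v cst) (f_gauge _ ue).
have -> : conn_form id w I a e (iota q) (tmap iota q v) = conn_form iota w I b (e \o iota) q v.
  by rewrite /conn_form (res.2 q e v (unit_section_smooth ue)).
rewrite -(conn_form_transfer v ue).
have -> : (fun p => expi (- f (iota p)) \*o Phi p (e (iota p))) = eps \o iota.
  by apply/funext => p; rewrite /eps /= -bundle_map_pullback.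
by [].
Qed.

Lemma relating_changed_gauge : relating_gauge w iota I' a' changed_gauge.
Proof.
split.
- exact: csmooth_changed_gauge.
- by move=> q; apply/normc1P; exact: changed_gauge_normal.
exists b', (framed_connection iota w I' cs' (fun _ _ => 0)); split.
- exact: changed_restriction.
- exact: canonical_trivial_framed.
move=> q s v ss; apply: (framed_connectionD symp comp' changed_form v _ ss).
by move=> p; exact: canonical_section_unit.
Qed.

End GaugeTransfer.

(** * Homotopies and the Maslov class *)

Section Prism.
Context {R : realType} {X Y : topologicalType} (A : set Y) (h : cochain R Y).
Variables (H : X * R -> Y).
Hypotheses (cocycle_h : cocycle A h) (cH : continuous H) (AH : forall y, A (H y)).

(* The prism over a path is cut into two triangles along its diagonal. *)
Lemma homotopic_cohomologous :
  cohomologous [set: X] (fun s => h (fun t => H (s t, 0))) (fun s => h (fun t => H (s t, 1))).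
Proof.
have [heq htri] := cocycle_h.
(* The value of [h] on the vertical edge over x: once the diagonals cancel, the two vertical edges
   are all that separates bottom and top of the prism. *)
exists (fun x => - h (fun r => H (x, r))) => s [cs _].
(* A singular simplex is continuous only within [0, 1]; its clamped version makes the prism map
   continuous on the whole plane. The cocycle does not see the difference, by its first clause. *)
pose s' := s \o clamp.
have cs' : continuous s'.
  apply: (continuous_comp_within continuous_clamp _ cs) => t.
  by rewrite /= in_itv /=; exact: clamp01.
have s'E (t : R) : 0 <= t <= 1 -> s' t = s t by move=> t01; rewrite /s' /= clampK.
have cpair (T T' T'' : topologicalType) (f : T -> T') (g : T -> T'') :
    continuous f -> continuous g -> continuous (fun y => (f y, g y)).
  by move=> cf cg y; exact: (cvg_pair (cf y) (cg y)).
pose K (y : R * R) := H (s' y.1, y.2).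
have cK : continuous K.
  move=> y; apply: (@continuous_comp _ _ _ (fun y : R * R => (s' y.1, y.2)) H); last exact: cH.
  apply: cpair; last by move=> z; exact: cvg_snd.
  by move=> z; apply: continuous_comp; [exact: cvg_fst|exact: cs'].
have slice (r : R) : continuous (fun t : R => K (t, r)).
  by move=> t; apply: continuous_comp; [exact: continuous_pairl|exact: cK].
have tri (u v : R * R -> R) : continuous u -> continuous v ->
    h (fun t => K (u (1 - t, t), v (1 - t, t))) - h (fun t => K (u (0, t), v (0, t)))
    + h (fun t => K (u (t, 0), v (t, 0))) = 0.
  move=> cu cv; apply: (htri (fun y => K (u y, v y))); split; last by move=> z _; exact: AH.
  apply: continuous_subspaceT => y.
  by apply: (@continuous_comp _ _ _ (fun y : R * R => (u y, v y)) K); [exact: cpair|exact: cK].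
have c1 : continuous (fun y : R * R => y.1) by move=> y; exact: cvg_fst.
have c2 : continuous (fun y : R * R => y.2) by move=> y; exact: cvg_snd.
have c12 : continuous (fun y : R * R => y.1 + y.2) by move=> y; apply: cvgD; [exact: c1|exact: c2].
(* The maps (x + y, y) and (y, x + y) send the standard triangle onto the halves of the square below
   and above the diagonal. *)
have := tri _ _ c12 c2; have := tri _ _ c2 c12.
have E1 (t : R) : 1 - t + t = 1 by rewrite subrK.
have -> : (fun t => K ((1 - t, t).1 + (1 - t, t).2, (1 - t, t).2)) = (fun t => K (1, t)).
  by apply/funext => t /=; rewrite E1.
have -> : (fun t => K ((1 - t, t).2, (1 - t, t).1 + (1 - t, t).2)) = (fun t => K (t, 1)).
  by apply/funext => t /=; rewrite E1.
have -> : (fun t : R => K (((0 : R), t).1 + ((0 : R), t).2, ((0 : R), t).2)) = (fun t => K (t, t)).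
  by apply/funext => t /=; rewrite add0r.
have -> : (fun t : R => K (((0 : R), t).2, ((0 : R), t).1 + ((0 : R), t).2)) = (fun t => K (t, t)).
  by apply/funext => t /=; rewrite add0r.
have -> : (fun t : R => K ((t, (0 : R)).1 + (t, (0 : R)).2, (t, (0 : R)).2)) = (fun t => K (t, 0)).
  by apply/funext => t /=; rewrite addr0.
have -> : (fun t : R => K ((t, (0 : R)).2, (t, (0 : R)).1 + (t, (0 : R)).2)) = (fun t => K (0, t)).
  by apply/funext => t /=; rewrite addr0.
have edge (r : R) : h (fun t => H (s t, r)) = h (fun t => K (t, r)).
  apply: heq.
  - split; last by move=> t _; exact: AH.
    apply: (@subspace_eq_continuous _ _ _ (fun t => K (t, r))).
      by move=> t; rewrite inE /= in_itv /= => t01; rewrite /K /= s'E.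
    exact: continuous_subspaceT.
  - split; last by move=> t _; exact: AH.
    exact: continuous_subspaceT.
  - by move=> t t01; rewrite /K /= s'E.
rewrite !edge -(s'E 1) ?lexx ?ler01 // -(s'E 0) ?lexx ?ler01 //.
rewrite -/(K _).
move: (h (fun t => K (t, 0))) (h (fun t => K (t, 1))) (h (fun t => K (t, t))) => x0 x1 x2.
rewrite -[h (fun r => H (s' 1, r))]/(h (fun r => K (1, r))) -[h (fun r => H (s' 0, r))]/(h (fun r => K (0, r))).
move: (h (fun t => K (1, t))) (h (fun t => K (0, t))) => y1 y0 e1 e2.
by lra.
Qed.

End Prism.

Lemma cohomologous_trans (R : realType) (X : topologicalType) (A : set X) (c c' c'' : cochain R X) :
  cohomologous A c c' -> cohomologous A c' c'' -> cohomologous A c c''.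
Proof.
move=> [f fP] [f' fP']; exists (fun x => f x + f' x) => s ss.
have := fP s ss; have := fP' s ss.
move: (c s) (c' s) (c'' s) (f (s 1)) (f (s 0)) (f' (s 1)) (f' (s 0)) => x y z a b a' b' e1 e2.
by lra.
Qed.

Section MaslovClass.
Context {R : realType} {n : nat} (M : manifold R (2 * n)) (w : M -> 'M[R]_(2 * n)).
Variables (S : manifold R n) (iota : S -> M) (I I' : M -> 'M[R]_(2 * n)).
Hypotheses (symp : symplectic w) (lag : lagrangian w iota).
Hypotheses (comp : compatible w I) (comp' : compatible w I').

Lemma gauge_change0 (f : M -> R) p : gauge_change w iota I I' f 0 p = 1.
Proof.
rewrite /gauge_change (phase0 symp lag comp comp') mulr1 mul0r oppr0 /expi cos0 sin0.
by [].
Qed.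

Lemma gauge_change_continuous (f : M -> R) q (r : R) : (forall x, smooth_at x f) ->
  ccontinuous_at (q, r) (fun y : S * R => gauge_change w iota I I' f y.2 y.1).
Proof.
move=> sf; apply: ccontinuousM; last exact: (phase_continuous symp lag comp comp').
have cf : {for (q, r), continuous (fun y : S * R => - (y.2 * f (iota y.1)))}.
  have c2 : {for (q, r), continuous (fun y : S * R => y.2)} by move=> A nA; exact: (cvg_snd nA).
  have c1 : {for (q, r), continuous (fun y : S * R => f (iota y.1))}.
    apply: (@continuous_comp _ _ _ (fun y : S * R => y.1) (fun p => f (iota p))).
      by move=> A nA; exact: (cvg_fst nA).
    exact: (smooth_at_continuous (smooth_at_comp (lagrangian_smooth_map lag) (sf (iota q)))).
  exact: (cvgN (cvgM c2 c1)).
split; rewrite /expi /=.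
  exact: (continuous_comp cf (@continuous_cos R _)).
exact: (continuous_comp cf (@continuous_sin R _)).
Qed.

(** The representing cocycle and the generator [h] are kept; only the gauge transformation is
    replaced, by one homotopic to it through maps into the circle. The roles of the two structures
    can be exchanged, so one inclusion suffices. *)
Lemma maslov_class_sub (k : R) (a a' : @connection R n (2 * n) M) :
  simply_connected R M -> orientable S ->
  reference_connection w k I a -> reference_connection w k I' a' ->
  maslov_class w iota I a `<=` maslov_class w iota I' a'.
Proof.
move=> sc ori ref ref' c [cc [g [h [rg hh cch]]]]; split=> //.
have [f [sf fg]] := gauge_function symp comp comp' ref ref' sc.
have [sg g1 [b [A0 [res can rel]]]] := rg.
have gn q : g q * (g q)^*%C = 1 by apply/normc1P.
pose g' := changed_gauge w iota I I' f g.
exists g', h; split=> //.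
  exact: (relating_changed_gauge lag ori ref' sf fg sg gn res can rel).
apply: (cohomologous_trans cch).
(* At r = 0 this is g, at r = 1 the changed gauge, and it has modulus 1 throughout. *)
pose G (y : S * R) := g y.1 * (gauge_change w iota I I' f y.2 y.1)^*%C.
pose H (y : S * R) := (Re (G y), Im (G y)).
have cG q r : ccontinuous_at (q, r) G.
  apply: ccontinuousM; last by apply: ccontinuous_conj; exact: gauge_change_continuous.
  have cfst : {for (q, r), continuous (fun y : S * R => y.1)} by move=> A nA; exact: (cvg_fst nA).
  have [sr si] := sg q.
  split; first exact: (continuous_comp cfst (smooth_at_continuous sr)).
  exact: (continuous_comp cfst (smooth_at_continuous si)).
have cH : continuous H.
  by move=> [q r]; have [cr ci] := cG q r; exact: (cvg_pair cr ci).
have circH y : circle R (H y).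
  have : G y * (G y)^*%C = 1.
    rewrite /G (cconjM (g y.1)) cconjK mulrACA gn mul1r mulrC.
    exact: (gauge_change_normal symp lag comp comp').
  by rewrite normc_sqr_real => -[].
have K := homotopic_cohomologous hh.1 cH circH.
have E : (fun s : R -> S => h (fun t => H (s t, 0))) = (fun s => h (fun t => (Re (g (s t)), Im (g (s t))))).
  apply/funext => s; congr h; apply/funext => t.
  by rewrite /H /G /= gauge_change0 conjc1 mulr1.
by move: K; rewrite [X in cohomologous _ X]E.
Qed.

End MaslovClass.

Theorem proposition1 (R : realType) (n : nat) (M : manifold R (2 * n))
    (omega : M -> 'M[R]_(2 * n)) (k : R) (S : manifold R n) (iota : S -> M)
    (omega_symplectic : symplectic omega)
    (M_compact : compact [set: M])
    (M_simply_connected : simply_connected R M)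
    (M_pseudo_einstein : pseudo_einstein omega k)
    (S_lagrangian : lagrangian omega iota)
    (S_orientable : orientable S)
    (S_bohr_sommerfeld : bohr_sommerfeld omega iota k)
    (I I' : M -> 'M[R]_(2 * n)) (a a' : connection M)
    (I_compatible : compatible omega I)
    (I'_compatible : compatible omega I')
    (a_reference : reference_connection omega k I a)
    (a'_reference : reference_connection omega k I' a') :
  maslov_class omega iota I a = maslov_class omega iota I' a'.
Proof.
rewrite eqEsubset; split.
  exact: (maslov_class_sub omega_symplectic S_lagrangian I_compatible I'_compatible
    M_simply_connected S_orientable a_reference a'_reference).
exact: (maslov_class_sub omega_symplectic S_lagrangian I'_compatible I_compatible
  M_simply_connected S_orientable a'_reference a_reference).
Qed.
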